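(* (1) Let $g\ge0$ be measurable on $\mathbb{C}$. The Toeplitz form $\mathfrak{t}_g$ is bounded on $F^2(\mathbb{C})\times F^2(\mathbb{C})$ if and only if $g\,d\mu$ is a Fock--Carleson measure, equivalently \[ \sup_{a\in\mathbb{C}}\frac1\pi\int_{\mathbb{C}}e^{-|z-a|^2}g(z)\,dA(z)<\infty, \] which is the same as $\|g^{(1/4)}\|_{L^\infty(\mathbb{C})}<\infty$. (2) Let $g:\mathbb{C}\to\mathbb{C}$ be measurable. The Toeplitz operator on the natural domain $U_g$, from $L^2(\mu)$ to $F^2(\mathbb{C})$, is bounded if and only if $|g|^2\,d\mu$ is a Fock--Carleson measure, equivalently \[ \sup_{a\in\mathbb{C}}\frac1\pi\int_{\mathbb{C}}e^{-|z-a|^2}|g(z)|^2\,dA(z)<\infty . \] Moreover, for the smoothed annuli symbol $g=\sum_{n\ge2}d_n\psi_n$ described in the context, all heat transforms $g^{(t)}$, $t>0$, are bounded, and the supremum condition in (1) holds while the supremum condition in (2) fails.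
   Context: $dA$ is planar Lebesgue measure, $d\mu(z)=\pi^{-1}e^{-|z|^2}\,dA(z)$, and $F^2(\mathbb{C})$ is the Bargmann space of entire $f$ with $\|f\|_{F^2}^2=\int_{\mathbb{C}}|f|^2\,d\mu<\infty$. $P:L^2(\mu)\to F^2(\mathbb{C})$ is the orthogonal projection. A positive Borel measure $\nu$ on $\mathbb{C}$ is a Fock--Carleson measure if there is $C>0$ with $\int_{\mathbb{C}}|h|^2\,d\nu\le C\|h\|_{F^2}^2$ for all $h\in F^2(\mathbb{C})$. Heat transform: $g^{(t)}(x)=\frac{1}{4\pi t}\int_{\mathbb{C}}g(y)e^{-|x-y|^2/(4t)}\,dA(y)$ for $t>0$. Toeplitz form: $\mathcal{D}(\mathfrak{t}_g)=\{f\in F^2(\mathbb{C}):|g|^{1/2}f\in L^2(\mu)\}$ and $\mathfrak{t}_g(f,h)=\int_{\mathbb{C}}gf\overline h\,d\mu$ for $f,h\in\mathcal{D}(\mathfrak{t}_g)$. The form is called bounded on $F^2\times F^2$ if $\mathcal{D}(\mathfrak{t}_g)$ is dense in $F^2(\mathbb{C})$ and $|\mathfrak{t}_g(f,h)|\le C\|f\|_{F^2}\|h\|_{F^2}$ on $\mathcal{D}(\mathfrak{t}_g)\times\mathcal{D}(\mathfrak{t}_g)$ for some $C>0$ (so that it extends to a bounded form on $F^2\times F^2$). Natural-domain operator: $\mathcal{D}(M_g)=\{f\in L^2(\mu):gf\in L^2(\mu)\}$, $U_gf=P(gf)$ for $f\in\mathcal{D}(M_g)$; it is bounded if $\|U_gf\|_{F^2}\le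 C\|f\|_{L^2(\mu)}$ on $\mathcal{D}(M_g)$ for some $C>0$. Smoothed annuli symbol: for $n\ge2$ let $a_n=\sqrt n$, $\rho_n=n^{-9/2}$, $d_n=n^{5/2}\log n$, $A_n=\{z\in\mathbb{C}:||z|-a_n|\le\rho_n\}$ (pairwise disjoint annuli, with area $|A_n|$). For each $n\ge2$ let $\psi_n\in C_c^\infty(\mathbb{C})$ be radial with $\operatorname{supp}\psi_n\subset A_n$, $0\le\psi_n\le1$, and $\int_{\mathbb{C}}\psi_n\,dA\ge c_1|A_n|$ with $c_1>0$ independent of $n$. Then $g=\sum_{n\ge2}d_n\psi_n$. *)

(* Defs.v *)
From HB Require Import structures.
From mathcomp Require Import all_boot all_order all_algebra.
From mathcomp Require Import all_classical all_reals all_analysis.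
From mathcomp Require Export complex.
From mathcomp Require Import measurable_realfun lra.

Set Implicit Arguments.
Unset Strict Implicit.
Unset Printing Implicit Defensive.
Import Order.TTheory GRing.Theory Num.Theory numFieldNormedType.Exports.
Import ComplexField.
Local Open Scope classical_set_scope.
Local Open Scope ring_scope.
Local Open Scope complex_scope.

(* Real-valued modulus (the norm `|z| of the library lives in R[i]). *)
Notation normc := Normc.normc.

(* C carries the topology of its modulus, as a normed space over itself, so
   that [derivable f z 1] is complex differentiability of f at z. *)
HB.instance Definition _ (R : realType) := NormedModule.copy R[i] R[i]^o.

(* Borel sigma-algebra of C. *)
HB.instance Definition _ (R : realType) :=
  Measurable.copy R[i] (g_sigma_algebraType (@open R[i])).

Section plane.
Variable R : realType.

Definition of_xy (p : R * R) : R[i] := p.1 +i* p.2.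

Lemma normc_norm (z : R[i]) : (normc z)%:C = `|z|.
Proof. by rewrite normc_def; case: z. Qed.

Lemma measurable_open_preimage (U : set R[i]) :
  open U -> measurable (of_xy @^-1` U).
Proof.
move=> oU.
pose box (a b c d : rat) : set (R * R) :=
  `]ratr a, ratr b[%classic `*` `]ratr c, ratr d[%classic.
have -> : of_xy @^-1` U =
    \bigcup_a \bigcup_b \bigcup_c \bigcup_d
      (if `[< box a b c d `<=` of_xy @^-1` U >] then box a b c d else set0).
  apply/seteqP; split => [[x y] Uxy|[x y]]; last first.
    move=> /= [a _ [b _ [c _ [d _]]]]; case: ifPn => // /asboolP sub.
    exact: sub.
  have : nbhs (of_xy (x, y)) U by apply: open_nbhs_nbhs; split.
  rewrite -nbhs_ballE => -[e /= e0 eU].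
  move: e0; rewrite /= ltcE/= => /andP[/eqP ime e0].
  have h0 : 0 < complex.Re e / 2 by lra.
  have ltxl (t : R) : t - complex.Re e / 2 < t by rewrite ltrBlDr ltrDl.
  have ltxr (t : R) : t < t + complex.Re e / 2 by rewrite ltrDl.
  have [a ha] := rat_in_itvoo (ltxl x).
  have [b hb] := rat_in_itvoo (ltxr x).
  have [c hc] := rat_in_itvoo (ltxl y).
  have [d hd] := rat_in_itvoo (ltxr y).
  move: ha hb hc hd; rewrite !in_itv/=.
  move=> /andP[a1 a2] /andP[b1 b2] /andP[c1 c2] /andP[d1 d2].
  exists a => //; exists b => //; exists c => //; exists d => //.
  case: ifPn => [_|/asboolP[]]; first by split; rewrite /= in_itv/= ?a2 ?c2.
  move=> [u v] [/=]; rewrite !in_itv/= => /andP[u1 u2] /andP[v1 v2].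
  apply: eU; rewrite -ball_normE /=.
  apply: (@le_lt_trans _ _ (`|x - u| + `|y - v|)%:C).
    have -> : of_xy (x, y) - of_xy (u, v) = (x - u)%:C + 'i * (y - v)%:C.
      by rewrite /of_xy; simpc.
    rewrite rmorphD/= (le_trans (ler_normD _ _))// normrM.
    rewrite !normc_def/= !(expr0n, addr0, expr1n, add0r, sqrtr1, sqrtr_sqr, mul1r)/=.
    by rewrite normr1 mul1r rmorphD.
  rewrite ltcE /= ime eqxx/= (splitr (complex.Re e)) ltrD// ltr_norml.
    by apply/andP; split; lra.
  by apply/andP; split; lra.
do 4 (apply: bigcupT_measurable_rat => ?).
case: ifPn => _; last exact: measurable0.
by apply: measurableX; exact: measurable_itv.
Qed.

Lemma measurable_of_xy : measurable_fun [set: R * R] of_xy.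
Proof.
apply: (measurability (@open R[i])) => //.
by move=> _ [U oU <-]; rewrite setTI; exact: measurable_open_preimage.
Qed.

(* Planar Lebesgue measure dA. *)
Definition area : set R[i] -> \bar R :=
  pushforward (lebesgue_measure \x lebesgue_measure)%E of_xy.

Let area0 : area set0 = 0%E.
Proof. by rewrite /area /pushforward preimage_set0 measure0. Qed.

Let area_ge0 A : (0 <= area A)%E.
Proof. by rewrite /area /pushforward; exact: measure_ge0. Qed.

Let area_sigma : semi_sigma_additive area.
Proof.
move=> F mF tF mUF; rewrite /area /pushforward preimage_bigcup.
apply: measure_semi_sigma_additive.
- by move=> n; rewrite -[X in measurable X]setTI; exact: measurable_of_xy.
- apply/trivIsetP => /= i j _ _ ij; rewrite -preimage_setI.
  by move/trivIsetP : tF => /(_ _ _ _ _ ij) ->//; rewrite preimage_set0.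
- by rewrite -preimage_bigcup -[X in measurable X]setTI;
    exact: measurable_of_xy.
Qed.

HB.instance Definition _ :=
  isMeasure.Build _ _ _ area area0 area_ge0 area_sigma.

Lemma open_preimage_normc (a b : R) :
  open ((@normc R : R[i] -> R) @^-1` `]a, b[%classic).
Proof.
rewrite openE => z /=; rewrite in_itv/= => /andP[az zb].
rewrite /interior /= -nbhs_ballE.
exists (Num.min (normc z - a) (b - normc z))%:C => /=.
  by rewrite ltcR lt_min !subr_gt0 az.
move=> w; rewrite -ball_normE /= -normc_norm ltcR lt_min in_itv/=.
move=> /andP[h1 h2].
have d1 : normc z <= normc w + normc (z - w).
  by rewrite -lecR rmorphD/= !normc_norm -{1}(subrK w z) addrC ler_normD.
have d2 : normc w <= normc z + normc (z - w).
  by rewrite -lecR rmorphD/= !normc_norm distrC -{1}(subrK z w) addrC ler_normD.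
by apply/andP; split; lra.
Qed.

Lemma measurable_normc : measurable_fun [set: R[i]] (@normc R).
Proof.
apply: (measurability _ (RGenOpens.measurableE R)).
move=> _ [_ [a [b ->] <-]]; rewrite setTI; apply: sub_sigma_algebra.
exact: open_preimage_normc.
Qed.

Lemma measurable_sqr_normc (g : R[i] -> R[i]) : measurable_fun setT g ->
  measurable_fun setT (fun z => normc (g z) ^+ 2).
Proof.
move=> mg; apply: measurable_funX.
exact: (measurableT_comp measurable_normc).
Qed.

Lemma sqr_normc_ge0 (g : R[i] -> R[i]) z : 0 <= normc (g z) ^+ 2.
Proof. exact: sqr_ge0. Qed.

End plane.

(* The measure w dm, for a measurable function w >= 0. *)
Section density.
Context d (T : measurableType d) (R : realType).
Variables (m : {measure set T -> \bar R}) (w : T -> R).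
Hypotheses (mw : measurable_fun [set: T] w) (w0 : forall x, 0 <= w x).

Definition density of measurable_fun [set: T] w & (forall x, 0 <= w x) :=
  fun A : set T => (\int[m]_(x in A) (w x)%:E)%E.

Local Notation nu := (density mw w0).

Let density0 : nu set0 = 0%E.
Proof. exact: integral_set0. Qed.

Let density_ge0 A : (0 <= nu A)%E.
Proof. by apply: integral_ge0 => x _; rewrite lee_fin. Qed.

Let density_sigma : semi_sigma_additive nu.
Proof.
apply: (@semi_sigma_additive_nng_induced _ _ _ m (EFin \o w)).
  exact/measurable_EFinP.
by move=> x; rewrite lee_fin.
Qed.

HB.instance Definition _ :=
  isMeasure.Build _ _ _ nu density0 density_ge0 density_sigma.

End density.

Section bargmann.
Variable R : realType.
Implicit Types (f h p g : R[i] -> R[i]).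

Definition gauss (z : R[i]) : R := pi^-1 * expR (- normc z ^+ 2).

Lemma measurable_gauss : measurable_fun setT gauss.
Proof.
apply: measurable_funM => //; apply: measurableT_comp => //.
apply: measurableT_comp => //; apply: measurable_funX.
exact: measurable_normc.
Qed.

Lemma gauss_ge0 z : 0 <= gauss z.
Proof. by rewrite mulr_ge0 ?expR_ge0// invr_ge0 pi_ge0. Qed.

Definition mu : {measure set R[i] -> \bar R} :=
  density (@area R) measurable_gauss gauss_ge0.

Definition sqL2norm f : \bar R := (\int[mu]_z (normc (f z) ^+ 2)%:E)%E.

(* L^2(mu) by Borel representatives. *)
Definition L2 f := measurable_fun setT f /\ (sqL2norm f < +oo)%E.

(* Meaningful for sqL2norm f < +oo only: fine +oo = 0. *)
Definition L2norm f : R := Num.sqrt (fine (sqL2norm f)).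

Definition inner f h : R[i] :=
  (\int[mu]_z complex.Re (f z * (h z)^*)) +i* (\int[mu]_z complex.Im (f z * (h z)^*)).

Definition entire f := forall z : R[i], derivable f z 1.

(* For f in F2, ||f||_{F^2} is [L2norm f]. *)
Definition F2 f := entire f /\ (sqL2norm f < +oo)%E.

Definition is_F2_projection f p :=
  F2 p /\ forall h, F2 h -> inner (fun z => f z - p z) h = 0.

(* Orthogonal projection of L^2(mu) onto F^2.  It exists and is unique for every
   f in L2; the default value 0 only concerns f outside L2. *)
Definition proj_F2 f : R[i] -> R[i] :=
  xget (fun=> 0) [set p | is_F2_projection f p].

Definition Fock_Carleson (nu : {measure set R[i] -> \bar R}) :=
  exists C : R, 0 < C /\
    forall h, F2 h ->
      (\int[nu]_z (normc (h z) ^+ 2)%:E <= (C * L2norm h ^+ 2)%:E)%E.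

(* Extended-real valued: the integral may diverge. *)
Definition heat (t : R) (g : R[i] -> R) (x : R[i]) : \bar R :=
  ((4 * pi * t)^-1%:E *
   \int[@area R]_y (g y * expR (- (normc (x - y) ^+ 2 / (4 * t))))%:E)%E.

Definition gauss_sup (w : R[i] -> R) : \bar R :=
  ereal_sup (range (fun a : R[i] =>
    (pi^-1%:E *
     \int[@area R]_z (expR (- normc (z - a) ^+ 2) * w z)%:E)%E)).

Definition form_domain g f :=
  F2 f /\ L2 (fun z => (Num.sqrt (normc (g z)))%:C * f z).

Definition toeplitz_form g f h : R[i] := inner (fun z => g z * f z) h.

Definition form_bounded g :=
  (forall f, F2 f -> forall e : R, 0 < e ->
     exists2 h, form_domain g h & L2norm (fun z => f z - h z) < e) /\
  (exists C : R, 0 < C /\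
     forall f h, form_domain g f -> form_domain g h ->
       normc (toeplitz_form g f h) <= C * L2norm f * L2norm h).

Definition mult_domain g f := L2 f /\ L2 (fun z => g z * f z).

Definition toeplitz_op g f : R[i] -> R[i] := proj_F2 (fun z => g z * f z).

Definition op_bounded g :=
  exists C : R, 0 < C /\
    forall f, mult_domain g f -> L2norm (toeplitz_op g f) <= C * L2norm f.

End bargmann.

Section smooth.
Variable R : realType.

(* C^k on the real plane, by existence of the partial derivatives and their
   regularity. *)
Fixpoint Ck (k : nat) (f : R * R -> R) : Prop :=
  if k is k'.+1 then
    [/\ continuous f,
        (forall p, derivable f p (1, 0)), Ck k' (fun p => 'D_(1, 0) f p),
        (forall p, derivable f p (0, 1)) & Ck k' (fun p => 'D_(0, 1) f p)]
  else continuous f.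

Definition supp (f : R[i] -> R) : set R[i] := closure [set z | f z != 0].

Definition smooth_compact (f : R[i] -> R) :=
  (forall k, Ck k (f \o @of_xy R)) /\ compact (supp f).

Definition radial (f : R[i] -> R) :=
  forall z w, normc z = normc w -> f z = f w.

End smooth.

Section annuli.
Variable R : realType.

Definition ann_radius (n : nat) : R := Num.sqrt n%:R.
Definition ann_width (n : nat) : R := n%:R `^ (- (9 / 2)).
Definition ann_height (n : nat) : R := n%:R `^ (5 / 2) * ln n%:R.

Definition annulus (n : nat) : set R[i] :=
  [set z | `|normc z - ann_radius n| <= ann_width n].

Definition annular_bumps (c1 : R) (psi : nat -> R[i] -> R) :=
  forall n, (2 <= n)%N ->
    [/\ smooth_compact (psi n), radial (psi n),
        supp (psi n) `<=` annulus n,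
        (forall z, 0 <= psi n z <= 1) &
        (c1%:E * area (annulus n) <= \int[@area R]_z (psi n z)%:E)%E].

(* The series is pointwise a finite sum, the annuli being disjoint. *)
Definition annuli_symbol (psi : nat -> R[i] -> R) (z : R[i]) : R :=
  limn (fun N => \sum_(2 <= n < N) ann_height n * psi n z).

End annuli.

(* Main.v *)
From HB Require Import structures.
Require Import Defs.
From mathcomp Require Import all_boot all_order all_algebra.
From mathcomp Require Import all_classical all_reals all_analysis.
From mathcomp Require Import measurable_realfun lra ring.
Set Implicit Arguments.
Unset Strict Implicit.
Unset Printing Implicit Defensive.
Import Order.TTheory GRing.Theory Num.Theory numFieldNormedType.Exports.
Import ComplexField.
Local Open Scope classical_set_scope.
Local Open Scope ring_scope.
Local Open Scope complex_scope.

(** Every criterion compares the symbol, or the square of its modulus, with its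
    averages against Gaussians e^(-|z - a|^2), and the whole comparison rests on the
    mean value property of entire functions against an integrable radial weight
    ([radial_mean]). That property comes from Goursat's theorem
    ([circulation_eq0]) applied to f(e^(s + i t)) on a rectangle of height 2 pi,
    which gives the mean over circles ([circle_mean]), and from the invariance of
    the area under rotations, which are products of shears ([area_rotate]).
    Two choices of the entire function give the two facts needed about F^2: the
    weighted modulus |f|^2 e^(-|z|^2) is dominated by its own Gaussian averages
    ([Fock_local]), and e^(conj(a) z) is the reproducing kernel ([reproducing]).

    Carleson measures. If the Gaussian averages of g are bounded, then [Fock_local]
    and Tonelli's theorem give the Carleson inequality ([gauss_sup_Carleson]).
    Conversely, the Carleson inequality for the normalized kernel at a is the bound
    on the average at a ([Carleson_gauss_sup]). The heat transform at time 1/4 is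
    this average, and a bound almost everywhere gives a bound everywhere
    ([gauss_sup_Lnorm]).

    Toeplitz form. If g dmu is a Carleson measure, the form is bounded by the
    Cauchy-Schwarz inequality. Conversely, the bound on the diagonal is the Carleson
    inequality on the form domain; it extends to F^2 by density, after truncation to
    the sets g <= n ([form_bounded_Carleson]).

    Toeplitz operator. If |g|^2 dmu is a Carleson measure and p is the projection of
    g f, then ||p||^2 = <f, conj(g) p> bounds ||p|| by a multiple of ||f||
    ([Carleson_op_bounded]). Conversely, the operator is tested on
    f = conj(g) h 1_A, with |g| and |z| bounded on A ([op_bounded_Carleson]). This
    requires that g f have a projection, which for a function supported in a disc is
    its integral against the reproducing kernel ([projection_exists]).

    The annuli symbol. Since d_n |A_n| is of the order of n^(-3/2) ln n, the symbol
    is integrable over the plane ([integral_symbol]), so that its heat transforms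
    and its Gaussian averages are bounded. However d_n^2 |A_n| is of the order of
    n (ln n)^2, which for large n exceeds any multiple of the area of the disc of
    radius 2 sqrt(n) containing A_n; averaging over the centres in that disc shows
    that the averages of g^2 are not bounded ([sqr_mass_bound]). *)

(** * Goursat's theorem on a rectangle *)

Section goursat.
Variable R : realType.
Local Notation leb := (@lebesgue_measure R).

(** The corner [u n] of the n-th interval, of length [L / 2 ^ n], moves so that
    the intervals are nested. *)
Lemma nested_intervals (u : nat -> R) (L : R) : 0 <= L ->
  (forall n, u n <= u n.+1 <= u n + L / 2 ^+ n.+1) ->
  exists x, forall n, u n <= x <= u n + L / 2 ^+ n.
Proof.
move=> L0 uL.
have uS m k : u m <= u (m + k)%N.
  elim: k => [|k ih]; first by rewrite addn0.
  by rewrite (le_trans ih)// addnS; case/andP: (uL (m + k)%N).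
have uD m k : u (m + k)%N + L / 2 ^+ (m + k) <= u m + L / 2 ^+ m.
  elim: k => [|k]; first by rewrite addn0.
  apply: le_trans; rewrite addnS; have /andP[_] := uL (m + k)%N.
  rewrite -(lerD2r (L / 2 ^+ (m + k).+1)) => /le_trans; apply.
  by rewrite exprS invfM; set t := (2 ^+ _)^-1; lra.
have ub m n : u m <= u n + L / 2 ^+ n.
  have h2 k : 0 <= L / 2 ^+ k by rewrite divr_ge0// exprn_ge0.
  have [mn|nm] := leqP m n.
    by rewrite -(subnKC mn) (le_trans (uS m (n - m)%N))// lerDl.
  rewrite -(subnKC (ltnW nm)); apply: le_trans (uD n (m - n)%N).
  by rewrite lerDl.
exists (sup (range u)) => n; apply/andP; split.
  apply: ub_le_sup; last by exists n.
  by exists (u 0%N + L / 2 ^+ 0) => _ [m _ <-].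
by apply: ge_sup; [exists (u n), n | move=> _ [m _ <-]].
Qed.

Lemma continuous_itv_integrable (f : R -> R) (a b : R) : continuous f ->
  leb.-integrable `[a, b] (EFin \o f).
Proof.
move=> cf; apply: continuous_compact_integrable; first exact: segment_compact.
exact: continuous_subspaceT.
Qed.

Lemma Rintegral_itv_split (f : R -> R) (a m b : R) : continuous f ->
  a <= m -> m <= b ->
  \int[leb]_(x in `[a, b]) f x =
  \int[leb]_(x in `[a, m]) f x + \int[leb]_(x in `[m, b]) f x.
Proof.
move=> cf am mb.
have := @Rintegral_itvB R f (BLeft a) (BRight b) m
  (continuous_itv_integrable _ _ cf).
rewrite !bnd_simp => /(_ am mb) e.
rewrite -(Rintegral_itv_obnd_cbnd (f := f) (r := m)); last first.
  apply: (integrableS _ _ _ (continuous_itv_integrable m b cf)) => //.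
  exact: subset_itv_oc_cc.
by rewrite -e addrC subrK.
Qed.

Lemma Rintegral_itv_cst (a b c : R) : a <= b ->
  \int[leb]_(x in `[a, b]) c = c * (b - a).
Proof.
move=> ab; rewrite Rintegral_cst //=.
rewrite lebesgue_measure_itv /= lte_fin; move: ab; rewrite le_eqVlt.
by move=> /predU1P[->|ab]; [rewrite ltxx subrr|rewrite ab].
Qed.

(** The form P dx + Q dy is closed at (x0, y0): P and Q are differentiable there,
    with dP = q dx + p dy and dQ = p dx + r dy sharing the mixed coefficient p.
    Only differentiability at the point is asked, not continuity of the partial
    derivatives, which is what Goursat's argument needs. *)
Definition closed_form_at (P Q : R -> R -> R) (x0 y0 : R) :=
  exists p q r : R, forall e, 0 < e -> exists2 d : R, 0 < d &
    forall x y, `|x - x0| <= d -> `|y - y0| <= d ->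
    `|P x y - P x0 y0 - q * (x - x0) - p * (y - y0)|
      <= e * (`|x - x0| + `|y - y0|) /\
    `|Q x y - Q x0 y0 - p * (x - x0) - r * (y - y0)|
      <= e * (`|x - x0| + `|y - y0|).

Lemma lipschitz_continuous_at (f : R -> R) (x0 K d : R) : 0 < d -> 0 <= K ->
  (forall x, `|x - x0| <= d -> `|f x - f x0| <= K * `|x - x0|) ->
  {for x0, continuous f}.
Proof.
move=> d0 K0 fK; apply/cvgrPdist_le => /= e e0; near=> x.
have xd : `|x - x0| <= d.
  by rewrite distrC; near: x; apply: cvgr_dist_le; [exact: cvg_id | exact: d0].
rewrite distrC (le_trans (fK _ xd))//.
apply: (@le_trans _ _ ((K + 1) * `|x - x0|)); first by rewrite ler_wpM2r// lerDl.
rewrite mulrC -ler_pdivlMr ?ltr_wpDl//.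
rewrite distrC; near: x; apply: cvgr_dist_le; first exact: cvg_id.
by rewrite divr_gt0// ltr_wpDl.
Unshelve. all: end_near. Qed.

Section forms.
Variables P Q : R -> R -> R.
Hypothesis PQ : forall x y, closed_form_at P Q x y.

Lemma closed_form_continuousP y : continuous (P ^~ y).
Proof.
move=> x; have [p [q [r /(_ 1 ltr01)[d d0 h]]]] := PQ x y.
apply: (@lipschitz_continuous_at _ _ (`|q| + 1) d) => //.
move=> x' xd; have := h x' y xd; rewrite subrr normr0 (ltW d0) => /(_ isT)[+ _].
rewrite mulr0 subr0 addr0 mul1r => hh.
rewrite -[P x' y - P x y](subrK (q * (x' - x))) (le_trans (ler_normD _ _))//.
by rewrite normrM mulrDl mul1r addrC lerD2l.
Qed.

Lemma closed_form_continuousQ x : continuous (Q x).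
Proof.
move=> y; have [p [q [r /(_ 1 ltr01)[d d0 h]]]] := PQ x y.
apply: (@lipschitz_continuous_at _ _ (`|r| + 1) d) => //.
move=> y' yd; have := h x y' _ yd; rewrite subrr normr0 (ltW d0) => /(_ isT)[_].
rewrite mulr0 subr0 add0r mul1r => hh.
rewrite -[Q x y' - Q x y](subrK (r * (y' - y))) (le_trans (ler_normD _ _))//.
by rewrite normrM mulrDl mul1r addrC lerD2l.
Qed.

(** The integral of P dx + Q dy along the boundary of [a, b] x [c, d], run
    counterclockwise, with the opposite sides already paired. *)
Definition circulation (a b c d : R) :=
  \int[leb]_(x in `[a, b]) (P x c - P x d) +
  \int[leb]_(y in `[c, d]) (Q b y - Q a y).

Let cP c d : continuous (fun x => P x c - P x d).
Proof. by move=> x; apply: cvgB; exact: closed_form_continuousP. Qed.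
Let cQ a b : continuous (fun y => Q b y - Q a y).
Proof. by move=> x; apply: cvgB; exact: closed_form_continuousQ. Qed.

Lemma circulation_splith a m b c d : a <= m -> m <= b ->
  circulation a b c d = circulation a m c d + circulation m b c d.
Proof.
move=> am mb; rewrite /circulation (Rintegral_itv_split (@cP c d) am mb).
rewrite addrACA -RintegralD//; try exact: continuous_itv_integrable.
by congr (_ + _); apply: eq_Rintegral => y _; ring.
Qed.

Lemma circulation_splitv a b c m d : c <= m -> m <= d ->
  circulation a b c d = circulation a b c m + circulation a b m d.
Proof.
move=> cm md; rewrite /circulation (Rintegral_itv_split (@cQ a b) cm md).
rewrite addrACA -RintegralD//; try exact: continuous_itv_integrable.
by congr (_ + _); apply: eq_Rintegral => y _; ring.
Qed.

(** If, between opposite sides, P and Q vary as the coefficients of the exact form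
    p (y dx + x dy) do, up to e, then the circulation is at most e times half the
    perimeter. *)
Lemma circulation_le (a b c d p e : R) : a <= b -> c <= d ->
  (forall x, x \in `[a, b] -> `|P x c - P x d + p * (d - c)| <= e) ->
  (forall y, y \in `[c, d] -> `|Q b y - Q a y - p * (b - a)| <= e) ->
  `|circulation a b c d| <= e * (b - a + (d - c)).
Proof.
move=> ab cd hP hQ.
have est (f : R -> R) u v k : u <= v -> continuous f ->
    (forall x, x \in `[u, v] -> `|f x - k| <= e) ->
    `|\int[leb]_(x in `[u, v]) f x - k * (v - u)| <= e * (v - u).
  move=> uv cf fk.
  have cf' : continuous (fun x => f x - k).
    by move=> x; apply: cvgB; [exact: cf|exact: cvg_cst].
  have icst (z : R) : leb.-integrable `[u, v] (EFin \o cst z).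
    by apply: continuous_itv_integrable => ?; exact: cvg_cst.
  rewrite -(Rintegral_itv_cst k uv) -RintegralB//; last 2 first.
  - exact: continuous_itv_integrable.
  - exact: icst.
  rewrite (le_trans (le_normr_Rintegral _ _))//.
    exact: continuous_itv_integrable.
  rewrite -(Rintegral_itv_cst e uv) le_Rintegral//.
    apply: continuous_itv_integrable => x.
    exact: cvg_norm (cf' x).
  exact: icst.
have h1 := est _ a b (- (p * (d - c))) ab (@cP c d).
have h2 := est _ c d (p * (b - a)) cd (@cQ a b).
rewrite mulrDr (le_trans _ (lerD (h1 _) (h2 hQ)))//.
  rewrite (le_trans _ (ler_normD _ _))//.
  set s := (X in _ <= `|X|); suff -> : s = circulation a b c d by [].
  by rewrite /s /circulation; ring.
by move=> x xab; rewrite opprK hP.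
Qed.

(** The lower left corner of a quarter (of sides l and h) of the rectangle of
    lower left corner s and sides 2 l and 2 h, whose circulation is at least a
    quarter of the whole one in absolute value. *)
Definition quarter_step (l h : R) (s : R * R) : R * R :=
  let big t := `|circulation s.1 (s.1 + 2 * l) s.2 (s.2 + 2 * h)| / 4 <=
    `|circulation t.1 (t.1 + l) t.2 (t.2 + h)| in
  if big s then s else
  if big (s.1 + l, s.2) then (s.1 + l, s.2) else
  if big (s.1, s.2 + h) then (s.1, s.2 + h) else (s.1 + l, s.2 + h).

Lemma quarter_stepP (l h : R) (s : R * R) : 0 <= l -> 0 <= h ->
  let t := quarter_step l h s in
  [/\ `|circulation s.1 (s.1 + 2 * l) s.2 (s.2 + 2 * h)| / 4 <=
      `|circulation t.1 (t.1 + l) t.2 (t.2 + h)|,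
      s.1 <= t.1 <= s.1 + l & s.2 <= t.2 <= s.2 + h].
Proof.
move=> l0 h0 /=; rewrite /quarter_step.
have al : s.1 <= s.1 + l by rewrite lerDl.
have ah : s.2 <= s.2 + h by rewrite lerDl.
case: ifPn => [b|/=]; first by rewrite !lexx al ah.
rewrite -ltNge => n1.
case: ifPn => [b|]; first by rewrite /= !lexx al ah.
rewrite -ltNge => n2.
case: ifPn => [b|]; first by rewrite /= !lexx al ah.
rewrite -ltNge /= => n3; rewrite !lexx al ah; split => //=.
rewrite leNgt; apply/negP => n4.
move: n1 n2 n3 n4 => /=.
have dl : s.1 + 2 * l = s.1 + l + l by ring.
have dh : s.2 + 2 * h = s.2 + h + h by ring.
rewrite dl dh; set J1 := circulation _ _ _ _.
set J := circulation _ _ _ _; set J2 := circulation _ _ _ _.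
set J3 := circulation _ _ _ _; set J4 := circulation _ _ _ _.
have -> : J = J1 + J2 + (J3 + J4).
  rewrite /J (@circulation_splitv _ _ _ (s.2 + h)) ?lerDl//.
  rewrite (@circulation_splith _ (s.1 + l)) ?lerDl//; congr (_ + _).
  by rewrite (@circulation_splith _ (s.1 + l)) ?lerDl.
have := ler_normD (J1 + J2) (J3 + J4).
have := ler_normD J1 J2; have := ler_normD J3 J4.
by lra.
Qed.

(** Goursat's bisection: the selected quarters shrink to a point where the form is
    closed, so that the circulation of the n-th one is o(4^-n), while it is at
    least 4^-n times the initial one. *)
Lemma circulation_eq0 (a c L H : R) : 0 <= L -> 0 <= H ->
  circulation a (a + L) c (c + H) = 0.
Proof.
move=> L0 H0; apply/eqP/negPn/negP; rewrite -normr_gt0.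
set J0 := `|_| => J0gt0.
pose s := fix s n : R * R :=
  if n is m.+1 then quarter_step (L / 2 ^+ m.+1) (H / 2 ^+ m.+1) (s m)
  else (a, c).
have l0 n : 0 <= L / 2 ^+ n by rewrite divr_ge0 ?exprn_ge0.
have h0 n : 0 <= H / 2 ^+ n by rewrite divr_ge0 ?exprn_ge0.
have sP n := quarter_stepP (s n) (l0 n.+1) (h0 n.+1).
have half (z : R) n : 2 * (z / 2 ^+ n.+1) = z / 2 ^+ n.
  by rewrite exprS invfM mulrCA mulVKf.
have sJ n : J0 / 4 ^+ n <=
    `|circulation (s n).1 ((s n).1 + L / 2 ^+ n) (s n).2 ((s n).2 + H / 2 ^+ n)|.
  elim: n => [|n ih]; first by rewrite !expr0 !divr1.
  have [+ _ _] := sP n; rewrite !half /=; apply: le_trans.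
  by rewrite exprSr invfM mulrA ler_wpM2r// invr_ge0.
have [x0 hx] : exists x0, forall n, (s n).1 <= x0 <= (s n).1 + L / 2 ^+ n.
  by apply: nested_intervals => // n; have [] := sP n.
have [y0 hy] : exists y0, forall n, (s n).2 <= y0 <= (s n).2 + H / 2 ^+ n.
  by apply: nested_intervals => // n; have [] := sP n.
have [p [q [r hd]]] := PQ x0 y0.
have e0 : 0 < J0 / (2 * ((L + H) ^+ 2 + 1)).
  by rewrite divr_gt0// mulr_gt0// ltr_wpDl// sqr_ge0.
set e := J0 / _ in e0.
have [d d0 {}hd] := hd e e0.
have [n nd] : exists n, (L + H) / 2 ^+ n <= d.
  exists (Num.Def.archi_bound ((L + H) / d)).
  rewrite ler_pdivrMr ?exprn_gt0// mulrC -ler_pdivrMr//.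
  exact/ltW/upper_nthrootP.
set l := L / 2 ^+ n; set h := H / 2 ^+ n.
have lh : (L + H) / 2 ^+ n = l + h by rewrite mulrDl.
have nearx x : x \in `[(s n).1, (s n).1 + l] -> `|x - x0| <= l.
  rewrite in_itv /= => /andP[x1 x2]; have /andP[x3 x4] : (s n).1 <= x0 <= (s n).1 + l := hx n.
  by rewrite ler_norml; apply/andP; split; lra.
have neary y : y \in `[(s n).2, (s n).2 + h] -> `|y - y0| <= h.
  rewrite in_itv /= => /andP[x1 x2]; have /andP[x3 x4] : (s n).2 <= y0 <= (s n).2 + h := hy n.
  by rewrite ler_norml; apply/andP; split; lra.
have ld : l <= d by rewrite (le_trans _ nd)// lh lerDl; exact: h0.
have hd' : h <= d by rewrite (le_trans _ nd)// lh lerDr; exact: l0.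
have in0 (u v : R) : 0 <= v -> u \in `[u, u + v] /\ u + v \in `[u, u + v].
  by move=> v0; rewrite !in_itv /= !lexx lerDl v0.
have [ix1 ix2] := in0 (s n).1 _ (l0 n); have [iy1 iy2] := in0 (s n).2 _ (h0 n).
have est x y : `|x - x0| <= l -> `|y - y0| <= h ->
    `|P x y - P x0 y0 - q * (x - x0) - p * (y - y0)| <= e * (l + h) /\
    `|Q x y - Q x0 y0 - p * (x - x0) - r * (y - y0)| <= e * (l + h).
  move=> xl yh; have [] := hd x y (le_trans xl ld) (le_trans yh hd').
  have le_e : e * (`|x - x0| + `|y - y0|) <= e * (l + h).
    by rewrite ler_wpM2l ?(ltW e0)// lerD.
  by move=> /le_trans/(_ le_e) ? /le_trans/(_ le_e).
have := @circulation_le (s n).1 ((s n).1 + l) (s n).2 ((s n).2 + h) p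
  (2 * (e * (l + h))).
rewrite !lerDl => /(_ (l0 n) (h0 n)).
have addK (u v : R) : u + v - u = v by ring.
rewrite !addK => hJ.
have {hJ} : `|circulation (s n).1 ((s n).1 + l) (s n).2 ((s n).2 + h)| <=
    2 * (e * (l + h)) * (l + h).
  apply: hJ => [x /nearx xl|y /neary yh].
    have [+ _] := est x _ xl (neary _ iy1); have [+ _] := est x _ xl (neary _ iy2).
    move=> e1 e2; rewrite mulr_natl mulr2n (le_trans _ (lerD e2 e1))//.
    apply: le_trans (ler_normB _ _).
    set t := (X in _ <= `|X|); rewrite (_ : t = P x (s n).2 - P x ((s n).2 + h) + p * h)//.
    by rewrite /t /h; ring.
  have [_ +] := est _ y (nearx _ ix1) yh; have [_ +] := est _ y (nearx _ ix2) yh.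
  move=> e1 e2; rewrite mulr_natl mulr2n (le_trans _ (lerD e1 e2))//.
  apply: le_trans (ler_normB _ _).
  set t := (X in _ <= `|X|); rewrite (_ : t = Q ((s n).1 + l) y - Q (s n).1 y - p * l)//.
  by rewrite /t /l; ring.
move=> /(le_trans (sJ n)); apply/negP; rewrite -ltNge.
have -> : 2 * (e * (l + h)) * (l + h) = 2 * e * (L + H) ^+ 2 / 4 ^+ n.
  rewrite -lh (_ : 4 = 2 * 2); last by rewrite -natrM.
  have t0 : 2 ^+ n != 0 :> R by rewrite expf_neq0// pnatr_eq0.
  by rewrite exprMn; field.
rewrite ltr_pM2r ?invr_gt0 ?exprn_gt0//.
have LH : 0 < (L + H) ^+ 2 + 1 by rewrite ltr_wpDl// sqr_ge0.
have -> : J0 = 2 * e * ((L + H) ^+ 2 + 1).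
  by rewrite /e; field; rewrite gt_eqF.
by rewrite ltr_pM2l ?ltrDl// mulr_gt0.
Qed.

End forms.
End goursat.

(** * Entire functions, the complex exponential, and circular means *)

Section complex_calculus.
Variable R : realType.
Implicit Types (f g : R[i] -> R[i]) (z w : R[i]).

Lemma entire_comp f g : entire f -> entire g -> entire (f \o g).
Proof.
move=> ef eg z; apply/derivable1_diffP.
by apply: differentiable_comp; exact/derivable1_diffP.
Qed.

Lemma entireM f g : entire f -> entire g -> entire (fun z => f z * g z).
Proof. by move=> ef eg z; exact: (derivableM (ef z) (eg z)). Qed.

Lemma entireD f g : entire f -> entire g -> entire (fun z => f z + g z).
Proof. by move=> ef eg z; exact: (derivableD (ef z) (eg z)). Qed.

Lemma entire_cst (c : R[i]) : entire (fun=> c).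
Proof. by move=> z; exact: derivable_cst. Qed.

Lemma entire_id : entire (fun z : R[i] => z).
Proof. by move=> z; exact: derivable_id. Qed.

Lemma entire_continuous f : entire f -> continuous f.
Proof. move=> ef z; apply: differentiable_continuous; exact/derivable1_diffP. Qed.

Lemma posC (e : R) : 0 < e -> 0 < e%:C :> R[i].
Proof. by rewrite ltcR. Qed.

Lemma gt0C_Re (e : R[i]) : 0 < e -> 0 < complex.Re e /\ e = (complex.Re e)%:C.
Proof.
by case: e => a b; rewrite ltcE /= => /andP[/eqP -> a0].
Qed.

Lemma normc_le (x : R[i]) (e : R) : (`|x| <= e%:C) = (normc x <= e).
Proof. by rewrite -normc_norm lecR. Qed.

Lemma normc_lt (x : R[i]) (e : R) : (`|x| < e%:C) = (normc x < e).
Proof. by rewrite -normc_norm ltcR. Qed.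

Lemma normc_ge0 (x : R[i]) : 0 <= normc x.
Proof. by rewrite -lecR normc_norm; exact: normr_ge0. Qed.

Lemma normc_eq0 (x : R[i]) : (normc x == 0) = (x == 0).
Proof. by apply/eqP/eqP => [/Normc.eq0_normc//|->]; rewrite Normc.normc0. Qed.

Lemma normc_gt0 (x : R[i]) : (0 < normc x) = (x != 0).
Proof. by rewrite lt_neqAle normc_ge0 andbT eq_sym normc_eq0. Qed.

(** A quadratic remainder estimate gives complex differentiability. *)
Lemma derivable_quadratic f z (D : R[i]) (K d : R) : 0 < d -> 0 <= K ->
  (forall h, normc h <= d ->
     normc (f (z + h) - f z - D * h) <= K * normc h ^+ 2) ->
  derivable f z 1.
Proof.
move=> d0 K0 fD; apply/cvg_ex; exists D => /=.
apply/cvgrPdist_le => /= e /gt0C_Re[e0 ->].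
have m0 : 0 < Num.min d (complex.Re e / (K + 1)).
  by rewrite lt_min d0 divr_gt0// ltr_wpDl.
near=> h.
have h0 : h != 0 by near: h; exact: nbhs_dnbhs_neq.
have hd : normc h <= Num.min d (complex.Re e / (K + 1)).
  rewrite -normc_le; near: h.
  apply: (@dnbhs0_le _ R[i]).
  by rewrite ltcR.
have nh : 0 < normc h by rewrite normc_gt0.
move: hd; rewrite le_min => /andP[hd hK].
rewrite normc_le -(ler_pM2l nh) -Normc.normcM -[_ *: _]/(_ * _).
have -> : h * (D - h^-1 * (f (h%:A + z) - f z)) = - (f (z + h) - f z - D * h).
  rewrite (_ : h%:A = h); last by rewrite -[_ *: _]/(_ * _) mulr1.
  by rewrite [h + z]addrC; field.
rewrite normcN (le_trans (fD _ hd))// expr2 mulrA mulrC ler_pM2l//.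
rewrite (le_trans _ (_ : normc h * (K + 1) <= _))//; last first.
  by rewrite -ler_pdivlMr// ltr_wpDl.
by rewrite mulrC ler_pM2l// lerDl.
Unshelve. all: end_near. Qed.

(** First order expansion of an entire function, in terms of the real modulus. *)
Lemma entire_remainder f z : entire f -> exists D : R[i], forall e : R, 0 < e ->
  exists2 d : R, 0 < d & forall h, normc h <= d ->
     normc (f (z + h) - f z - D * h) <= e * normc h.
Proof.
move=> /(_ z) /cvg_ex[D /cvgrPdist_le /= fD]; exists D => e e0.
have /nbhs_ballP[d /gt0C_Re[d0 dE] dP] := fD _ (posC e0).

exists (complex.Re d / 2); first by rewrite divr_gt0.
move=> h hd; have [->|h0] := eqVneq h 0.
  by rewrite addr0 mulr0 subrr subr0 Normc.normc0 mulr0.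
have nh : 0 < normc h by rewrite normc_gt0.
have : ball 0 d h.
  rewrite -ball_normE /= sub0r normrN dE normc_lt (le_lt_trans hd)//.
  by rewrite ltr_pdivrMr// mulr_natr mulr2n ltrDl.
move=> /dP /(_ h0).
rewrite normc_le -(ler_pM2l nh) -Normc.normcM -[_ *: _]/(_ * _) [e * _]mulrC.
have -> : h * (D - h^-1 * (f (h%:A + z) - f z)) = - (f (z + h) - f z - D * h).
  rewrite (_ : h%:A = h); last by rewrite -[_ *: _]/(_ * _) mulr1.
  by rewrite [h + z]addrC; field.
by rewrite normcN.
Qed.

(** The complex exponential, in Cartesian form. *)
Definition cexp z : R[i] :=
  (expR (complex.Re z) * cos (complex.Im z)) +i*
  (expR (complex.Re z) * sin (complex.Im z)).

Lemma cexpD z w : cexp (z + w) = cexp z * cexp w.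
Proof.
case: z w => [a b] [c d]; rewrite /cexp /= expRD cosD sinD.
by simpc; congr (_ +i* _); ring.
Qed.

Lemma cexp0 : cexp 0 = 1.
Proof. by rewrite /cexp /= expR0 cos0 sin0 mulr1 mulr0. Qed.

Lemma normc_cexp z : normc (cexp z) = expR (complex.Re z).
Proof.
rewrite /= !exprMn -mulrDr cos2Dsin2 mulr1 sqrtr_sqr ger0_norm//.
Qed.

Lemma conjc_cexp z : ((cexp z)^*)%R = cexp (z^*)%R.
Proof. by case: z => a b; rewrite /cexp /= cosN sinN mulrN. Qed.

Lemma sqr_normcE z : normc z ^+ 2 = complex.Re z ^+ 2 + complex.Im z ^+ 2.
Proof. by case: z => a b; rewrite /= sqr_sqrtr// addr_ge0 ?sqr_ge0. Qed.

Lemma normc_le_ReIm z : normc z <= `|complex.Re z| + `|complex.Im z|.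
Proof.
rewrite -(@ler_pXn2r _ 2) ?nnegrE ?addr_ge0 ?normc_ge0//.
rewrite sqr_normcE -(real_normK (num_real (complex.Re z))).
rewrite -(real_normK (num_real (complex.Im z))) sqrrD.
by rewrite addrAC lerDl mulrn_wge0// mulr_ge0.
Qed.

Lemma normr_Re_le z : `|complex.Re z| <= normc z.
Proof.
rewrite -(@ler_pXn2r _ 2) ?nnegrE ?normc_ge0//.
by rewrite sqr_normcE -normrX ger0_norm ?sqr_ge0// lerDl sqr_ge0.
Qed.

Lemma normr_Im_le z : `|complex.Im z| <= normc z.
Proof.
rewrite -(@ler_pXn2r _ 2) ?nnegrE ?normc_ge0//.
by rewrite sqr_normcE -normrX ger0_norm ?sqr_ge0// lerDr sqr_ge0.
Qed.

Lemma expR_remainder (x : R) : `|x| <= 2^-1 -> `|expR x - 1 - x| <= 2 * x ^+ 2.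
Proof.
rewrite ler_norml => /andP[x1 x2].
have h1 := expR_ge1Dx x; have h2 := expR_ge1Dx (- x).
have e0 := expR_gt0 x.
have : expR x * (1 - x) <= 1.
  by rewrite -[leRHS](expRxMexpNx_1 x) ler_pM2l.
move=> h3; rewrite ler_norml; apply/andP; split; first by nra.
have : (1 - x) * (expR x - 1 - x) <= (1 - x) * (2 * x ^+ 2) by nra.
by rewrite ler_pM2l; lra.
Qed.

Lemma mean_value_le (f df : R -> R) (y K : R) :
  (forall x : R, is_derive x (1 : R) f (df x)) ->
  (forall t, `|t| <= `|y| -> `|df t| <= K) -> `|f y - f 0| <= K * `|y|.
Proof.
move=> fd dfK.
have cf : continuous f.
  move=> x; apply: differentiable_continuous; apply/derivable1_diffP.
  by have [] := fd x.
have [y0|y0] := leP 0 y.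
  have [c + ->] := MVT_segment y0 (fun x _ => fd x) (continuous_subspaceT cf).
  rewrite in_itv /= => /andP[c0 cy]; rewrite subr0 normrM ler_wpM2r// dfK//.
  by rewrite !ger0_norm.
have [c + e] := MVT_segment (ltW y0) (fun x _ => fd x) (continuous_subspaceT cf).
rewrite in_itv /= => /andP[c0 cy].
rewrite distrC e sub0r normrM normrN ler_wpM2r// dfK//.
by rewrite !ler0_norm ?lerN2// ltW.
Qed.

Lemma normr_sin_le (y : R) : `|sin y| <= `|y|.
Proof.
have := @mean_value_le sin cos y 1 (@is_derive_sin R).
rewrite sin0 subr0 mul1r; apply => t _.
by rewrite ler_norml cos_geN1 cos_le1.
Qed.

Lemma cos_remainder (y : R) : `|cos y - 1| <= y ^+ 2.
Proof.
have := @mean_value_le cos (fun x => - sin x) y `|y| (@is_derive_cos R).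
rewrite cos0 -expr2 real_normK ?num_real//; apply => t ty.
by rewrite normrN (le_trans (normr_sin_le t)).
Qed.

Lemma sin_remainder (y : R) : `|y| <= 1 -> `|sin y - y| <= y ^+ 2.
Proof.
move=> y1; have d (x : R) : is_derive x (1 : R) (fun x => sin x - x) (cos x - 1).
  exact: is_deriveB.
have := @mean_value_le (fun x => sin x - x) (fun x => cos x - 1) y `|y| d.
rewrite sin0 !subr0 -expr2 real_normK ?num_real//; apply => t ty.
rewrite (le_trans (cos_remainder t))// -(real_normK (num_real t)) expr2.
by rewrite (le_trans _ ty)// ler_piMr// (le_trans ty).
Qed.

Lemma cexp_remainder z : normc z <= 2^-1 ->
  normc (cexp z - 1 - z) <= 4 * normc z ^+ 2.
Proof.
move=> z1; have x1 := le_trans (normr_Re_le z) z1; have y1 := le_trans (normr_Im_le z) z1.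
rewrite sqr_normcE (le_trans (normc_le_ReIm _))//.
case: z {z1} x1 y1 => x y /= x1 y1; rewrite /cexp; simpc => /=.
have ex := expR_remainder x1.
have ey : `|sin y - y| <= y ^+ 2 by apply: sin_remainder; lra.
have cy := cos_remainder y.

have e2 : expR x <= 2.
  have := expR_ge1Dx (- x); have := expRxMexpNx_1 x; have := expR_gt0 x.
  by move: x1; rewrite ler_norml => /andP[? ?]; nra.
have sy := normr_sin_le y.
have ex1 : `|expR x - 1| <= 2 * `|x|.
  rewrite -[expR x - 1](subrK x) (le_trans (ler_normD _ _))//.
  rewrite mulr_natl mulr2n lerD2r (le_trans ex)// -(real_normK (num_real x)) expr2 mulrA.
  by rewrite ler_piMl// mulrC -ler_pdivlMr// mul1r.
have -> : expR x * cos y - 1 - x = expR x * (cos y - 1) + (expR x - 1 - x) by ring.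
have -> : expR x * sin y - y = (expR x - 1) * sin y + (sin y - y) by ring.
rewrite (le_trans (lerD (ler_normD _ _) (ler_normD _ _)))// !normrM.
have h1 : `|expR x| * `|cos y - 1| <= 2 * y ^+ 2.
  by rewrite ler_pM// ger0_norm ?expR_ge0.
have h2 : `|expR x - 1| * `|sin y| <= 2 * `|x| * `|y| by rewrite ler_pM.
have h3 : 2 * `|x| * `|y| <= x ^+ 2 + y ^+ 2.
  rewrite -(real_normK (num_real x)) -(real_normK (num_real y)).
  have := sqr_ge0 (`|x| - `|y|); nra.
have := sqr_ge0 x; lra.
Qed.

Lemma entire_cexp : entire cexp.
Proof.
move=> z; apply: (@derivable_quadratic _ _ (cexp z) (4 * normc (cexp z)) 2^-1) => //.
  by rewrite mulr_ge0// normc_ge0.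
move=> h hh; have -> : cexp (z + h) - cexp z - cexp z * h = cexp z * (cexp h - 1 - h).
  by rewrite cexpD; ring.
rewrite Normc.normcM [4 * _]mulrC -mulrA ler_wpM2l ?normc_ge0//.
exact: cexp_remainder.
Qed.

Local Notation leb := (@lebesgue_measure R).

(** For entire f, the real and imaginary parts u, v of f(e^(s + i t)) satisfy the
    Cauchy-Riemann equations, that is, v ds + u dt is a closed form. *)
Lemma exp_pair_form f : entire f ->
  let w s t := cexp (s +i* t) in
  forall s t, closed_form_at (fun s t => complex.Im (f (w s t)))
    (fun s t => complex.Re (f (w s t))) s t.
Proof.
move=> ef w s t; have eg := entire_comp ef entire_cexp.
have [[p q] hD] := entire_remainder (s +i* t) eg.
exists p, q, (- q) => e e0; have [d d0 {}hD] := hD e e0.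
exists (d / 2); first by rewrite divr_gt0.
move=> x y xs yt; pose h : R[i] := (x - s) +i* (y - t).
have hs : normc h <= `|x - s| + `|y - t| := normc_le_ReIm h.
have hd : normc h <= d by lra.
have := hD _ hd.
have -> : (s +i* t) + h = x +i* y by rewrite /h; simpc; congr (_ +i* _); ring.
rewrite /= -/(w x y) -/(w s t); case: (f (w x y)) => a b; case: (f (w s t)) => a' b'.
rewrite /h; simpc => /= hn.
have hle : e * Num.sqrt ((x - s) ^+ 2 + (y - t) ^+ 2) <= e * (`|x - s| + `|y - t|).
  by rewrite ler_wpM2l// ltW.
set A := a - a' + _ in hn; set B := b - b' + _ in hn.
split; rewrite (le_trans _ (le_trans hn hle))//.
  have -> : b - b' - q * (x - s) - p * (y - t) = B by rewrite /B; ring.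
  exact: (normr_Im_le (A +i* B)).
have -> : a - a' - p * (x - s) + q * (y - t) = A by rewrite /A; ring.
exact: (normr_Re_le (A +i* B)).
Qed.

(** Mean value property on the unit circle. The form v ds + u dt above is
    2 pi-periodic in t, so that on [s, 0] x [0, 2 pi] the horizontal sides cancel
    and Goursat's theorem says that the integral of u over the circle of radius
    e^s does not depend on s; letting s tend to -oo gives the value at 0. *)
Lemma circle_mean f : entire f ->
  \int[leb]_(t in `[0, 2 * pi]) complex.Re (f (cexp (0 +i* t))) =
  2 * pi * complex.Re (f 0).
Proof.
move=> ef; pose P s t := complex.Im (f (cexp (s +i* t))).
pose Q s t := complex.Re (f (cexp (s +i* t))).
have PQ s t : closed_form_at P Q s t := exp_pair_form ef s t.
have pi2 : 0 <= 2 * pi :> R by rewrite mulr_ge0// pi_ge0.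
pose I s := \int[leb]_(t in `[0, 2 * pi]) Q s t.
have cQ s : continuous (Q s) := @closed_form_continuousQ _ _ _ PQ s.
have iQ s : leb.-integrable `[0, 2 * pi] (EFin \o Q s).
  exact: continuous_itv_integrable.
have ic : leb.-integrable `[0, 2 * pi] (EFin \o (fun=> complex.Re (f 0))).
  by apply: continuous_itv_integrable => ?; exact: cvg_cst.
have perP s : P s 0 = P s (2 * pi).
  by rewrite /P /cexp /= sin0 cos0 mulr_natl sin2pi cos2pi.
have Icst s : s <= 0 -> I s = I 0.
  move=> s0; have := circulation_eq0 PQ s 0 (etrans (oppr_ge0 s) s0) pi2.
  rewrite subrr add0r /circulation.
  have -> : \int[leb]_(x in `[s, 0]) (P x 0 - P x (2 * pi)) = 0.
    under eq_Rintegral do rewrite perP subrr.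
    by rewrite (Rintegral_itv_cst 0 s0) mul0r.
  have -> : \int[leb]_(y in `[0, 2 * pi]) (Q 0 y - Q s y) = I 0 - I s.
    by apply: RintegralB; [exact: measurable_itv|exact: iQ|exact: iQ].
  by rewrite add0r; set u := I 0; set v := I s => uv; apply/eqP; rewrite eq_sym -subr_eq0 uv.
(* The mean over a circle of small radius e^s is close to the value at 0. *)
rewrite -[LHS]/(I 0); apply/eqP; rewrite -subr_eq0 -normr_le0.
apply/ler_addgt0Pl => e e0; rewrite addr0.
pose e' := e / (2 * pi).
have e'0 : 0 < e' by rewrite divr_gt0// mulr_gt0// pi_gt0.
have /cvgrPdist_le /(_ _ (posC e'0)) := @entire_continuous _ ef 0.
move=> /nbhs_ballP[d /gt0C_Re[d0 dE] /= dP].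
pose s := Num.min 0 (ln (complex.Re d / 2)).
have s0 : s <= 0 by rewrite ge_min lexx.
have sd t : normc (cexp (s +i* t)) < complex.Re d.
  rewrite normc_cexp /= (@le_lt_trans _ _ (complex.Re d / 2))//; last first.
    by rewrite ltr_pdivrMr// mulr_natr mulr2n ltrDl.
  by rewrite -[leRHS]lnK ?posrE ?divr_gt0// ler_expR ge_min lexx orbT.
rewrite -(Icst _ s0) [2 * pi * _]mulrC -[2 * pi]subr0 -Rintegral_itv_cst//.
rewrite /I -RintegralB//.
rewrite (le_trans (le_normr_Rintegral _ _))//.
  apply: continuous_itv_integrable => x.
  by apply: cvgB; [exact: cQ | exact: cvg_cst].
have -> : e = \int[leb]_(x in `[0, 2 * pi]) e'.
  rewrite Rintegral_itv_cst// subr0 divfK// mulf_neq0// gt_eqF//.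
  exact: pi_gt0.
apply: le_Rintegral => //.
- apply: continuous_itv_integrable => x; apply: cvg_norm.
  by apply: cvgB; [exact: cQ | exact: cvg_cst].
- by apply: continuous_itv_integrable => ?; exact: cvg_cst.
move=> t _.
have : ball 0 d (cexp (s +i* t)).
  by rewrite -ball_normE /= sub0r normrN dE normc_lt.
move=> /dP; rewrite normc_le; apply: le_trans.
by rewrite -normcN opprB (le_trans _ (normr_Re_le _))// raddfB.
Qed.

End complex_calculus.

(** * Measurability into the complex plane, and maps preserving area *)

Section area_basics.
Variable R : realType.
Local Notation leb := (@lebesgue_measure R).

Lemma measurable_real_fun (f : R[i] -> R) :
  (forall z w, `|f z - f w| <= normc (z - w)) -> measurable_fun setT f.
Proof.
move=> f1; apply: (measurability _ (RGenOpens.measurableE R)).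
move=> _ [_ [a [b ->] <-]]; rewrite setTI; apply: sub_sigma_algebra => /=.
rewrite openE => z /=; rewrite in_itv/= => /andP[az zb].
rewrite /interior /= -nbhs_ballE.
exists (Num.min (f z - a) (b - f z))%:C => /=.
  by rewrite ltcR lt_min !subr_gt0 az.
move=> w; rewrite -ball_normE /= normc_lt lt_min in_itv/= => /andP[h1 h2].
have := f1 z w; rewrite ler_norml => /andP[h3 h4].
by apply/andP; split; lra.
Qed.

Lemma measurable_Re : measurable_fun setT (@complex.Re R).
Proof.
apply: measurable_real_fun => z w; apply: le_trans (normr_Re_le _).
by case: z w => a b [c d].
Qed.

Lemma measurable_Im : measurable_fun setT (@complex.Im R).
Proof.
apply: measurable_real_fun => z w; apply: le_trans (normr_Im_le _).
by case: z w => a b [c d].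
Qed.

Lemma measurable_fun_complex d (T : measurableType d) (F : T -> R[i]) :
  measurable_fun setT (fun x => complex.Re (F x)) ->
  measurable_fun setT (fun x => complex.Im (F x)) -> measurable_fun setT F.
Proof.
move=> mRe mIm.
have -> : F = @of_xy R \o (fun x => (complex.Re (F x), complex.Im (F x))).
  by apply/funext => x; rewrite /of_xy /=; case: (F x).
by apply: measurableT_comp; [exact: measurable_of_xy|exact: measurable_fun_pair].
Qed.

Lemma measurable_fun_Re d (T : measurableType d) (F : T -> R[i]) :
  measurable_fun setT F -> measurable_fun setT (fun x => complex.Re (F x)).
Proof. by move=> mF; exact: (measurableT_comp measurable_Re). Qed.

Lemma measurable_fun_Im d (T : measurableType d) (F : T -> R[i]) :
  measurable_fun setT F -> measurable_fun setT (fun x => complex.Im (F x)).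
Proof. by move=> mF; exact: (measurableT_comp measurable_Im). Qed.

Lemma measurable_funcM d (T : measurableType d) (F G : T -> R[i]) :
  measurable_fun setT F -> measurable_fun setT G ->
  measurable_fun setT (fun x => F x * G x).
Proof.
move=> mF mG.
have mFr := measurable_fun_Re mF; have mFi := measurable_fun_Im mF.
have mGr := measurable_fun_Re mG; have mGi := measurable_fun_Im mG.
apply: measurable_fun_complex.
- rewrite [X in measurable_fun _ X](_ : _ = fun x =>
    complex.Re (F x) * complex.Re (G x) - complex.Im (F x) * complex.Im (G x)).
    by apply: measurable_funB; exact: measurable_funM.
  by apply/funext => x; case: (F x) (G x) => a b [c e].
- rewrite [X in measurable_fun _ X](_ : _ = fun x =>
    complex.Re (F x) * complex.Im (G x) + complex.Im (F x) * complex.Re (G x)).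
    by apply: measurable_funD; exact: measurable_funM.
  by apply/funext => x; case: (F x) (G x) => a b [c e].
Qed.

Lemma measurable_funcD d (T : measurableType d) (F G : T -> R[i]) :
  measurable_fun setT F -> measurable_fun setT G ->
  measurable_fun setT (fun x => F x + G x).
Proof.
move=> mF mG; apply: measurable_fun_complex; under eq_fun do rewrite raddfD/=.
- by apply: measurable_funD; exact: measurable_fun_Re.
- by apply: measurable_funD; exact: measurable_fun_Im.
Qed.

Lemma measurable_funcN d (T : measurableType d) (F : T -> R[i]) :
  measurable_fun setT F -> measurable_fun setT (fun x => - F x).
Proof.
move=> mF; apply: measurable_fun_complex; under eq_fun do rewrite raddfN/=.
- by apply: measurableT_comp => //; exact: measurable_fun_Re.
- by apply: measurableT_comp => //; exact: measurable_fun_Im.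
Qed.

Lemma measurable_funcJ d (T : measurableType d) (F : T -> R[i]) :
  measurable_fun setT F -> measurable_fun setT (fun x => (F x)^*).
Proof.
move=> mF; apply: measurable_fun_complex.
- rewrite [X in measurable_fun _ X](_ : _ = fun x => complex.Re (F x)).
    exact: measurable_fun_Re.
  by apply/funext => x; case: (F x).
- rewrite [X in measurable_fun _ X](_ : _ = fun x => - complex.Im (F x)).
    by apply: measurableT_comp => //; exact: measurable_fun_Im.
  by apply/funext => x; case: (F x).
Qed.

Lemma measurable_fun_real_complex d (T : measurableType d) (F : T -> R) :
  measurable_fun setT F -> measurable_fun setT (fun x => (F x)%:C).
Proof. by move=> mF; apply: measurable_fun_complex. Qed.

Lemma measurable_fun_normc d (T : measurableType d) (F : T -> R[i]) :
  measurable_fun setT F -> measurable_fun setT (fun x => normc (F x)).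
Proof. by move=> mF; exact: (measurableT_comp (@measurable_normc R)). Qed.

Lemma measurable_fun_cexp d (T : measurableType d) (F : T -> R[i]) :
  measurable_fun setT F -> measurable_fun setT (fun x => cexp (F x)).
Proof.
move=> mF; have mFr := measurable_fun_Re mF; have mFi := measurable_fun_Im mF.
apply: measurable_fun_complex => /=.
- apply: measurable_funM; apply: measurableT_comp => //.
  by apply: continuous_measurable_fun; exact: continuous_cos.
- apply: measurable_funM; apply: measurableT_comp => //.
  by apply: continuous_measurable_fun; exact: continuous_sin.
Qed.

Lemma continuous_measurablec (f : R[i] -> R[i]) : continuous f ->
  measurable_fun setT f.
Proof.
move=> cf; apply: (measurability (@open R[i])) => //.
move=> _ [U oU <-]; rewrite setTI; apply: sub_sigma_algebra.
by move/continuousP : cf; apply.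
Qed.

Lemma entire_measurable (f : R[i] -> R[i]) : entire f -> measurable_fun setT f.
Proof. by move=> /entire_continuous; exact: continuous_measurablec. Qed.

Lemma lebesgue_affine (r a : R) (A : set R) : 0 < r -> measurable A ->
  (r%:E * leb [set x | A (r * x + a)%R] = leb A)%E.
Proof.
move=> r0 mA.
have mphi : measurable_fun setT (fun x : measurableTypeR R => r * x + a : measurableTypeR R).
  by apply: measurable_funD => //; exact: measurable_funM.
apply/esym; unshelve refine (@lebesgue_measure_unique R
  (mscale (NngNum (ltW r0)) (pushforward leb
  (fun x : measurableTypeR R => r * x + a : measurableTypeR R))) _ A mA) => //.
move=> _ [[u v] /= _ <-].
have e : (fun x : R => r * x + a) @^-1` `]u, v]%classic =
   `](u - a) / r, (v - a) / r]%classic.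
  apply/seteqP; split => x /=; rewrite !in_itv /= ltr_pdivrMr// ler_pdivlMr//.
    by move=> /andP[? ?]; apply/andP; split; lra.
  by move=> /andP[? ?]; apply/andP; split; lra.
rewrite [RHS](_ : _ = (r%:E * leb (`](u - a) / r, (v - a) / r]%classic)%R)%E); last first.
  by rewrite -e.
rewrite !lebesgue_measure_itv /= !lte_fin ltr_pM2r ?invr_gt0// ltrD2r.
case: ifPn => _; last by rewrite mule0.
by rewrite -!EFinD -EFinM; congr EFin; field; rewrite gt_eqF.
Qed.

Lemma lebesgue_translate (a : R) (A : set R) : measurable A ->
  leb [set x | A (x + a)] = leb A.
Proof.
move=> mA; rewrite -[RHS](lebesgue_affine a ltr01 mA) mul1e.
by congr (leb _); apply/seteqP; split => x /=; rewrite mul1r.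
Qed.

Lemma measurable_cdisc (M : R) : measurable [set z : R[i] | normc z <= M].
Proof.
rewrite -[X in measurable X]setTI (_ : [set z : R[i] | _] = (@normc R) @^-1` `]-oo, M]%classic); last first.
  by apply/seteqP; split => x; rewrite /= in_itv.
by apply: measurable_normc => //; exact: measurable_itv.
Qed.

Lemma leb_square (M : R) : 0 <= M ->
  ((leb \x leb) (`[(- M)%R, M]%classic `*` `[(- M)%R, M]%classic) =
  ((2 * M) ^+ 2)%:E)%E.
Proof.
move=> M0.
have mI : measurable (`[- M, M]%classic : set (measurableTypeR R)) by exact: measurable_itv.
have lI : leb `[- M, M]%classic = (2 * M)%:E.
  rewrite lebesgue_measure_itv /= lte_fin; move: M0; rewrite le_eqVlt.
  move=> /predU1P[<-|M0]; first by rewrite oppr0 ltxx mulr0.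
  by rewrite gtrN// -EFinB; congr EFin; ring.
pose I := `[- M, M]%classic; transitivity (leb I * leb I)%E.
  exact: product_measure1E.
by rewrite /I lI -EFinM expr2.
Qed.

Lemma area_cdisc_le (M : R) : 0 <= M ->
  (area [set z : R[i] | normc z <= M]%R <= (4 * M ^+ 2)%:E)%E.
Proof.
move=> M0.
have mI : measurable (`[- M, M]%classic : set (measurableTypeR R)) by exact: measurable_itv.
apply: (@le_trans _ _ ((leb \x leb)%E (`[- M, M]%classic `*` `[- M, M]%classic))).
  rewrite /area /pushforward; apply: le_measure; rewrite ?inE.
  - rewrite -[X in measurable X]setTI; apply: measurable_of_xy => //.
    exact: measurable_cdisc.
  - exact: measurableX.
  - move=> [x y] /= h; rewrite !in_itv /= -!ler_norml; split.
      by rewrite (le_trans (normr_Re_le (x +i* y))).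
    by rewrite (le_trans (normr_Im_le (x +i* y))).
rewrite (@leb_square M)// lee_fin le_eqVlt; apply/predU1P; left; ring.
Qed.

Lemma area_cdisc_gt0 (M : R) : 0 < M ->
  (0 < area [set z : R[i] | normc z <= M]%R)%E.
Proof.
move=> M0; pose m := M / 2; have m0 : 0 < m by rewrite divr_gt0.
have mI : measurable (`[- m, m]%classic : set (measurableTypeR R)) by exact: measurable_itv.
apply: (@lt_le_trans _ _ ((leb \x leb)%E (`[- m, m]%classic `*` `[- m, m]%classic))).
  by rewrite leb_square ?(ltW m0)// lte_fin exprn_gt0// mulr_gt0.
rewrite /area /pushforward; apply: le_measure; rewrite ?inE.
- exact: measurableX.
- rewrite -[X in measurable X]setTI; apply: measurable_of_xy => //.
  exact: measurable_cdisc.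
- move=> [x y] /=; rewrite !in_itv /= -!ler_norml => -[hx hy].
  rewrite (le_trans (normc_le_ReIm (x +i* y)))//= (le_trans (lerD hx hy))//.
  by rewrite -splitr.
Qed.

Lemma area_sigma_finite : sigma_finite setT (@area R).
Proof.
exists (fun n => [set z : R[i] | normc z <= n%:R]).
  apply/seteqP; split => // z _; exists (Num.bound (normc z)) => //=.
  exact/ltW/archi_boundP/normc_ge0.
move=> n; split; first exact: measurable_cdisc.
by rewrite (le_lt_trans (area_cdisc_le _))// ltry.
Qed.

HB.instance Definition _ := @Measure_isSigmaFinite.Build _ _ _ (@area R) area_sigma_finite.

Lemma measurable_xyP (A : set R[i]) : measurable A -> measurable (@of_xy R @^-1` A).
Proof. by move=> mA; rewrite -[X in measurable X]setTI; exact: measurable_of_xy. Qed.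

(** Measurable maps of the plane under which planar Lebesgue measure is
    invariant. *)
Definition area_preserving (phi : R[i] -> R[i]) := measurable_fun setT phi /\
  forall A, measurable A -> area (phi @^-1` A) = area A.

Lemma area_preserving_comp phi psi : area_preserving phi ->
  area_preserving psi -> area_preserving (phi \o psi).
Proof.
move=> [mphi aphi] [mpsi apsi]; split; first exact: measurableT_comp.
move=> A mA; rewrite comp_preimage apsi ?aphi//.
by rewrite -[X in measurable X]setTI; exact: mphi.
Qed.

Lemma area_shear_y (a : R -> R) : measurable_fun setT a ->
  area_preserving (fun z => complex.Re z +i* (complex.Im z + a (complex.Re z))).
Proof.
move=> ma; split.
  apply: measurable_fun_complex => /=; first exact: measurable_Re.
  apply: measurable_funD; first exact: measurable_Im.
  by apply: measurableT_comp => //; exact: measurable_Re.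
move=> A mA; rewrite /area /pushforward /product_measure1 /=.
apply: eq_integral => x _ /=.
rewrite -[RHS](lebesgue_translate (a x)); last first.
  by apply: measurable_xsection; exact: measurable_xyP.
by congr (leb _); apply/seteqP; split => y /=; rewrite /xsection /= !inE.
Qed.

(** The area, defined by vertical sections, computed by horizontal ones. *)
Lemma area_ysection A : measurable A ->
  area A = (\int[leb]_y leb (ysection (@of_xy R @^-1` A) y))%E.
Proof.
move=> mA; apply: (@product_measure_unique _ _ _ _ _ leb leb (leb \x^ leb)%E).
  by move=> B C mB mC; rewrite /= product_measure2E.
exact: measurable_xyP.
Qed.

Lemma area_shear_x (a : R -> R) : measurable_fun setT a ->
  area_preserving (fun z => (complex.Re z + a (complex.Im z)) +i* (complex.Im z)).
Proof.
move=> ma; have mphi : measurable_fun setT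
    (fun z : R[i] => (complex.Re z + a (complex.Im z)) +i* (complex.Im z)).
  apply: measurable_fun_complex => /=; last exact: measurable_Im.
  apply: measurable_funD; first exact: measurable_Re.
  by apply: measurableT_comp => //; exact: measurable_Im.
split; first exact: mphi.
move=> A mA; rewrite (area_ysection mA) area_ysection; last first.
  by rewrite -[X in measurable X]setTI; exact: mphi.
apply: eq_integral => y _ /=.
rewrite -[RHS](lebesgue_translate (a y)); last first.
  by apply: measurable_ysection; exact: measurable_xyP.
by congr (leb _); apply/seteqP; split => x /=; rewrite /ysection /= !inE.
Qed.

Lemma area_translate (w : R[i]) : area_preserving (fun z => z + w).
Proof.
have := area_preserving_comp (@area_shear_x (cst (complex.Re w)) (@measurable_cst _ _ _ _ _ _))
  (@area_shear_y (cst (complex.Im w)) (@measurable_cst _ _ _ _ _ _)).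
congr area_preserving.
by apply/funext => -[x y]; case: w => a b.
Qed.

(** A rotation is a product of three shears, provided that it is not the half-turn,
    which is the square of the quarter-turn. *)
Lemma area_rotate (w : R[i]) : normc w = 1 -> area_preserving (fun z => w * z).
Proof.
have rot (c s : R) : c ^+ 2 + s ^+ 2 = 1 -> c != -1 ->
    area_preserving (fun z => (c +i* s) * z).
  move=> cs c1; have c0 : 1 + c != 0 by rewrite addrC addr_eq0.
  have ml (k : R) : measurable_fun setT (fun x : R => k * x).
    by apply: measurable_funM.
  (* With t = - tan(theta / 2) and s = sin(theta): shear by t, s, then t. *)
  have [t [st tc]] : exists t, s * t = c - 1 /\ t * (1 + c) = - s.
    exists (- (s / (1 + c))); split; last by field.
    rewrite mulrN mulrA -expr2 (_ : s ^+ 2 = 1 - c ^+ 2); last by lra.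
    by field.
  have cE : 1 + s * t = c by rewrite st; ring.
  have := area_preserving_comp (area_shear_x (ml t))
    (area_preserving_comp (area_shear_y (ml s)) (area_shear_x (ml t))).
  congr area_preserving; apply/funext => -[x y] /=; simpc; congr (_ +i* _).
    transitivity ((1 + s * t) * x + t * (1 + (1 + s * t)) * y); first by ring.
    by rewrite cE tc; ring.
  transitivity ((1 + s * t) * y + s * x); first by ring.
  by rewrite cE; ring.
case: w => c s /= cs1.
have cs : c ^+ 2 + s ^+ 2 = 1.
  by rewrite -[LHS]sqr_sqrtr ?addr_ge0 ?sqr_ge0// cs1 expr1n.
have [cN1|/rot] := eqVneq c (-1); last by apply; exact: cs.
have s0 : s = 0.
  by apply/eqP; rewrite -(@sqrf_eq0 R); apply/eqP; move: cs; rewrite cN1 sqrrN; lra.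
have i1 : (0 : R) ^+ 2 + 1 ^+ 2 = 1 by rewrite expr0n expr1n add0r.
have i0 : (0 : R) != -1 by rewrite eq_sym oppr_eq0 oner_eq0.
have := area_preserving_comp (rot 0 1 i1 i0) (rot 0 1 i1 i0).
congr area_preserving; apply/funext => -[x y] /=; rewrite cN1 s0; simpc.
by congr (_ +i* _); ring.
Qed.

Lemma area_scale (r : R) (A : set R[i]) : 0 < r -> measurable A ->
  ((r ^+ 2)%:E * area [set z | A (r%:C * z)%R] = area A)%E.
Proof.
move=> r0 mA.
have mphi : measurable_fun setT (fun x : measurableTypeR R => r * x : measurableTypeR R).
  exact: measurable_funM.
have intE (F : measurableTypeR R -> \bar R) : measurable_fun setT F ->
    (forall x, 0 <= F x)%E -> (r%:E * \int[leb]_x F (r * x)%R = \int[leb]_x F x)%E.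
  move=> mF F0.
  pose phi (x : measurableTypeR R) : measurableTypeR R := r * x.
  have -> : (\int[leb]_x F (phi x) = \int[pushforward leb phi]_x F x)%E.
    by rewrite ge0_integral_pushforward.
  rewrite -(@ge0_integral_mscale _ _ _ _ _ measurableT (NngNum (ltW r0)))//.
  apply: eq_measure_integral => B mB _.
  rewrite -[RHS](lebesgue_affine 0 r0 mB); congr (_ * leb _)%E.
  by apply/seteqP; split => x /=; rewrite addr0.
have mA' := measurable_xyP mA.
have mF : measurable_fun setT (fun x => leb (xsection (@of_xy R @^-1` A) x)).
  exact: measurable_fun_xsection.
rewrite [RHS](_ : _ = (\int[leb]_x leb (xsection (@of_xy R @^-1` A) x))%E)//.
rewrite -(intE _ mF (fun x => measure_ge0 _ _)) expr2 EFinM -muleA; congr (_ * _)%E.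
have mA2 : measurable (@of_xy R @^-1` [set z | A (r%:C * z)]).
  apply: measurable_xyP; rewrite -[X in measurable X]setTI.
  have mr : measurable_fun setT (fun z : R[i] => r%:C * z).
    by apply: measurable_funcM; [exact: measurable_cst | exact: measurable_id].
  exact: mr.
rewrite -(@ge0_integralZl _ _ _ leb _ measurableT _ _ r%:E)//; last 2 first.
- by apply: measurable_fun_xsection.
- by rewrite lee_fin ltW.
apply: eq_integral => x _.
rewrite -[RHS](lebesgue_affine 0 r0); last exact: measurable_xsection.
congr (_ * leb _)%E; apply/seteqP; split => y /=.
  by rewrite /xsection /= !inE /of_xy /=; simpc.
by rewrite /xsection /= !inE /of_xy /=; simpc.
Qed.

End area_basics.

(** * Mean value property against a radial weight *)

Section invariance.
Variable R : realType.
Local Notation leb := (@lebesgue_measure R).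
Local Notation dA := (@area R).

Lemma ge0_integral_area_preserving phi (f : R[i] -> \bar R) :
  area_preserving phi -> measurable_fun setT f -> (forall z, 0 <= f z)%E ->
  (\int[dA]_z f (phi z) = \int[dA]_z f z)%E.
Proof.
move=> [mphi aphi] mf f0.
have -> : (\int[dA]_z f (phi z) = \int[pushforward dA phi]_z f z)%E.
  by rewrite [RHS]ge0_integral_pushforward.
by apply: eq_measure_integral => A mA _; exact: aphi.
Qed.

Lemma integrable_area_preserving phi (f : R[i] -> \bar R) :
  area_preserving phi -> dA.-integrable setT f ->
  dA.-integrable setT (f \o phi).
Proof.
move=> [mphi aphi] /integrableP[mf fi]; apply/integrableP; split.
  exact: measurableT_comp.
rewrite (@ge0_integral_area_preserving phi (fun z => `|f z|%E)) //.
exact: measurableT_comp.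
Qed.

Lemma integral_area_preserving phi (f : R[i] -> \bar R) :
  area_preserving phi -> dA.-integrable setT f ->
  (\int[dA]_z f (phi z) = \int[dA]_z f z)%E.
Proof.
move=> aphi fi; have [mphi aphiE] := aphi.
have mf : measurable_fun setT f by case/integrableP : fi.
have -> : (\int[dA]_z f (phi z) = \int[pushforward dA phi]_z f z)%E.
  rewrite [RHS]integral_pushforward//; exact: integrable_area_preserving.
by apply: eq_measure_integral => A mA _; exact: aphiE.
Qed.

Lemma integral_area_xy (f : R[i] -> \bar R) : measurable_fun setT f ->
  (forall z, 0 <= f z)%E ->
  (\int[dA]_z f z = \int[leb]_x \int[leb]_y f (x +i* y)%R)%E.
Proof.
move=> mf f0.
transitivity (\int[leb \x leb]_p f (of_xy p))%E.
  by rewrite ge0_integral_pushforward//; exact: measurable_of_xy.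
by rewrite fubini_tonelli1//; apply: measurableT_comp => //; exact: measurable_of_xy.
Qed.

Lemma measurable_expNsqr (c : R) :
  measurable_fun setT (fun z : R[i] => expR (- (c * normc z ^+ 2))).
Proof.
apply: measurableT_comp => //; apply: measurableT_comp => //.
by apply: measurable_funM => //; apply: measurable_funX; exact: measurable_normc.
Qed.

Lemma measurable_gauss_shift (a : R[i]) :
  measurable_fun setT (fun u : R[i] => expR (- normc (u - a) ^+ 2)).
Proof.
apply: measurableT_comp => //; apply: measurableT_comp => //; apply: measurable_funX.
by apply: measurable_fun_normc; apply: measurable_funcD => //; exact: measurable_cst.
Qed.

Lemma integral_gauss_area :
  (\int[dA]_z (expR (- normc z ^+ 2))%:E = pi%:E)%E.
Proof.
rewrite integral_area_xy; last 2 first.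
- apply/measurable_EFinP; have := measurable_expNsqr 1.
  by under eq_fun do rewrite mul1r.
- by move=> z; rewrite lee_fin expR_ge0.
under eq_integral => x _.
  under eq_integral => y _.
    rewrite sqr_normcE /= opprD expRD EFinM -/(gauss_fun x) -/(gauss_fun y).
    over.
  rewrite ge0_integralZl//; last 3 first.
  - by apply/measurable_EFinP; exact: measurable_gauss_fun.
  - by move=> y _; rewrite lee_fin gauss_fun_ge0.
  - by rewrite lee_fin gauss_fun_ge0.
  rewrite integralT_gauss; over.
rewrite ge0_integralZr//; last 2 first.
- by apply/measurable_EFinP; exact: measurable_gauss_fun.
- by move=> y _; rewrite lee_fin gauss_fun_ge0.
by rewrite integralT_gauss -EFinM -expr2 sqr_sqrtr// pi_ge0.
Qed.

Lemma circle_meanE (f : R[i] -> R[i]) : entire f ->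
  (\int[leb]_(t in `[0%R, (2 * pi)%R]) (complex.Re (f (cexp (0 +i* t))))%:E =
  (2 * pi * complex.Re (f 0))%:E)%E.
Proof.
move=> ef; rewrite -(circle_mean ef) /Rintegral fineK//.
apply: integrable_fin_num => //=; apply: continuous_itv_integrable.
exact: closed_form_continuousQ (exp_pair_form ef) 0.
Qed.

(** Mean value property of an entire function F against an integrable radial weight
    W. By invariance under rotations, the integral of Re F W is also that of
    Re F(e^(it) z) W(z) for each t; averaging over t and exchanging the integrals,
    the mean of F over each circle appears, which is F(0). *)
Lemma radial_mean (F : R[i] -> R[i]) (W : R[i] -> R) :
  entire F -> measurable_fun setT W -> radial W -> (forall z, 0 <= W z) ->
  dA.-integrable setT (EFin \o W) ->
  (\int[dA]_z (normc (F z) * W z)%:E < +oo)%E ->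
  (\int[dA]_z (complex.Re (F z) * W z)%:E =
   (complex.Re (F 0))%:E * \int[dA]_z (W z)%:E)%E.
Proof.
move=> eF mW rW W0 iW FW.
have mF := entire_measurable eF.
pose k z := complex.Re (F z) * W z.
have mk : measurable_fun setT k.
  by apply: measurable_funM => //; exact: measurable_fun_Re.
have ik : dA.-integrable setT (EFin \o k).
  apply/integrableP; split; first exact/measurable_EFinP.
  apply: le_lt_trans FW; apply: ge0_le_integral => //.
  - by apply: measurableT_comp => //; exact/measurable_EFinP.
  - apply/measurable_EFinP; apply: measurable_funM => //.
    exact: measurable_fun_normc.
  - move=> z _ /=; rewrite lee_fin normrM (ger0_norm (W0 z)) ler_wpM2r//.
    exact: normr_Re_le.
pose I := (`[0, 2 * pi]%classic : set (measurableTypeR R)).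
have mI : measurable I by exact: measurable_itv.
have pi2 : 0 <= 2 * pi :> R by rewrite mulr_ge0// pi_ge0.
have pi20 : 0 < 2 * pi :> R by rewrite mulr_gt0// pi_gt0.
have lI : leb I = (2 * pi)%:E.
  by rewrite /I lebesgue_measure_itv /= lte_fin pi20 -EFinB subr0.
pose e (t : R) : R[i] := cexp (0 +i* t).
have ne t : normc (e t) = 1 by rewrite normc_cexp /= expR0.
pose f (p : measurableTypeR R * R[i]) : \bar R := (\1_I p.1 * k (e p.1 * p.2))%:E.
have mrot : measurable_fun setT (fun p : measurableTypeR R * R[i] => e p.1 * p.2).
  apply: measurable_funcM => //; apply: measurable_fun_cexp.
  by apply: measurable_fun_complex => /=; [exact: measurable_cst|exact: measurable_fst].
have mf : measurable_fun setT f.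
  apply/measurable_EFinP; apply: measurable_funM.
    by apply: measurableT_comp.
  exact: measurableT_comp.
have rot t := area_rotate (ne t).
have If : (leb \x dA)%E.-integrable setT f.
  apply/integrable12ltyP => //.
  have mabs : measurable_fun setT (fun z => `|k z|%:E).
    by apply/measurable_EFinP; exact: measurableT_comp.
  have step t : (\int[dA]_z `|f (t, z)| = (\1_I t)%:E * \int[dA]_z (`|k z|)%:E)%E.
    rewrite -(@ge0_integral_area_preserving _ (fun z => (`|k z|)%:E) (rot t))//.
    rewrite -ge0_integralZl//; last first.
      by apply: measurableT_comp mabs _; case: (rot t).
    by apply: eq_integral => z _; rewrite /f /= normrM -EFinM ger0_norm.
  under eq_integral do rewrite step.
  rewrite ge0_integralZr//; last 2 first.
  - by apply/measurable_EFinP.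
  - by apply: integral_ge0 => z _; rewrite lee_fin.
  rewrite integral_indic// setIT; rewrite [X in (X * _)%E]lI.
  by apply: lte_mul_pinfty => //; case/integrableP : ik.
have iK := integrable_fin_num measurableT ik.
have stepF t : fubini_F dA f t = ((\1_I t)%:E * (fine (\int[dA]_z (k z)%:E))%:E)%E.
  rewrite fineK// -(integral_area_preserving (rot t) ik) -integralZl//.
  exact: integrable_area_preserving.
have stepG z : fubini_G leb f z = ((2 * pi * complex.Re (F 0))%:E * (W z)%:E)%E.
  have eFz : entire (fun w => F (w * z)).
    by apply: (entire_comp eF); apply: entireM; [exact: entire_id|exact: entire_cst].
  have := circle_meanE eFz; rewrite mul0r => <-.
  rewrite -integralZr//; last first.
    apply: continuous_itv_integrable.
    exact: closed_form_continuousQ (exp_pair_form eFz) 0.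
  rewrite [RHS]integral_mkcond; apply: eq_integral => t _.
  rewrite /f /k /= patchE indicE; case: ifPn => _; last by rewrite mul0r.
  rewrite mul1r -EFinM; congr (_ * _)%:E.
  by apply: rW; rewrite Normc.normcM ne mul1r.
have H : (\int[leb]_t fubini_F dA f t = \int[dA]_z fubini_G leb f z)%E := Fubini If.
rewrite (eq_integral _ _ (fun t _ => stepF t)) in H.
rewrite (eq_integral _ _ (fun z _ => stepG z)) in H.
move: H; rewrite integralZr//; last first.
  apply/integrableP; split; first exact/measurable_EFinP.
  under eq_integral do rewrite gee0_abs ?lee_fin//.
  by rewrite integral_indic// setIT (le_lt_trans _ (ltry (2 * pi)))// -lI.
rewrite integral_indic// setIT [X in (X * _)%E]lI integralZl// fineK//.
have -> : (2 * pi * complex.Re (F 0))%:E = ((2 * pi)%:E * (complex.Re (F 0))%:E)%E.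
  by rewrite -EFinM.
move=> H; have := congr1 (fun x => ((2 * pi)^-1%:E * x)%E) H.
by rewrite !muleA -!EFinM !mulVf ?gt_eqF// mul1e mul1r.
Qed.

End invariance.

(** * Integration against a measure with a density *)

Section density_integral.
Local Open Scope ereal_scope.
Context d (T : measurableType d) (R : realType).
Variables (m : {measure set T -> \bar R}) (w : T -> R).
Hypotheses (mw : measurable_fun [set: T] w) (w0 : forall x, (0 <= w x)%R).
Import HBNNSimple.

Lemma ge0_integral_density (f : T -> \bar R) : measurable_fun setT f ->
  (forall x, 0 <= f x) ->
  \int[density m mw w0]_x f x = \int[m]_x ((w x)%:E * f x).
Proof.
move=> mf f0; pose f_ := nnsfun_approx measurableT mf.
have mwE : measurable_fun setT (EFin \o w) by exact/measurable_EFinP.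
have cvgf x : EFin \o f_ ^~ x @ \oo --> f x by exact: cvg_nnsfun_approx.
transitivity (limn (fun n => \int[density m mw w0]_x (f_ n x)%:E)).
  rewrite -monotone_convergence//.
  - by apply: eq_integral => x _; apply/esym/cvg_lim => //; exact: cvgf.
  - by move=> n; exact/measurable_EFinP.
  - by move=> n x _; rewrite lee_fin.
  - by move=> x _ i j ij; rewrite lee_fin; exact/lefP/nd_nnsfun_approx.
transitivity (limn (fun n => \int[m]_x ((w x)%:E * (f_ n x)%:E))); last first.
  rewrite -monotone_convergence//.
  - apply: eq_integral => x _; apply/cvg_lim => //.
    by apply: cvgeZl => //; exact: cvgf.
  - by move=> n; apply: emeasurable_funM => //; exact/measurable_EFinP.
  - by move=> n x _; rewrite -EFinM lee_fin mulr_ge0.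
  - move=> x _ i j ij; apply: lee_wpmul2l; first by rewrite lee_fin.
    by rewrite lee_fin; exact/lefP/nd_nnsfun_approx.
congr (limn _); apply/funext => n.
under [LHS]eq_integral do rewrite fimfunE -fsumEFin//.
rewrite [LHS]ge0_integral_fsum//; last 2 first.
- by move=> r; exact/measurable_EFinP/measurableT_comp.
- by move=> r x _; rewrite nnfun_muleindic_ge0.
have h0 r x : 0 <= (r * \1_(f_ n @^-1` [set r]) x)%:E.
  by rewrite EFinM nnfun_muleindic_ge0.
under [RHS]eq_integral do rewrite fimfunE -fsumEFin// ge0_mule_fsumr//.
rewrite [RHS]ge0_integral_fsum//; last 2 first.
- move=> r; apply: emeasurable_funM => //.
  exact/measurable_EFinP/measurableT_comp.
- by move=> r x _; rewrite mule_ge0// lee_fin.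
apply: eq_fsbigr => r _.
have mfr : measurable (f_ n @^-1` [set r]) by [].
have [r0|r0] := leP 0%R r; last first.
  have f0r : f_ n @^-1` [set r] = set0.
    rewrite -subset0 => x /= fxr; move: r0; rewrite -fxr ltNge.
    by move/negP; apply.
  rewrite f0r; under eq_integral do rewrite indic0 mulr0.
  by under [RHS]eq_integral do rewrite indic0 mulr0 mule0; rewrite !integral0.
rewrite integralZl_indic_nnsfun// integral_indic// setIT.
under eq_integral do rewrite EFinM muleCA.
rewrite ge0_integralZl//; last 2 first.
- by apply: emeasurable_funM => //; exact/measurable_EFinP.
- by move=> x _; rewrite mule_ge0// lee_fin.
congr (_ * _); rewrite /= /density integral_mkcond.
apply: eq_integral => x _; rewrite patchE indicE.
by case: ifPn => _; rewrite ?mule1 ?mule0.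
Qed.

End density_integral.

Lemma integralZl_ge0 d (T : measurableType d) (R : realType)
    (m : {measure set T -> \bar R}) (k : R) (f : T -> R) :
  0 <= k -> measurable_fun setT f -> (forall x, 0 <= f x) ->
  (\int[m]_x (k * f x)%:E = k%:E * \int[m]_x (f x)%:E)%E.
Proof.
move=> k0 mf f0; under eq_integral do rewrite EFinM.
rewrite ge0_integralZl//; first exact/measurable_EFinP.
by move=> x _; rewrite lee_fin.
Qed.

(** * Local control of entire functions by Gaussian averages *)

Section fock.
Variable R : realType.
Local Notation dA := (@area R).
Implicit Types (f h : R[i] -> R[i]) (z u a : R[i]).

Lemma normc_conj z : normc (z^*) = normc z.
Proof. by case: z => x y /=; rewrite sqrrN. Qed.

Lemma mulC_conj z : z * z^* = (normc z ^+ 2)%:C.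
Proof. by rewrite sqr_normcE; case: z => x y; simpc; congr (_ +i* _); ring. Qed.

(** The sub-mean value property of |F|^2, obtained from the mean value property of
    the entire function conj(F(0))^2 F^2, whose value at 0 is |F(0)|^4. *)
Lemma sub_mean (F : R[i] -> R[i]) (W : R[i] -> R) :
  entire F -> measurable_fun setT W -> radial W -> (forall z, 0 <= W z) ->
  dA.-integrable setT (EFin \o W) ->
  ((normc (F 0) ^+ 2)%:E * \int[dA]_z (W z)%:E <=
   \int[dA]_z (normc (F z) ^+ 2 * W z)%:E)%E.
Proof.
move=> eF mW rW W0 iW.
have mF := entire_measurable eF.
have mFW : measurable_fun setT (fun z => normc (F z) ^+ 2 * W z).
  by apply: measurable_funM => //; apply: measurable_funX; exact: measurable_fun_normc.
have [Foo|] := ltP (\int[dA]_z (normc (F z) ^+ 2 * W z)%:E)%E +oo%E; last first.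
  by rewrite leye_eq => /eqP ->; exact: leey.
have [F0|F0] := eqVneq (F 0) 0.
  rewrite F0 Normc.normc0 expr0n mul0e integral_ge0// => z _.
  by rewrite lee_fin mulr_ge0// sqr_ge0.
pose c : R[i] := ((F 0)^*) ^+ 2.
pose G z := c * (F z * F z).
have eG : entire G.
  by apply: entireM; [exact: entire_cst|exact: entireM].
have nc : normc c = normc (F 0) ^+ 2.
  by rewrite /c expr2 Normc.normcM normc_conj -expr2.
have nG z : normc (G z) = normc (F 0) ^+ 2 * normc (F z) ^+ 2.
  by rewrite /G (Normc.normcM c) nc (Normc.normcM (F z)) -expr2.
have n0 : 0 < normc (F 0) ^+ 2 by rewrite exprn_gt0// normc_gt0.
have IG : (\int[dA]_z (normc (G z) * W z)%:E =
    (normc (F 0) ^+ 2)%:E * \int[dA]_z (normc (F z) ^+ 2 * W z)%:E)%E.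
  under eq_integral do rewrite nG -mulrA.
  rewrite integralZl_ge0//; first exact: ltW.
  by move=> z; rewrite mulr_ge0// sqr_ge0.
have Goo : (\int[dA]_z (normc (G z) * W z)%:E < +oo)%E.
  by rewrite IG; apply: lte_mul_pinfty => //; rewrite lee_fin ltW.
have G0 : complex.Re (G 0) = (normc (F 0) ^+ 2) ^+ 2.
  rewrite /G /c -expr2 -exprMn.
  by rewrite mulrC mulC_conj -rmorphXn.
have := radial_mean eG mW rW W0 iW Goo.
rewrite G0 => H.
have : ((normc (F 0) ^+ 2)%:E * ((normc (F 0) ^+ 2)%:E * \int[dA]_z (W z)%:E) <=
    (normc (F 0) ^+ 2)%:E * \int[dA]_z (normc (F z) ^+ 2 * W z)%:E)%E.
  have mG := entire_measurable eG.
  have mk : measurable_fun setT (fun z => (complex.Re (G z) * W z)%:E).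
    by apply/measurable_EFinP; apply: measurable_funM => //; exact: measurable_fun_Re.
  rewrite muleA -EFinM -expr2 -H -IG (le_trans (lee_abs _))//.
  rewrite (le_trans (le_abse_integral _ _ mk))// ge0_le_integral//.
  - exact: measurableT_comp.
  - by apply/measurable_EFinP; apply: measurable_funM => //; exact: measurable_fun_normc.
  - move=> z _; rewrite /= lee_fin normrM (ger0_norm (W0 z)) ler_wpM2r//.
    exact: normr_Re_le.
by rewrite lee_pmul2l.
Qed.

Lemma integrable_gauss_area : dA.-integrable setT
  (EFin \o (fun z : R[i] => expR (- normc z ^+ 2))).
Proof.
have mg : measurable_fun setT (fun z : R[i] => (expR (- normc z ^+ 2))%:E).
  by apply/measurable_EFinP; have := measurable_expNsqr (1 : R); under eq_fun do rewrite mul1r.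
apply/integrableP; split => //=.
by under eq_integral do rewrite ger0_norm ?expR_ge0//; rewrite integral_gauss_area ltry.
Qed.

Lemma integrable_gauss2_area : dA.-integrable setT
  (EFin \o (fun z : R[i] => expR (- (2 * normc z ^+ 2)))).
Proof.
apply: le_integrable integrable_gauss_area => //.
  by apply/measurable_EFinP; exact: measurable_expNsqr.
move=> z _; rewrite /= lee_fin !ger0_norm ?expR_ge0// ler_expR lerN2.
by rewrite ler_peMl ?sqr_ge0// ler1n.
Qed.

(** The mass of the weight e^(-2 |z|^2). Its value pi / 2 is not needed below, only
    that it is positive and finite. *)
Definition gauss2_mass : R := fine (\int[dA]_z (expR (- (2 * normc z ^+ 2)))%:E).

Lemma gauss2_massE :
  (\int[dA]_z (expR (- (2 * normc z ^+ 2)))%:E = gauss2_mass%:E)%E.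
Proof. by rewrite fineK// (integrable_fin_num _ integrable_gauss2_area). Qed.

Lemma gauss2_mass_gt0 : 0 < gauss2_mass.
Proof.
rewrite -lte_fin -gauss2_massE.
have mD := @measurable_cdisc R 1.
apply: (@lt_le_trans _ _ (\int[dA]_(z in [set z : R[i] | (normc z <= 1)%R]) (expR (- 2))%:E)%E).
  by rewrite integral_cst// mule_gt0//; exact: area_cdisc_gt0.
rewrite integral_mkcond; apply: ge0_le_integral => //.
- by move=> z _; rewrite patchE; case: ifPn => // _; rewrite lee_fin expR_ge0.
- by apply/(measurable_restrictT _ mD); exact: measurable_cst.
- by apply/measurable_EFinP; exact: measurable_expNsqr.
move=> z _; rewrite patchE; case: ifPn => [|_]; last by rewrite lee_fin expR_ge0.
rewrite inE /= => z1; rewrite lee_fin ler_expR lerN2 ler_piMr// expr_le1//.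
exact: normc_ge0.
Qed.

(** The weighted square |f|^2 e^(-|.|^2) at z is controlled by its Gaussian average
    around z: the sub-mean value property for F(w) = f(w + z) e^(- conj(z) w) with
    weight e^(-2 |w|^2), completing the square. *)
Lemma Fock_local f z : entire f ->
  ((normc (f z) ^+ 2 * expR (- normc z ^+ 2) * gauss2_mass)%:E <=
   \int[dA]_u (normc (f u) ^+ 2 * expR (- normc u ^+ 2) *
               expR (- normc (u - z) ^+ 2))%:E)%E.
Proof.
move=> ef; pose F w := f (w + z) * cexp (- z^* * w).
have eF : entire F.
  apply: entireM.
    by apply: (entire_comp ef); apply: entireD; [exact: entire_id|exact: entire_cst].
  apply: (entire_comp (@entire_cexp R)).
  by apply: entireM; [exact: entire_cst|exact: entire_id].
have := sub_mean eF (measurable_expNsqr (2 : R)) _ (fun=> expR_ge0 _) integrable_gauss2_area.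
have rW : radial (fun z : R[i] => expR (- (2 * normc z ^+ 2))).
  by move=> u v /= ->.
move=> /(_ rW); rewrite gauss2_massE /F add0r mulr0 cexp0 mulr1.
have mf := entire_measurable ef.
have mG0 : measurable_fun setT (fun u => normc (f u) ^+ 2 * expR (- normc u ^+ 2) *
    expR (- normc (u - z) ^+ 2)).
  apply: measurable_funM; last exact: measurable_gauss_shift.
  apply: measurable_funM.
    by apply: measurable_funX; exact: measurable_fun_normc.
  by have := measurable_gauss_shift (0 : R[i]); under eq_fun do rewrite subr0.
have G0 u : 0 <= normc (f u) ^+ 2 * expR (- normc u ^+ 2) *
    expR (- normc (u - z) ^+ 2).
  by rewrite mulr_ge0 ?expR_ge0// mulr_ge0 ?sqr_ge0 ?expR_ge0.
have -> : (\int[dA]_w (normc (f (w + z) * cexp (- z^* * w)) ^+ 2 *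
      expR (- (2 * normc w ^+ 2)))%:E =
   (expR (normc z ^+ 2))%:E * \int[dA]_u (normc (f u) ^+ 2 * expR (- normc u ^+ 2) *
               expR (- normc (u - z) ^+ 2))%:E)%E.
  rewrite -integralZl_ge0 ?expR_ge0//.
  rewrite -[RHS](@ge0_integral_area_preserving _ (fun w => w + z)); last 3 first.
  - exact: area_translate.
  - by apply/measurable_EFinP; apply: measurable_funM.
  - by move=> u; rewrite lee_fin mulr_ge0 ?expR_ge0//; exact: G0.
  apply: eq_integral => w _; congr EFin.
  rewrite Normc.normcM normc_cexp exprMn addrK -expRM_natl.
  move: (normc (f (w + z)) ^+ 2) => n.
  rewrite -!mulrA -!expRD [RHS]mulrCA -expRD; congr (_ * expR _).
  by rewrite !sqr_normcE; case: z {F eF mG0 G0} w => a b [c d]; simpc => /=; ring.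
rewrite -EFinM => h.
rewrite -(@lee_pmul2l _ (expR (normc z ^+ 2))%:E) ?lte_fin ?expR_gt0//.
rewrite (le_trans _ h)// -EFinM lee_fin le_eqVlt; apply/predU1P; left.
rewrite mulrA mulrCA -expRD subrr expR0; ring.
Qed.

End fock.

(** * Norm and inner product of the Gaussian L^2 space *)

Section fock_norm.
Variable R : realType.
Local Notation dA := (@area R).
Implicit Types (f h : R[i] -> R[i]) (z u a : R[i]).

Lemma normc_distC z u : normc (z - u) = normc (u - z).
Proof. by rewrite -normcN opprB. Qed.

Lemma integral_mu (k : R[i] -> R) : measurable_fun setT k ->
  (\int[@mu R]_z (k z)%:E = \int[dA]_z (gauss z * k z)%:E)%E.
Proof.
move=> mk; rewrite integralE [RHS]integralE.
have mkE : measurable_fun setT (EFin \o k) by exact/measurable_EFinP.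
congr (_ - _)%E.
- rewrite ge0_integral_density; last 2 first.
  + exact: measurable_funepos.
  + by move=> z; exact: funepos_ge0.
  apply: eq_integral => z _; rewrite !funeposE.
  by rewrite /= -!EFin_max -EFinM maxr_pMr ?gauss_ge0// mulr0.
- rewrite ge0_integral_density; last 2 first.
  + exact: measurable_funeneg.
  + by move=> z; exact: funeneg_ge0.
  apply: eq_integral => z _; rewrite !funenegE.
  by rewrite /= -!EFin_max -EFinM maxr_pMr ?gauss_ge0// mulr0 mulrN.
Qed.

Lemma sqL2normE f : measurable_fun setT f ->
  sqL2norm f = (\int[dA]_z (gauss z * normc (f z) ^+ 2)%:E)%E.
Proof. by move=> mf; rewrite -integral_mu//; exact: measurable_sqr_normc. Qed.

Lemma sqL2norm_ge0 f : (0 <= sqL2norm f)%E.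
Proof. by apply: integral_ge0 => z _; rewrite lee_fin sqr_ge0. Qed.

Lemma sqr_L2norm f : (sqL2norm f < +oo)%E -> sqL2norm f = (L2norm f ^+ 2)%:E.
Proof.
move=> foo; rewrite sqr_sqrtr ?fine_ge0 ?sqL2norm_ge0// fineK//.
by rewrite ge0_fin_numE// sqL2norm_ge0.
Qed.

Lemma L2norm_ge0 f : 0 <= L2norm f.
Proof. exact: sqrtr_ge0. Qed.

Lemma F2_L2 f : F2 f -> L2 f.
Proof. by move=> [/entire_measurable]. Qed.

(** The optimal t is b / a, when both are positive; the general case follows by
    perturbing a and b. *)
Lemma young_limit (X a b : R) : 0 <= a -> 0 <= b ->
  (forall t : R, 0 < t -> 2 * X <= t * a ^+ 2 + t^-1 * b ^+ 2) -> X <= a * b.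
Proof.
move=> a0 b0 h; apply/ler_addgt0Pr => e e0.
pose d := e / (a + b + 1).
have s0 : 0 < a + b + 1 by rewrite ltr_wpDl// addr_ge0.
have d0 : 0 < d by rewrite divr_gt0.
have ad : 0 < a + d by rewrite ltr_wpDl.
have bd : 0 < b + d by rewrite ltr_wpDl.
have := h ((b + d) / (a + d)) (divr_gt0 bd ad); rewrite invf_div.
have h1 : (b + d) / (a + d) * a ^+ 2 <= (b + d) * a.
  rewrite -mulrA ler_pM2l// mulrC ler_pdivrMr// expr2 ler_wpM2l//.
  by rewrite lerDl ltW.
have h2 : (a + d) / (b + d) * b ^+ 2 <= (a + d) * b.
  rewrite -mulrA ler_pM2l// mulrC ler_pdivrMr// expr2 ler_wpM2l//.
  by rewrite lerDl ltW.
have h3 : d * (a + b) <= e.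
  by rewrite /d mulrAC ler_pdivrMr// ler_pM2l// lerDl.
by nra.
Qed.

(** Integrate 2 |f h| <= t |f|^2 + |h|^2 / t and optimize over t. *)
Lemma L2_cauchy_schwarz f h : L2 f -> L2 h ->
  (\int[@mu R]_z (normc (f z) * normc (h z))%:E <= (L2norm f * L2norm h)%:E)%E.
Proof.
move=> [mf foo] [mh hoo].
have mfh : measurable_fun setT (fun z => normc (f z) * normc (h z)).
  by apply: measurable_funM; exact: measurable_fun_normc.
have fh0 z : 0 <= normc (f z) * normc (h z) by rewrite mulr_ge0 ?normc_ge0.
have young (t : R) : 0 < t -> (2%:E * \int[@mu R]_z (normc (f z) * normc (h z))%:E <=
    (t * L2norm f ^+ 2 + t^-1 * L2norm h ^+ 2)%:E)%E.
  move=> t0; have ti0 : 0 < t^-1 by rewrite invr_gt0.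
  have sq0 (k : R[i] -> R[i]) z : 0 <= normc (k z) ^+ 2 by exact: sqr_ge0.
  have -> : (t * L2norm f ^+ 2 + t^-1 * L2norm h ^+ 2)%:E =
      (t%:E * sqL2norm f + t^-1%:E * sqL2norm h)%E.
    by rewrite (sqr_L2norm foo) (sqr_L2norm hoo).
  rewrite -integralZl_ge0//.
  rewrite -(integralZl_ge0 _ (ltW t0) (measurable_sqr_normc mf) (sq0 f)).
  rewrite -(integralZl_ge0 _ (ltW ti0) (measurable_sqr_normc mh) (sq0 h)).
  have mtf : measurable_fun setT (fun z => (t * normc (f z) ^+ 2)%:E).
    by apply/measurable_EFinP; apply: measurable_funM => //; exact: measurable_sqr_normc.
  have mth : measurable_fun setT (fun z => (t^-1 * normc (h z) ^+ 2)%:E).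
    by apply/measurable_EFinP; apply: measurable_funM => //; exact: measurable_sqr_normc.
  have tf0 z : (0 <= (t * normc (f z) ^+ 2)%:E)%E by rewrite lee_fin (mulr_ge0 (ltW t0)).
  have th0 z : (0 <= (t^-1 * normc (h z) ^+ 2)%:E)%E by rewrite lee_fin (mulr_ge0 (ltW ti0)).
  rewrite -ge0_integralD//; apply: ge0_le_integral => //.
  - by move=> z _; rewrite lee_fin mulr_ge0.
  - by apply/measurable_EFinP; apply: measurable_funM.
  - exact: emeasurable_funD.
  move=> z _; rewrite -EFinD lee_fin.
  move: (normc (f z)) (normc (h z)) => p q.
  have tt : t * t^-1 = 1 by rewrite divff// gt_eqF.
  have := mulr_ge0 (ltW ti0) (sqr_ge0 (t * p - q)).
  have -> : t^-1 * (t * p - q) ^+ 2 = t * t^-1 * (t * p ^+ 2) - 2 * (t * t^-1) * p * q + t^-1 * q ^+ 2.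
    ring.
  by rewrite tt; lra.
have fin : (\int[@mu R]_z (normc (f z) * normc (h z))%:E \is a fin_num)%E.
  rewrite ge0_fin_numE; last by apply: integral_ge0 => z _; rewrite lee_fin.
  have := young _ ltr01; rewrite mul1r invr1 mul1r.
  case: (\int[_]_z _)%E => [r|//|//]; first by rewrite ltry.
  by rewrite gt0_muley ?lte_fin.
rewrite -(fineK fin) lee_fin; apply: young_limit; rewrite ?L2norm_ge0// => t t0.
by rewrite -lee_fin EFinM fineK//; exact: young.
Qed.

(** The triangle inequality for complex integrals, whose real and imaginary parts
    are integrated separately: project F on the direction of its integral. *)
Lemma normc_integral (F : R[i] -> R[i]) : measurable_fun setT F ->
  (\int[@mu R]_z (normc (F z))%:E < +oo)%E ->
  ((normc ((\int[@mu R]_z complex.Re (F z)) +i* (\int[@mu R]_z complex.Im (F z))))%:E <=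
   \int[@mu R]_z (normc (F z))%:E)%E.
Proof.
move=> mF Foo; have mn := measurable_fun_normc mF.
have iN : (@mu R).-integrable setT (EFin \o (fun z => normc (F z))).
  apply/integrableP; split; first exact/measurable_EFinP.
  by under eq_integral do rewrite /= ger0_norm ?normc_ge0//.
have iRe : (@mu R).-integrable setT (EFin \o (fun z => complex.Re (F z))).
  apply: le_integrable iN => //; first by apply/measurable_EFinP; exact: measurable_fun_Re.
  by move=> z _; rewrite /= lee_fin (ger0_norm (normc_ge0 _)) normr_Re_le.
have iIm : (@mu R).-integrable setT (EFin \o (fun z => complex.Im (F z))).
  apply: le_integrable iN => //; first by apply/measurable_EFinP; exact: measurable_fun_Im.
  by move=> z _; rewrite /= lee_fin (ger0_norm (normc_ge0 _)) normr_Im_le.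
set a := Rintegral _ _ _; set b := Rintegral _ _ _.
have [->|I0] := eqVneq (a +i* b) 0.
  by rewrite Normc.normc0 integral_ge0// => z _; rewrite lee_fin normc_ge0.
have N0 : 0 < normc (a +i* b) by rewrite normc_gt0.
have iaRe : (@mu R).-integrable setT (EFin \o (fun z => a * complex.Re (F z))).
  exact: (integrableZl measurableT a iRe).
have ibIm : (@mu R).-integrable setT (EFin \o (fun z => b * complex.Im (F z))).
  exact: (integrableZl measurableT b iIm).
have iab : (@mu R).-integrable setT
    (EFin \o (fun z => a * complex.Re (F z) + b * complex.Im (F z))).
  exact: (integrableD measurableT iaRe ibIm).
have iNN : (@mu R).-integrable setT (EFin \o (fun z => normc (a +i* b) * normc (F z))).
  exact: (integrableZl measurableT (normc (a +i* b)) iN).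
have sqE : normc (a +i* b) ^+ 2 =
    \int[@mu R]_z (a * complex.Re (F z) + b * complex.Im (F z)).
  rewrite RintegralD// !RintegralZl// sqr_normcE /= !expr2 //.
rewrite -(fineK (integrable_fin_num measurableT iN)) lee_fin.
rewrite -(ler_pM2l N0) -expr2 sqE.
have -> : normc (a +i* b) * fine (\int[@mu R]_x (EFin \o (fun z => normc (F z))) x)%E =
    \int[@mu R]_z (normc (a +i* b) * normc (F z)).
  by rewrite RintegralZl.
apply: le_Rintegral => // z _.
have : complex.Re ((a +i* b)^* * F z) <= normc ((a +i* b)^* * F z).
  exact: le_trans (ler_norm _) (normr_Re_le _).
rewrite Normc.normcM normc_conj; apply: le_trans.
by case: (F z) => p q; simpc => /=; lra.
Qed.

Lemma inner_le f h : L2 f -> L2 h -> normc (inner f h) <= L2norm f * L2norm h.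
Proof.
move=> Lf Lh; have [mf _] := Lf; have [mh _] := Lh.
have CS := L2_cauchy_schwarz Lf Lh.
have nE : (\int[@mu R]_z (normc (f z * (h z)^*))%:E =
    \int[@mu R]_z (normc (f z) * normc (h z))%:E)%E.
  by under eq_integral do rewrite Normc.normcM normc_conj.
rewrite -lee_fin (le_trans _ CS)// -nE; apply: normc_integral.
  by apply: measurable_funcM => //; exact: measurable_funcJ.
by rewrite nE (le_lt_trans CS)// ltry.
Qed.

End fock_norm.

(** * Carleson measures and the Toeplitz form *)

Section carleson.
Variable R : realType.
Local Notation dA := (@area R).
Implicit Types (f h : R[i] -> R[i]) (g : R[i] -> R) (z u a : R[i]).

(** Uniform bounds on the integrals over an exhausting sequence of sets pass to the
    whole space. *)
Lemma integral_le_exhaustion d (T : measurableType d) (m : {measure set T -> \bar R})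
    (w : T -> R) (A : nat -> set T) (K : \bar R) :
  measurable_fun setT w -> (forall x, 0 <= w x) -> (forall n, measurable (A n)) ->
  (forall m n, (m <= n)%N -> A m `<=` A n) -> (forall x, exists n, A n x) ->
  (forall n, \int[m]_(x in A n) (w x)%:E <= K)%E ->
  (\int[m]_x (w x)%:E <= K)%E.
Proof.
move=> mw w0 mA ndA exA hK.
have AT : \bigcup_n A n = setT.
  by apply/seteqP; split => // x _; have [n An] := exA x; exists n.
have ndA' : nondecreasing_seq A by move=> i j ij; rewrite subsetEset; exact: ndA.
have mAw i : measurable_fun (A i) (fun x => (w x)%:E).
  by apply: measurable_funTS; exact/measurable_EFinP.
have w0' i x : A i x -> (0 <= (w x)%:E)%E by rewrite lee_fin.
have := ge0_nondecreasing_set_cvg_integral (mu := m) ndA' mA mAw w0'.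
rewrite AT => /cvg_lim <-//; apply: lime_le; last by apply: nearW.
apply: ereal_nondecreasing_is_cvgn.
exact: ge0_nondecreasing_set_nondecreasing_integral.
Qed.

Lemma Carleson_integralE g (mg : measurable_fun setT g) (g0 : forall z, 0 <= g z) h :
  measurable_fun setT h ->
  (\int[density (@mu R) mg g0]_z (normc (h z) ^+ 2)%:E =
   \int[@mu R]_z (g z * normc (h z) ^+ 2)%:E)%E.
Proof.
move=> mh; rewrite ge0_integral_density.
- by under eq_integral do rewrite -EFinM.
- by apply/measurable_EFinP; exact: measurable_sqr_normc.
- by move=> z; rewrite lee_fin; exact: sqr_ge0.
Qed.

Lemma gauss_avg_le g a :
  (pi^-1%:E * \int[dA]_z (expR (- normc (z - a) ^+ 2) * g z)%:E <= gauss_sup g)%E.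
Proof. by apply: ereal_sup_ubound; exists a. Qed.

(** Finiteness of the supremum, as a uniform real bound without the factor
    1 / pi. *)
Lemma gauss_sup_ltP g : measurable_fun setT g -> (forall z, 0 <= g z) ->
  (gauss_sup g < +oo)%E <-> exists M : R, 0 < M /\
    forall a, (\int[dA]_z (expR (- normc (z - a) ^+ 2) * g z)%:E <= M%:E)%E.
Proof.
move=> mg g0; split=> [goo|[M [M0 hM]]].
  have g_ge0 : (0 <= gauss_sup g)%E.
    apply: le_trans (gauss_avg_le g 0); apply: mule_ge0.
      by rewrite lee_fin invr_ge0 pi_ge0.
    by apply: integral_ge0 => z _; rewrite lee_fin mulr_ge0// expR_ge0.
  have gfin : gauss_sup g \is a fin_num by rewrite ge0_fin_numE.
  have fg0 : 0 <= fine (gauss_sup g) by rewrite fine_ge0.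
  exists (pi * (fine (gauss_sup g) + 1)); split.
    by rewrite mulr_gt0 ?pi_gt0// ltr_wpDl.
  move=> a; rewrite -(@lee_pmul2l _ pi^-1%:E)//; last by rewrite lte_fin invr_gt0 pi_gt0.
  rewrite (le_trans (gauss_avg_le g a))// -EFinM mulKf ?gt_eqF ?pi_gt0//.
  by rewrite -(fineK gfin) lee_fin lerDl.
apply: (@le_lt_trans _ _ (pi^-1 * M)%:E); last exact: ltry.
apply: ge_ereal_sup => _ [a _ <-].
by rewrite EFinM lee_pmul2l// lte_fin invr_gt0 pi_gt0.
Qed.

(** If the Gaussian averages of g are bounded by M, then bounding |h(z)|^2 e^(-|z|^2)
    by its own Gaussian average and exchanging the integrals puts the Gaussian
    average of g in front of |h(u)|^2. *)
Lemma gauss_sup_Carleson g (mg : measurable_fun setT g) (g0 : forall z, 0 <= g z) :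
  (gauss_sup g < +oo)%E -> Fock_Carleson (density (@mu R) mg g0).
Proof.
move=> /(gauss_sup_ltP mg g0)[M [M0 hM]].
have k0 := gauss2_mass_gt0 R.
exists (M / gauss2_mass R); split; first by rewrite divr_gt0.
move=> h [eh hoo]; have mh := entire_measurable eh.
rewrite Carleson_integralE//.
have mg2 : measurable_fun setT (fun z => g z * normc (h z) ^+ 2).
  by apply: measurable_funM => //; exact: measurable_sqr_normc.
have g20 z : 0 <= g z * normc (h z) ^+ 2 by rewrite (mulr_ge0 (g0 z))// sqr_ge0.
rewrite integral_mu//.
rewrite -(@lee_pmul2l _ (gauss2_mass R)%:E)// -integralZl_ge0//; last 3 first.
- exact: ltW.
- by apply: measurable_funM => //; exact: measurable_gauss.
- by move=> z; rewrite mulr_ge0// gauss_ge0.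
pose k (p : R[i] * R[i]) := (pi^-1 * g p.1) * (normc (h p.2) ^+ 2 * expR (- normc p.2 ^+ 2) *
     expR (- normc (p.2 - p.1) ^+ 2)).
have k_ge0 p : 0 <= k p.
  rewrite (mulr_ge0 (mulr_ge0 _ (g0 _)))// ?invr_ge0 ?pi_ge0//.
  by rewrite (mulr_ge0 (mulr_ge0 (sqr_ge0 _) (expR_ge0 _)))// expR_ge0.
have mk : measurable_fun setT k.
  apply: measurable_funM.
    by apply: measurable_funM => //; exact: measurableT_comp.
  apply: measurable_funM; first apply: measurable_funM.
  - by apply: measurable_funX; apply: measurable_fun_normc; exact: measurableT_comp.
  - apply: measurableT_comp => //; apply: measurableT_comp => //; apply: measurable_funX.
    exact: measurable_fun_normc.
  - apply: measurableT_comp => //; apply: measurableT_comp => //; apply: measurable_funX.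
    apply: measurable_fun_normc; apply: measurable_funcD => //.
    exact: measurable_funcN.
apply: (@le_trans _ _ (\int[dA]_z \int[dA]_u (k (z, u))%:E)%E).
  apply: ge0_le_integral => //.
  - by move=> z _; rewrite lee_fin mulr_ge0 ?(ltW k0)// mulr_ge0// gauss_ge0.
  - by apply/measurable_EFinP; do 2 apply: measurable_funM => //; exact: measurable_gauss.
  - apply: (@measurable_fun_fubini_tonelli_F _ _ _ _ _ dA (EFin \o k)) => //.
    exact/measurable_EFinP.
  move=> z _.
  have c0 : 0 <= pi^-1 * g z by rewrite mulr_ge0// invr_ge0 pi_ge0.
  rewrite /k /= (integralZl_ge0 _ c0); last 2 first.
  - apply: measurable_funM; last exact: measurable_gauss_shift.
    apply: measurable_funM; first exact: measurable_sqr_normc.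
    by have := measurable_gauss_shift (0 : R[i]); under eq_fun do rewrite subr0.
  - by move=> u; rewrite (mulr_ge0 (mulr_ge0 (sqr_ge0 _) (expR_ge0 _)))// expR_ge0.
  rewrite [X in (X%:E <= _)%E](_ : _ = (pi^-1 * g z) *
    (normc (h z) ^+ 2 * expR (- normc z ^+ 2) * gauss2_mass R)); last first.
    by rewrite /gauss; move: (normc (h z) ^+ 2) => n; ring.
  by rewrite EFinM; apply: lee_wpmul2l => //; exact: Fock_local.
rewrite (fubini_tonelli (EFin \o k)); last 2 first.
- exact/measurable_EFinP.
- by move=> p; rewrite lee_fin.
have mgh : measurable_fun setT (fun u => gauss u * normc (h u) ^+ 2).
  by apply: measurable_funM; [exact: measurable_gauss|exact: measurable_sqr_normc].
have gh0 (u : R[i]) : 0 <= gauss u * normc (h u) ^+ 2.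
  by rewrite (mulr_ge0 (gauss_ge0 _))// sqr_ge0.
apply: (@le_trans _ _ (\int[dA]_u (M * (gauss u * normc (h u) ^+ 2))%:E)%E).
  apply: ge0_le_integral => //.
  - by move=> u _; apply: integral_ge0 => z _; rewrite lee_fin.
  - apply: (@measurable_fun_fubini_tonelli_G _ _ _ _ _ dA (EFin \o k)) => //.
    exact/measurable_EFinP.
  - by apply/measurable_EFinP; apply: measurable_funM.
  move=> u _; rewrite [M * _]mulrC.
  apply: (@le_trans _ _ ((gauss u * normc (h u) ^+ 2)%:E *
      \int[dA]_z (expR (- normc (z - u) ^+ 2) * g z)%:E)%E); last first.
    by rewrite [leRHS]EFinM; apply: lee_wpmul2l => //; rewrite lee_fin.
  rewrite -(integralZl_ge0 _ (gh0 u)); last 2 first.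
  - by apply: measurable_funM => //; exact: measurable_gauss_shift.
  - by move=> z; rewrite mulr_ge0// expR_ge0.
  rewrite le_eqVlt; apply/predU1P; left; apply: eq_integral => z _.
  rewrite /k /= /gauss normc_distC; congr EFin.
  by move: (normc (h u) ^+ 2) => n; ring.
rewrite (integralZl_ge0 _ (ltW M0))// -sqL2normE// sqr_L2norm//.
move: (L2norm h ^+ 2) => n; rewrite -[leRHS]EFinM -[leLHS]EFinM lee_fin.
have kn0 : gauss2_mass R != 0 by rewrite gt_eqF.
by rewrite [leRHS](_ : _ = M * n)//; field.
Qed.

(** The normalized reproducing kernel at a; its squared modulus times the Gaussian
    density is the Gaussian density centred at a. *)
Definition knorm a z : R[i] := cexp (a^* * z - (normc a ^+ 2 / 2)%:C).

Lemma sqr_knorm a z :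
  gauss z * normc (knorm a z) ^+ 2 = pi^-1 * expR (- normc (z - a) ^+ 2).
Proof.
rewrite /gauss /knorm normc_cexp -expRM_natl -mulrA -expRD; congr (_ * expR _).
by rewrite !sqr_normcE; case: a z => x y [u v]; simpc => /=; field.
Qed.

Lemma entire_knorm a : entire (knorm a).
Proof.
apply: (entire_comp (@entire_cexp R)); apply: entireD; last exact: entire_cst.
by apply: entireM; [exact: entire_cst|exact: entire_id].
Qed.

Lemma sqL2norm_knorm a : sqL2norm (knorm a) = 1%:E.
Proof.
rewrite sqL2normE; last by apply: entire_measurable; exact: entire_knorm.
under eq_integral do rewrite sqr_knorm.
have cpi : 0 <= pi^-1 :> R by rewrite invr_ge0 pi_ge0.
rewrite (integralZl_ge0 _ cpi (measurable_gauss_shift a) (fun=> expR_ge0 _)).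
rewrite (@ge0_integral_area_preserving _ _ (fun z => (expR (- normc z ^+ 2))%:E) (area_translate (- a))).
- by rewrite integral_gauss_area -EFinM mulVf// gt_eqF// pi_gt0.
- by apply/measurable_EFinP; have := measurable_gauss_shift (0 : R[i]); under eq_fun do rewrite subr0.
- by move=> z; rewrite lee_fin expR_ge0.
Qed.

Lemma F2_knorm a : F2 (knorm a).
Proof. by split; [exact: entire_knorm|rewrite sqL2norm_knorm ltry]. Qed.

(** Testing the Carleson condition on the normalized kernel at a gives exactly the
    Gaussian average of g at a. *)
Lemma Carleson_gauss_sup g (mg : measurable_fun setT g) (g0 : forall z, 0 <= g z) :
  Fock_Carleson (density (@mu R) mg g0) -> (gauss_sup g < +oo)%E.
Proof.
move=> [C [C0 hC]]; apply: (@le_lt_trans _ _ C%:E); last exact: ltry.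
apply: ge_ereal_sup => _ [a _ <-].
have := hC _ (F2_knorm a).
have -> : L2norm (knorm a) = 1 by rewrite /L2norm sqL2norm_knorm /= sqrtr1.
have mk := entire_measurable (@entire_knorm a).
rewrite expr1n mulr1; apply: le_trans.
rewrite Carleson_integralE// integral_mu; last first.
  by apply: measurable_funM => //; exact: measurable_sqr_normc.
have cpi : 0 <= pi^-1 :> R by rewrite invr_ge0 pi_ge0.
rewrite -(integralZl_ge0 _ cpi); last 2 first.
- by apply: measurable_funM => //; exact: measurable_gauss_shift.
- by move=> z; rewrite mulr_ge0// expR_ge0.
rewrite le_eqVlt; apply/predU1P; left; apply: eq_integral => z _; congr EFin.
by rewrite mulrA -sqr_knorm mulrAC mulrA.
Qed.

Lemma normc_real (x : R) : 0 <= x -> normc x%:C = x.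
Proof. by move=> x0; rewrite /= expr0n addr0 sqrtr_sqr ger0_norm. Qed.

(** The function g^(1/2) f, in the form in which it occurs in the form domain of
    the symbol g. *)
Local Notation sqrtw g f := (fun z => ((Num.sqrt (normc (g z)%:C))%:C * f z)%R).

Lemma sqL2norm_sqrt_weight g f : (forall z, 0 <= g z) ->
  sqL2norm (sqrtw g f) =
  (\int[@mu R]_z (g z * normc (f z) ^+ 2)%:E)%E.
Proof.
move=> g0; apply: eq_integral => z _; congr EFin.
by rewrite Normc.normcM exprMn normc_real ?sqrtr_ge0// normc_real// sqr_sqrtr.
Qed.

Lemma measurable_sqrt_weight g f : measurable_fun setT g -> measurable_fun setT f ->
  measurable_fun setT (sqrtw g f).
Proof.
move=> mg mf; apply: measurable_funcM => //; apply: measurable_fun_real_complex.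
apply: measurableT_comp.
  by apply: continuous_measurable_fun; exact: sqrt_continuous.
by apply: measurable_fun_normc; exact: measurable_fun_real_complex.
Qed.

(** The form domain is then all of F^2, and the bound is the Cauchy-Schwarz
    inequality for g^(1/2) f and g^(1/2) h. *)
Lemma Carleson_form_bounded g (mg : measurable_fun setT g) (g0 : forall z, 0 <= g z) :
  Fock_Carleson (density (@mu R) mg g0) -> form_bounded (fun z => (g z)%:C).
Proof.
move=> [C [C0 hC]].
have normle f : F2 f -> (sqL2norm (sqrtw g f) <=
    (C * L2norm f ^+ 2)%:E)%E.
  move=> F2f; rewrite sqL2norm_sqrt_weight// -(Carleson_integralE mg g0).
    exact: hC.
  by case: (F2_L2 F2f).
have dom f : F2 f -> form_domain (fun z => (g z)%:C) f.
  move=> F2f; split => //; split.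
    by apply: measurable_sqrt_weight => //; case: (F2_L2 F2f).
  by rewrite (le_lt_trans (normle f F2f))// ltry.
have sqle f : F2 f -> L2norm (sqrtw g f) <=
    Num.sqrt C * L2norm f.
  move=> F2f; rewrite -(@ler_pXn2r _ 2) ?nnegrE ?mulr_ge0 ?sqrtr_ge0 ?L2norm_ge0//.
  rewrite exprMn (sqr_sqrtr (ltW C0)) -lee_fin -sqr_L2norm; first exact: normle.
  by case: (dom f F2f) => _ [].
split=> [f F2f e e0|].
  exists f; first exact: dom.
  rewrite /L2norm /sqL2norm; under eq_integral do rewrite subrr Normc.normc0 expr0n.
  by rewrite integral0 /= sqrtr0.
exists C; split => // f h [F2f Lf] [F2h Lh].
have -> : toeplitz_form (fun z => (g z)%:C) f h =
    inner (sqrtw g f)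
          (sqrtw g h).
  have E z : (g z)%:C * f z * (h z)^* = (Num.sqrt (normc (g z)%:C))%:C * f z *
      ((Num.sqrt (normc (g z)%:C))%:C * h z)^*.
    rewrite normc_real// -{1}(sqr_sqrtr (g0 z)).
    move: (Num.sqrt (g z)) (f z) (h z) => s [a b] [c d].
    by simpc; congr (_ +i* _); ring.
  by congr (_ +i* _); apply: eq_Rintegral => z _; rewrite E.
rewrite (le_trans (inner_le Lf Lh))//.
rewrite (le_trans (ler_pM _ _ (sqle f F2f) (sqle h F2h))) ?L2norm_ge0//.
by rewrite mulrACA -expr2 (sqr_sqrtr (ltW C0)) mulrA.
Qed.

Lemma sqr_normc_split u z :
  normc u ^+ 2 <= 2 * normc z ^+ 2 + 2 * normc (z - u) ^+ 2.
Proof.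
rewrite !sqr_normcE; case: z u => a b [c d] /=.
have := sqr_ge0 (2 * a - c); have := sqr_ge0 (2 * b - d); nra.
Qed.

Lemma sqL2norm_split f h : measurable_fun setT f -> measurable_fun setT h ->
  (sqL2norm h <= 2%:E * sqL2norm f + 2%:E * sqL2norm (fun z => (f z - h z)%R))%E.
Proof.
move=> mf mh.
have mfh : measurable_fun setT (fun z => f z - h z).
  by apply: measurable_funcD => //; exact: measurable_funcN.
have sq0 (k : R[i] -> R[i]) z : 0 <= normc (k z) ^+ 2 by exact: sqr_ge0.
have m1 := measurable_sqr_normc mf; have m2 := measurable_sqr_normc mfh.
have two0 : 0 <= 2 :> R by [].
rewrite /sqL2norm -(integralZl_ge0 _ two0 m1 (sq0 _)) -(integralZl_ge0 _ two0 m2 (sq0 _)).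
have m1' : measurable_fun setT (fun z => (2 * normc (f z) ^+ 2)%:E).
  by apply/measurable_EFinP; exact: measurable_funM.
have m2' : measurable_fun setT (fun z => (2 * normc (f z - h z) ^+ 2)%:E).
  by apply/measurable_EFinP; exact: measurable_funM.
rewrite -ge0_integralD//; last 2 first.
- by move=> z _; rewrite lee_fin (mulr_ge0 two0)// sq0.
- by move=> z _; rewrite lee_fin (mulr_ge0 two0)// (sq0 (fun z => f z - h z)).
apply: ge0_le_integral => //.
- by move=> z _; rewrite lee_fin sq0.
- by apply/measurable_EFinP; exact: measurable_sqr_normc.
- exact: emeasurable_funD.
by move=> z _; rewrite -EFinD lee_fin sqr_normc_split.
Qed.

(** On the domain, the bound at (h, h) is the Carleson inequality. To reach an
    arbitrary f in F^2, restrict the integral to the set where g <= n: there f may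
    be replaced by a member of the domain, at a cost of the order of n times the
    squared distance, which density makes arbitrarily small; the resulting constant
    does not depend on n. *)
Lemma form_bounded_Carleson g (mg : measurable_fun setT g) (g0 : forall z, 0 <= g z) :
  form_bounded (fun z => (g z)%:C) -> Fock_Carleson (density (@mu R) mg g0).
Proof.
move=> [dens [C [C0 hC]]]; exists (4 * C); split; first by rewrite mulr_gt0.
move=> f F2f; have Lf := F2_L2 F2f; have [mf foo] := Lf; rewrite Carleson_integralE//.
have domle h : form_domain (fun z => (g z)%:C) h ->
    (\int[@mu R]_z (g z * normc (h z) ^+ 2)%:E <= C%:E * sqL2norm h)%E.
  move=> dh; have [F2h Lh] := dh; have [mh hoo] := F2_L2 F2h.
  have := hC _ _ dh dh.
  have -> : toeplitz_form (fun z => (g z)%:C) h h =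
     (\int[@mu R]_z (g z * normc (h z) ^+ 2))%:C.
    have E z : (g z)%:C * h z * (h z)^* = (g z * normc (h z) ^+ 2)%:C.
      by rewrite -mulrA mulC_conj -rmorphM.
    rewrite /toeplitz_form /inner; congr (_ +i* _).
      by apply: eq_Rintegral => z _; rewrite E.
    under eq_Rintegral do rewrite E /=.
    by rewrite /Rintegral integral0.
  have int0 : 0 <= \int[@mu R]_z (g z * normc (h z) ^+ 2).
    by apply: Rintegral_ge0 => z _; rewrite (mulr_ge0 (g0 z))// sqr_ge0.
  rewrite normc_real// -mulrA -expr2 -lee_fin EFinM -sqr_L2norm//.
  rewrite /Rintegral fineK//.
  rewrite ge0_fin_numE; last first.
    by apply: integral_ge0 => z _; rewrite lee_fin (mulr_ge0 (g0 z))// sqr_ge0.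
  by move: Lh => [_]; rewrite sqL2norm_sqrt_weight.
pose w z := g z * normc (f z) ^+ 2.
have mw : measurable_fun setT w by apply: measurable_funM => //; exact: measurable_sqr_normc.
have w0 z : 0 <= w z by rewrite (mulr_ge0 (g0 z))// sqr_ge0.
pose A (n : nat) := [set z | g z <= n%:R].
have mA n : measurable (A n).
  rewrite -[X in measurable X]setTI (_ : A n = g @^-1` `]-oo, n%:R]%classic).
    by apply: mg => //; exact: measurable_itv.
  by apply/seteqP; split => z; rewrite /A /= in_itv.
apply: (integral_le_exhaustion (A := A)) => //.
- by move=> m n mn z /= /le_trans; apply; rewrite ler_nat.
- by move=> z; exists (Num.bound (g z)); exact/ltW/archi_boundP.
move=> n; apply/lee_addgt0Pr => e e0.
(* The error made by replacing f by h is at most c ||f - h||^2. *)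
pose c := 4 * C + 2 * n%:R + 1.
have c0 : 0 < c by rewrite ltr_wpDl// addr_ge0// mulr_ge0// ltW.
have ec0 : 0 < Num.sqrt (e / c) by rewrite sqrtr_gt0 divr_gt0.
have [h dh he] := dens f F2f _ ec0.
have [F2h Lh] := dh; have [mh hoo] := F2_L2 F2h.
have mfh : measurable_fun setT (fun z => f z - h z).
  by apply: measurable_funcD => //; exact: measurable_funcN.
have fhoo : (sqL2norm (fun z => (f z - h z)%R) < +oo)%E.
  apply: (le_lt_trans (sqL2norm_split mf mfh)).
  have -> : (fun z => (f z - (f z - h z))%R) = h by apply/funext => z; rewrite subKr.
  by rewrite (sqr_L2norm foo) (sqr_L2norm hoo) ltry.
pose D2 := L2norm (fun z => f z - h z) ^+ 2.
have D2e : D2 <= e / c.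
  rewrite /D2 -(sqr_sqrtr (divr_ge0 (ltW e0) (ltW c0))).
  by rewrite ler_pXn2r ?nnegrE ?sqrtr_ge0 ?L2norm_ge0// ltW.
have H2 : L2norm h ^+ 2 <= 2 * L2norm f ^+ 2 + 2 * D2.
  by have := sqL2norm_split mf mh; rewrite (sqr_L2norm hoo) (sqr_L2norm foo) (sqr_L2norm fhoo).
have two0 : 0 <= 2 :> R by [].
have n0 : 0 <= 2 * n%:R :> R by rewrite mulr_ge0.
pose w1 z := g z * normc (h z) ^+ 2.
have mw1 : measurable_fun setT w1 by apply: measurable_funM => //; exact: measurable_sqr_normc.
have w10 z : 0 <= w1 z by rewrite (mulr_ge0 (g0 z))// sqr_ge0.
have mw2 := measurable_sqr_normc mfh.
have w20 z : 0 <= normc (f z - h z) ^+ 2 by exact: sqr_ge0.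
apply: (@le_trans _ _ (2%:E * \int[@mu R]_z (w1 z)%:E + (2 * n%:R)%:E * sqL2norm (fun z => (f z - h z)%R))%E).
  rewrite /sqL2norm -(integralZl_ge0 _ two0 mw1 w10) -(integralZl_ge0 _ n0 mw2 w20).
  have m1' : measurable_fun setT (fun z => (2 * w1 z)%:E).
    by apply/measurable_EFinP; exact: measurable_funM.
  have m2' : measurable_fun setT (fun z => (2 * n%:R * normc (f z - h z) ^+ 2)%:E).
    by apply/measurable_EFinP; exact: measurable_funM.
  rewrite -ge0_integralD//; last 2 first.
  - by move=> z _; rewrite lee_fin (mulr_ge0 two0).
  - by move=> z _; rewrite lee_fin (mulr_ge0 n0).
  rewrite integral_mkcond; apply: ge0_le_integral => //.
  - by move=> z _; rewrite patchE; case: ifPn => // _; rewrite lee_fin; exact: w0.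
  - apply/(measurable_restrictT _ (mA n)); apply: measurable_funTS.
    exact/measurable_EFinP.
  - exact: emeasurable_funD.
  move=> z _; rewrite patchE; case: ifPn => [|_]; last first.
    by rewrite -EFinD lee_fin addr_ge0// (mulr_ge0 two0, mulr_ge0 n0).
  rewrite inE /A /= => gn; rewrite -EFinD lee_fin /w /w1.
  apply: (@le_trans _ _ (g z * (2 * normc (h z) ^+ 2 + 2 * normc (h z - f z) ^+ 2))).
    by rewrite ler_wpM2l// sqr_normc_split.
  rewrite mulrDr mulrCA lerD2l mulrCA -mulrA ler_wpM2l// normc_distC.
  by rewrite ler_wpM2r.
apply: (@le_trans _ _ (2%:E * (C%:E * sqL2norm h) + (2 * n%:R)%:E * sqL2norm (fun z => (f z - h z)%R))%E).
  by rewrite leeD2r// lee_wpmul2l ?lee_fin//; exact: domle.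
rewrite (sqr_L2norm hoo) (sqr_L2norm fhoo) -/D2 -!EFinM -!EFinD lee_fin.
have h1 : 2 * (C * L2norm h ^+ 2) <= 2 * (C * (2 * L2norm f ^+ 2 + 2 * D2)).
  by rewrite ler_pM2l// ler_pM2l.
have h2 : c * D2 <= e by rewrite mulrC -ler_pdivlMr.
have D0 : 0 <= D2 by rewrite sqr_ge0.
rewrite /c in h2; lra.
Qed.

(** At time 1/4 the heat transform is the Gaussian average, so that the supremum
    dominates the essential supremum. Conversely, an almost everywhere bound holds
    at points x arbitrarily close to a, and moving the centre from x to a costs a
    bounded factor on a large disc if x is close enough to a. *)
Lemma gauss_sup_Lnorm g (mg : measurable_fun setT g) (g0 : forall z, 0 <= g z) :
  (gauss_sup g < +oo)%E <-> (Lnorm dA +oo%E (heat (4^-1)%R g) < +oo)%E.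
Proof.
have heatE x : heat 4^-1 g x =
   (pi^-1%:E * \int[dA]_z (expR (- normc (z - x) ^+ 2) * g z)%:E)%E.
  rewrite /heat; congr ((_^-1)%:E * _)%E; first by field.
  apply: eq_integral => z _; rewrite mulrC normc_distC.
  by rewrite divff// divr1.
have h0 x : (0 <= heat 4^-1 g x)%E.
  rewrite heatE mule_ge0 ?lee_fin ?invr_ge0 ?pi_ge0//.
  by apply: integral_ge0 => z _; rewrite lee_fin mulr_ge0// expR_ge0.
have dA0 : (0 < dA setT)%E.
  apply: lt_le_trans (area_cdisc_gt0 ltr01) _; apply: le_measure; rewrite ?inE//.
  exact: measurable_cdisc.
rewrite unlock /Lnorm dA0; split => [goo|].
  apply: le_lt_trans goo; apply: ereal_inf_lbound => /=.
  apply: nearW => x /=; rewrite gee0_abs// heatE; exact: gauss_avg_le.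
move=> ess; apply/(gauss_sup_ltP mg g0).
have [M M0 hM] : exists2 M : R, 0 < M & (\forall x \ae dA, (heat 4^-1 g x <= M%:E)%E).
  have := ess_sup_inf.ess_sup_ge dA (abse \o heat 4^-1 g); move: ess.
  case: (ess_sup_inf.ess_sup dA _) => [r _|//|_] h.
    exists (Num.max r 1); first by rewrite lt_max ltr01 orbT.
    apply: filterS h => x /= hx; rewrite gee0_abs// in hx.
    by rewrite (le_trans hx)// lee_fin le_max lexx.
  exists 1 => //; apply: filterS h => x /= hx; exfalso.
  by move: hx; rewrite gee0_abs// leeNy_eq => /eqP hx; have := h0 x; rewrite hx.
have near_pt a (d : R) : 0 < d -> exists2 x, normc (x - a) <= d & (heat 4^-1 g x <= M%:E)%E.
  move=> d0; case: hM => N [mN N0 hN]; apply: contrapT => nex.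
  have sub : [set x | normc (x - a) <= d] `<=` N.
    by move=> x /= xd; apply: hN => /= hx; apply: nex; exists x.
  have : (0 < dA [set x | (normc (x - a) <= d)%R])%E.
    have [_ tr] := area_translate (- a).
    by have := area_cdisc_gt0 d0; rewrite -(tr _ (@measurable_cdisc R d)).
  rewrite lt_neqAle => /andP[/negP + _]; apply; apply/eqP/esym.
  apply: (subset_measure0 _ mN sub N0).
  have [mtr _] := area_translate (- a).
  have := mtr measurableT _ (@measurable_cdisc R d); by rewrite setTI.
exists (pi * M * expR 3); split; first by rewrite !mulr_gt0 ?pi_gt0 ?expR_gt0.
move=> a.
pose A (n : nat) := [set z : R[i] | normc (z - a) <= n%:R].
have mA n : measurable (A n).
  have [mtr _] := area_translate (- a).
  by have := mtr measurableT _ (@measurable_cdisc R n%:R); rewrite setTI.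
have mgs x : measurable_fun setT (fun z => expR (- normc (z - x) ^+ 2) * g z).
  by apply: measurable_funM => //; exact: measurable_gauss_shift.
have gs0 x z : 0 <= expR (- normc (z - x) ^+ 2) * g z by rewrite mulr_ge0 ?expR_ge0.
apply: (integral_le_exhaustion (A := A)) => //.
- by move=> m n mn z /= /le_trans; apply; rewrite ler_nat.
- by move=> z; exists (Num.bound (normc (z - a))); exact/ltW/archi_boundP/normc_ge0.
(* For |z - a| <= n and |x - a| <= 1 / (n + 1),
   |z - x|^2 <= |z - a|^2 + 2 n / (n + 1) + 1 / (n + 1)^2 <= |z - a|^2 + 3. *)
move=> n; have d0 : 0 < (n.+1%:R)^-1 :> R by rewrite invr_gt0.
have [x xa hx] := near_pt a _ d0.
have e30 : 0 <= expR 3 :> R by exact: expR_ge0.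
apply: (@le_trans _ _ ((expR 3)%:E * \int[dA]_z (expR (- normc (z - x) ^+ 2) * g z)%:E)%E).
  rewrite -(integralZl_ge0 _ e30 (mgs x) (gs0 x)).
  rewrite integral_mkcond; apply: ge0_le_integral => //.
  - by move=> z _; rewrite patchE; case: ifPn => // _; rewrite lee_fin gs0.
  - apply/(measurable_restrictT _ (mA n)); apply: measurable_funTS.
    exact/measurable_EFinP.
  - by apply/measurable_EFinP; exact: measurable_funM.
  move=> z _; rewrite patchE; case: ifPn => [|_]; last first.
    by rewrite lee_fin mulr_ge0.
  rewrite inE /A /= => za; rewrite lee_fin mulrA -expRD ler_wpM2r// ler_expR.
  have tri : normc (z - x) <= normc (z - a) + (n.+1%:R)^-1.
    rewrite (_ : z - x = (z - a) + (a - x)); last by ring.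
    by rewrite (le_trans (le_normcD _ _))// lerD2l normc_distC.
  have p0 := normc_ge0 (z - x).
  have q1 : (n.+1%:R)^-1 <= 1 :> R by rewrite invf_le1// ler1n.
  have nq : n%:R * (n.+1%:R)^-1 <= 1 :> R.
    by rewrite ler_pdivrMr// mul1r ler_nat.
  have := normc_ge0 (z - a); move: za tri p0 q1 nq d0.
  move: (normc (z - a)) (normc (z - x)) (n.+1%:R^-1) (n%:R) => p q r k; nra.
have -> : (pi * M * expR 3)%:E = ((expR 3)%:E * (pi * M)%:E)%E by rewrite -EFinM mulrC.
rewrite lee_wpmul2l ?lee_fin// -(@lee_pmul2l _ pi^-1%:E)//; last first.
  by rewrite lte_fin invr_gt0 pi_gt0.
by rewrite -heatE -EFinM mulKf// gt_eqF// pi_gt0.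
Qed.

End carleson.

(** * The reproducing kernel and the orthogonal projection *)

Section projection.
Variable R : realType.
Local Notation dA := (@area R).
Local Notation mu := (@mu R).
Implicit Types (f h u : R[i] -> R[i]) (z w a : R[i]).

Lemma mu_setT : mu setT = 1%:E.
Proof.
rewrite -(mul1e (mu setT)) -integral_cst// (integral_mu (measurable_cst _)).
under eq_integral do rewrite mulr1 /gauss.
have cpi : 0 <= pi^-1 :> R by rewrite invr_ge0 pi_ge0.
rewrite (integralZl_ge0 _ cpi); last 2 first.
- by have := measurable_expNsqr (1 : R); under eq_fun do rewrite mul1r.
- by move=> z; exact: expR_ge0.
by rewrite integral_gauss_area -EFinM mulVf// gt_eqF// pi_gt0.
Qed.

Lemma mu_sigma_finite : sigma_finite setT (density dA (@measurable_gauss R) (@gauss_ge0 R)).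
Proof.
exists (fun=> setT); first by rewrite bigcup_const.
by move=> _; split => //; rewrite (le_lt_trans _ (ltry 1))// -mu_setT.
Qed.

HB.instance Definition _ := @Measure_isSigmaFinite.Build _ _ _
  (density dA (@measurable_gauss R) (@gauss_ge0 R)) mu_sigma_finite.

(** Complex integrals against mu, componentwise; [inner f h] is the integral of
    f conj(h) by definition. *)
Definition cintegral (F : R[i] -> R[i]) : R[i] :=
  (\int[mu]_z complex.Re (F z)) +i* (\int[mu]_z complex.Im (F z)).

(** Absolute integrability against mu. *)
Definition cintegrable (F : R[i] -> R[i]) := measurable_fun setT F /\
  (\int[mu]_z (normc (F z))%:E < +oo)%E.

Lemma cintegrable_normc F : cintegrable F ->
  mu.-integrable setT (EFin \o (fun z => normc (F z))).
Proof.
move=> [mF Foo]; apply/integrableP; split.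
  by apply/measurable_EFinP; exact: measurable_fun_normc.
by under eq_integral do rewrite /= ger0_norm ?normc_ge0//.
Qed.

Lemma cintegrable_Re F : cintegrable F ->
  mu.-integrable setT (EFin \o (fun z => complex.Re (F z))).
Proof.
move=> iF; apply: le_integrable (cintegrable_normc iF) => //.
  by apply/measurable_EFinP; apply: measurable_fun_Re; case: iF.
by move=> z _; rewrite /= lee_fin (ger0_norm (normc_ge0 _)) normr_Re_le.
Qed.

Lemma cintegrable_Im F : cintegrable F ->
  mu.-integrable setT (EFin \o (fun z => complex.Im (F z))).
Proof.
move=> iF; apply: le_integrable (cintegrable_normc iF) => //.
  by apply/measurable_EFinP; apply: measurable_fun_Im; case: iF.
by move=> z _; rewrite /= lee_fin (ger0_norm (normc_ge0 _)) normr_Im_le.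
Qed.

Lemma cintegrable_le F (K : R[i] -> R) : measurable_fun setT F ->
  measurable_fun setT K -> (\int[mu]_z (K z)%:E < +oo)%E ->
  (forall z, normc (F z) <= K z) -> cintegrable F.
Proof.
move=> mF mK Koo FK; split => //; apply: le_lt_trans Koo.
apply: ge0_le_integral => //.
- by move=> z _; rewrite lee_fin normc_ge0.
- by apply/measurable_EFinP; exact: measurable_fun_normc.
- exact/measurable_EFinP.
- by move=> z _; rewrite lee_fin.
Qed.

Lemma eq_cintegral F G : F =1 G -> cintegral F = cintegral G.
Proof. by move=> FG; congr (_ +i* _); apply: eq_Rintegral => z _; rewrite FG. Qed.

Lemma cintegralD F G : cintegrable F -> cintegrable G ->
  cintegral (fun z => F z + G z) = cintegral F + cintegral G.
Proof.
move=> iF iG; rewrite /cintegral.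
have E z : F z + G z = (complex.Re (F z) + complex.Re (G z)) +i*
    (complex.Im (F z) + complex.Im (G z)) by case: (F z) (G z) => a b [c d].
under eq_Rintegral do rewrite E /=.
under [X in _ +i* X = _]eq_Rintegral do rewrite E /=.
rewrite RintegralD//; [|exact: cintegrable_Re|exact: cintegrable_Re].
rewrite RintegralD//; [exact: cintegrable_Im|exact: cintegrable_Im].
Qed.

Lemma cintegralZ (c : R[i]) F : cintegrable F ->
  cintegral (fun z => c * F z) = c * cintegral F.
Proof.
move=> iF; case: c => a b; rewrite /cintegral.
have iR := cintegrable_Re iF; have iI := cintegrable_Im iF.
have ER z : complex.Re ((a +i* b) * F z) = a * complex.Re (F z) - b * complex.Im (F z).
  by case: (F z).
have EI z : complex.Im ((a +i* b) * F z) = a * complex.Im (F z) + b * complex.Re (F z).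
  by case: (F z).
under eq_Rintegral do rewrite ER.
under [X in _ +i* X = _]eq_Rintegral do rewrite EI.
rewrite RintegralB//; [|exact: (integrableZl measurableT a iR)|exact: (integrableZl measurableT b iI)].
rewrite RintegralD//; [|exact: (integrableZl measurableT a iI)|exact: (integrableZl measurableT b iR)].
by rewrite !RintegralZl.
Qed.

Lemma cintegrableZ (c : R[i]) F : cintegrable F -> cintegrable (fun z => c * F z).
Proof.
move=> [mF Foo]; split.
  by apply: measurable_funcM => //; exact: measurable_cst.
under eq_integral do rewrite Normc.normcM.
rewrite integralZl_ge0 ?normc_ge0//; last 2 first.
- exact: measurable_fun_normc.
- by move=> z; exact: normc_ge0.
by apply: lte_mul_pinfty => //; rewrite lee_fin normc_ge0.
Qed.

Lemma cintegrableD F G : cintegrable F -> cintegrable G ->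
  cintegrable (fun z => F z + G z).
Proof.
move=> [mF Foo] [mG Goo].
have mnF := measurable_fun_normc mF; have mnG := measurable_fun_normc mG.
apply: (@cintegrable_le _ (fun z => normc (F z) + normc (G z))).
- exact: measurable_funcD.
- exact: measurable_funD.
- under eq_integral do rewrite EFinD.
  rewrite ge0_integralD//; [exact: lte_add_pinfty| | | |].
  + by move=> z _; rewrite lee_fin normc_ge0.
  + exact/measurable_EFinP.
  + by move=> z _; rewrite lee_fin normc_ge0.
  + exact/measurable_EFinP.
- by move=> z; exact: le_normcD.
Qed.

Lemma L2_cintegrable f h : L2 f -> L2 h -> cintegrable (fun z => f z * (h z)^*).
Proof.
move=> Lf Lh; split.
  by apply: measurable_funcM; [case: Lf|apply: measurable_funcJ; case: Lh].
under eq_integral do rewrite Normc.normcM normc_conj.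
by rewrite (le_lt_trans (L2_cauchy_schwarz Lf Lh))// ltry.
Qed.

Lemma cintegral_le F : cintegrable F ->
  normc (cintegral F) <= \int[mu]_z normc (F z).
Proof.
move=> iF; have [mF Foo] := iF.
rewrite -lee_fin /Rintegral fineK; first exact: normc_integral.
rewrite ge0_fin_numE//; apply: integral_ge0 => z _; rewrite lee_fin; exact: normc_ge0.
Qed.

(** The reproducing kernel w |-> e^(conj(a) w) of F^2 at the point a. *)
Definition kern a z : R[i] := cexp (a^* * z).

Lemma kern_knorm a z : kern a z = (expR (normc a ^+ 2 / 2))%:C * knorm a z.
Proof.
have -> : (expR (normc a ^+ 2 / 2))%:C = cexp (normc a ^+ 2 / 2)%:C.
  by rewrite /cexp /= cos0 sin0 mulr1 mulr0.
by rewrite /kern /knorm -cexpD addrC subrK.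
Qed.

Lemma sqL2normZ (c : R[i]) f : measurable_fun setT f ->
  sqL2norm (fun z => c * f z) = ((normc c ^+ 2)%:E * sqL2norm f)%E.
Proof.
move=> mf; rewrite /sqL2norm -integralZl_ge0 ?sqr_ge0//; last 2 first.
- exact: measurable_sqr_normc.
- by move=> z; exact: sqr_ge0.
by apply: eq_integral => z _; rewrite Normc.normcM exprMn.
Qed.

Lemma F2_kern a : F2 (kern a).
Proof.
split.
  apply: (entire_comp (@entire_cexp R)).
  by apply: entireM; [exact: entire_cst|exact: entire_id].
rewrite (_ : kern a = fun z => (expR (normc a ^+ 2 / 2))%:C * knorm a z); last first.
  by apply/funext => z; exact: kern_knorm.
rewrite sqL2normZ; last by apply: entire_measurable; exact: entire_knorm.
by rewrite sqL2norm_knorm mule1 ltry.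
Qed.

Lemma cexp_real (x : R) : cexp x%:C = (expR x)%:C.
Proof. by rewrite /cexp /= cos0 sin0 mulr1 mulr0. Qed.

(** Completing the square: translated by z and up to the factor pi, the Gaussian
    density times the conjugate kernel at z is an entire function times a radial
    weight. *)
Lemma kern_shift z w : cexp (- z^* * w) * (expR (- normc w ^+ 2))%:C =
  (pi * gauss (w + z))%:C * (kern z (w + z))^*.
Proof.
rewrite /gauss mulVKf ?gt_eqF ?pi_gt0// /kern conjc_cexp -!cexp_real -!cexpD.
congr cexp; rewrite !sqr_normcE; case: z w => a b [c d]; simpc.
by congr (_ +i* _) => /=; ring.
Qed.

Lemma integrable_mu_area (k : R[i] -> R) : mu.-integrable setT (EFin \o k) ->
  dA.-integrable setT (EFin \o (fun z => gauss z * k z)).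
Proof.
move=> /integrableP[/measurable_EFinP mk koo]; apply/integrableP; split.
  by apply/measurable_EFinP; apply: measurable_funM => //; exact: measurable_gauss.
under eq_integral do rewrite /= normrM (ger0_norm (gauss_ge0 _)).
rewrite -integral_mu//; exact: measurableT_comp.
Qed.

(** The reproducing property is the mean value property of the entire function
    h(w + z) e^(- conj(z) w) against the weight e^(-|w|^2). *)
Lemma reproducing_Re h z : F2 h ->
  \int[mu]_w complex.Re (h w * (kern z w)^*) = complex.Re (h z).
Proof.
move=> F2h; have [eh _] := F2h.
have Lh := F2_L2 F2h; have Lk := F2_L2 (F2_kern z).
have iC := L2_cintegrable Lh Lk; have [mC Coo] := iC.
pose F w := h (w + z) * cexp (- z^* * w).
have eF : entire F.
  apply: entireM.
    by apply: (entire_comp eh); apply: entireD; [exact: entire_id|exact: entire_cst].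
  apply: (entire_comp (@entire_cexp R)).
  by apply: entireM; [exact: entire_cst|exact: entire_id].
have FW w : F w * (expR (- normc w ^+ 2))%:C =
    (pi * gauss (w + z))%:C * (h (w + z) * (kern z (w + z))^*).
  by rewrite /F -mulrA kern_shift mulrCA.
have mW : measurable_fun setT (fun w : R[i] => expR (- normc w ^+ 2)).
  by have := measurable_expNsqr (1 : R); under eq_fun do rewrite mul1r.
have rW : radial (fun w : R[i] => expR (- normc w ^+ 2)) by move=> u v /= ->.
have pg0 w : 0 <= pi * gauss w :> R by rewrite mulr_ge0 ?pi_ge0// gauss_ge0.
have nFW w : normc (F w) * expR (- normc w ^+ 2) =
    pi * (gauss (w + z) * normc (h (w + z) * (kern z (w + z))^*)).
  have := congr1 (@normc R) (FW w).
  rewrite !Normc.normcM (normc_real (expR_ge0 _)) (normc_real (pg0 _)) => ->.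
  by rewrite -!mulrA.
have RFW w : complex.Re (F w) * expR (- normc w ^+ 2) =
    pi * (gauss (w + z) * complex.Re (h (w + z) * (kern z (w + z))^*)).
  have := congr1 (@complex.Re R) (FW w).
  have ReZ (x : R[i]) (r : R) : complex.Re (r%:C * x) = r * complex.Re x.
    by case: x => a b /=; rewrite mul0r subr0.
  by rewrite [F w * _]mulrC !ReZ mulrC => ->; rewrite mulrA.
have pi0 := pi_ge0 R.
have mk := measurable_fun_normc mC.
have mgk : measurable_fun setT (fun w => gauss w * normc (h w * (kern z w)^*)).
  by apply: measurable_funM => //; exact: measurable_gauss.
have gk0 w : 0 <= gauss w * normc (h w * (kern z w)^*).
  by rewrite mulr_ge0 ?gauss_ge0// normc_ge0.
have := @radial_mean R F (fun w => expR (- normc w ^+ 2)) eF mW rW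
  (fun=> expR_ge0 _) (@integrable_gauss_area R).
have -> : (\int[dA]_w (normc (F w) * expR (- normc w ^+ 2))%:E < +oo)%E.
  under eq_integral do rewrite nFW.
  rewrite (@ge0_integral_area_preserving _ _ (fun w => (pi * (gauss w * normc (h w * (kern z w)^*)))%:E)
    (area_translate z)).
  - rewrite (integralZl_ge0 _ pi0 mgk gk0) -integral_mu//.
    exact: lte_mul_pinfty.
  - by apply/measurable_EFinP; apply: measurable_funM.
  - by move=> w; rewrite lee_fin mulr_ge0.
move=> /(_ isT).
under eq_integral do rewrite RFW.
have iT := integrable_mu_area (cintegrable_Re iC).
have iT' := integrableZl measurableT pi iT.
rewrite (integral_area_preserving (f := fun w => (pi * (gauss w * complex.Re (h w * (kern z w)^*)))%:E)
  (area_translate z) iT').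
rewrite integral_gauss_area /F add0r mulr0 cexp0 mulr1.
under eq_integral do rewrite EFinM.
rewrite integralZl// -integral_mu; last exact: measurable_fun_Re.
rewrite muleC => e; rewrite /Rintegral.
have fin := integrable_fin_num measurableT (cintegrable_Re iC).
move: e; rewrite -(fineK fin) -!EFinM => -[] /mulIf -> //.
by rewrite gt_eqF// pi_gt0.
Qed.

Lemma reproducing h z : F2 h -> inner h (kern z) = h z.
Proof.
move=> F2h; rewrite /inner (reproducing_Re z F2h).
have F2ih : F2 (fun w => (- 'i) * h w).
  have [eh hoo] := F2h; split; first exact: (entireM (@entire_cst R (- 'i)) eh).
  rewrite sqL2normZ; last exact: entire_measurable.
  by apply: lte_mul_pinfty => //; rewrite lee_fin sqr_ge0.
have ImE (x : R[i]) : complex.Im x = complex.Re (- 'i * x).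
  by case: x => a b; simpc.
under [X in _ +i* X]eq_Rintegral do rewrite ImE mulrA.
by rewrite (reproducing_Re z F2ih) -ImE; case: (h z).
Qed.

Lemma cFubini (F : R[i] * R[i] -> R[i]) : measurable_fun setT F ->
  (\int[mu]_z \int[mu]_w (normc (F (z, w)))%:E < +oo)%E ->
  (forall z, cintegrable (fun w => F (z, w))) ->
  (forall w, cintegrable (fun z => F (z, w))) ->
  cintegral (fun z => cintegral (fun w => F (z, w))) =
  cintegral (fun w => cintegral (fun z => F (z, w))).
Proof.
move=> mF Foo F1 F2.
have mn := measurable_fun_normc mF.
have fub (k : R[i] -> R) : (forall x, `|k x| <= normc x) ->
    measurable_fun setT (k \o F) ->
    (forall z, mu.-integrable setT (EFin \o (fun w => k (F (z, w))))) ->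
    (forall w, mu.-integrable setT (EFin \o (fun z => k (F (z, w))))) ->
    \int[mu]_z \int[mu]_w k (F (z, w)) = \int[mu]_w \int[mu]_z k (F (z, w)).
  move=> kn mk k1 k2.
  have mkE : measurable_fun setT (EFin \o (k \o F)) by exact/measurable_EFinP.
  have ik : (mu \x mu)%E.-integrable setT (EFin \o (k \o F)).
    apply/integrable12ltyP => //; apply: le_lt_trans Foo.
    apply: ge0_le_integral => //.
    - by move=> z _; exact: integral_ge0.
    - apply: (@measurable_fun_fubini_tonelli_F _ _ _ _ _ mu (abse \o (EFin \o (k \o F)))).
        exact: measurableT_comp.
      by move=> p; exact: abse_ge0.
    - apply: (@measurable_fun_fubini_tonelli_F _ _ _ _ _ mu (EFin \o (fun p => normc (F p)))) => //.
        exact/measurable_EFinP.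
      by move=> p; rewrite lee_fin normc_ge0.
    move=> z _; apply: ge0_le_integral => //.
    - apply: measurableT_comp => //; apply: measurableT_comp mkE _.
      exact: pair1_measurable.
    - apply/measurable_EFinP; apply: measurableT_comp mn _.
      exact: pair1_measurable.
    - by move=> w _; rewrite lee_fin kn.
  have H : (\int[mu]_z fubini_F mu (EFin \o (k \o F)) z =
    \int[mu]_w fubini_G mu (EFin \o (k \o F)) w)%E := Fubini ik.
  rewrite /Rintegral; congr fine.
  rewrite (eq_integral (fubini_F mu (EFin \o (k \o F)))); last first.
    by move=> z _; rewrite fineK// (integrable_fin_num _ (k1 z)).
  rewrite H; apply: eq_integral => w _.
  by rewrite fineK// (integrable_fin_num _ (k2 w)).
have e1 := fub (@complex.Re R) (@normr_Re_le R) (measurable_fun_Re mF)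
  (fun z => cintegrable_Re (F1 z)) (fun w => cintegrable_Re (F2 w)).
have e2 := fub (@complex.Im R) (@normr_Im_le R) (measurable_fun_Im mF)
  (fun z => cintegrable_Im (F1 z)) (fun w => cintegrable_Im (F2 w)).
rewrite [LHS]/cintegral [RHS]/cintegral /=; exact: (f_equal2 (@Complex R) e1 e2).
Qed.

Lemma cintegral_conj F : cintegrable F ->
  cintegral (fun z => ((F z)^*)%R) = ((cintegral F)^*)%R.
Proof.
move=> iF; rewrite /cintegral.
have ER z : complex.Re ((F z)^*)%R = complex.Re (F z) by case: (F z).
have EI z : complex.Im ((F z)^*)%R = -1 * complex.Im (F z).
  by case: (F z) => a b /=; rewrite mulN1r.
under eq_Rintegral do rewrite ER.
under [X in _ +i* X = _]eq_Rintegral do rewrite EI.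
by rewrite (RintegralZl _ measurableT (cintegrable_Im iF)) mulN1r.
Qed.

Lemma conj_kern z w : ((kern z w)^*)%R = kern w z.
Proof. by rewrite /kern conjc_cexp rmorphM /= conjCK mulrC. Qed.

Lemma kern0 z : kern 0 z = 1.
Proof. by rewrite /kern rmorph0 mul0r cexp0. Qed.

Lemma kernD z t w : kern w (z + t) = kern w z * kern w t.
Proof. by rewrite /kern mulrDr cexpD. Qed.

Lemma normc_kern z w : normc (kern z w) = expR (complex.Re (z^* * w)).
Proof. exact: normc_cexp. Qed.

Lemma Re_le_normcM z w : complex.Re (z^* * w) <= normc z * normc w.
Proof.
rewrite -(normc_conj z) -Normc.normcM.
exact: le_trans (ler_norm _) (normr_Re_le _).
Qed.

(** e^(N |z|) is square integrable: since |z| <= |x| + |y|, it is dominated by the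
    four kernels at N (+- 1 +- i). *)
Lemma L2_exp_normc (N : R) : 0 <= N -> L2 (fun z : R[i] => (expR (N * normc z))%:C).
Proof.
move=> N0.
have mE : measurable_fun setT (fun z : R[i] => (expR (N * normc z))%:C).
  apply: measurable_fun_real_complex; apply: measurableT_comp => //.
  by apply: measurable_funM => //; exact: measurable_normc.
split => //.
pose K z := normc (kern (N%:C * (1 +i* 1)) z) ^+ 2 + normc (kern (N%:C * (1 -i* 1)) z) ^+ 2 +
  (normc (kern (N%:C * (-1 +i* 1)) z) ^+ 2 + normc (kern (N%:C * (-1 -i* 1)) z) ^+ 2).
have mk a : measurable_fun setT (fun z => (normc (kern a z) ^+ 2)%:E).
  by apply/measurable_EFinP; apply: measurable_sqr_normc; case: (F2_L2 (F2_kern a)).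
have k0 a z : (0 <= (normc (kern a z) ^+ 2)%:E)%E by rewrite lee_fin sqr_ge0.
have koo a : (\int[mu]_z (normc (kern a z) ^+ 2)%:E < +oo)%E by case: (F2_kern a).
apply: (@le_lt_trans _ _ (\int[mu]_z (K z)%:E)%E).
  apply: ge0_le_integral => //.
  - by move=> z _; rewrite lee_fin sqr_ge0.
  - by apply/measurable_EFinP; exact: measurable_sqr_normc.
  - rewrite /K; under eq_fun do rewrite !EFinD.
    by do ! apply: emeasurable_funD.
  move=> z _; rewrite lee_fin normc_real ?expR_ge0// /K !normc_kern -!expRM_natl.
  have n1 := normc_le_ReIm z.
  have h1 : 2%:R * (N * normc z) <= 2%:R * (N * (`|complex.Re z| + `|complex.Im z|)).
    by rewrite ler_pM2l// ler_wpM2l.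
  rewrite -ler_expR in h1; apply: (le_trans h1) => {h1 n1}.
  case: z => x y /=.
  set e1 := (X in expR X + _ + _); set e2 := (X in _ + expR X + _).
  set e3 := (X in _ + (expR X + _)); set e4 := (X in _ + (_ + expR X)).
  have p1 := expR_ge0 e1; have p2 := expR_ge0 e2.
  have p3 := expR_ge0 e3; have p4 := expR_ge0 e4.
  have : [\/ 2%:R * (N * (`|x| + `|y|)) = e1, 2%:R * (N * (`|x| + `|y|)) = e2,
       2%:R * (N * (`|x| + `|y|)) = e3 | 2%:R * (N * (`|x| + `|y|)) = e4].
    case: (ger0P x) => _; case: (ger0P y) => _.
    - by apply: Or41; rewrite /e1 /=; ring.
    - by apply: Or42; rewrite /e2 /=; ring.
    - by apply: Or43; rewrite /e3 /=; ring.
    - by apply: Or44; rewrite /e4 /=; ring.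
  by case=> ->; lra.
rewrite /K; under eq_integral do rewrite !EFinD.
rewrite ge0_integralD//; last 4 first.
- by move=> z _; rewrite adde_ge0.
- exact: emeasurable_funD.
- by move=> z _; rewrite adde_ge0.
- exact: emeasurable_funD.
have k2 a b : (\int[mu]_z ((normc (kern a z) ^+ 2)%:E +
    (normc (kern b z) ^+ 2)%:E) < +oo)%E.
  by rewrite ge0_integralD//; apply: lte_add_pinfty; exact: koo.
by apply: lte_add_pinfty; exact: k2.
Qed.

(** The orthogonal projection of a function u supported in a disc of radius N is
    p(z) = <u, k_z>. The support condition makes p entire, by differentiation under
    the integral sign with a quadratic remainder, and bounded by a multiple of
    e^(N |z|), so that p is in F^2; <p, h> = <u, h> for h in F^2 by Fubini's theorem
    and the reproducing property. *)
Lemma projection_exists (N : R) u : L2 u -> 0 <= N ->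
  (forall w, N < normc w -> u w = 0) -> exists p, is_F2_projection u p.
Proof.
move=> Lu N0 uN; have [mu_ uoo] := Lu.
have iuk z : cintegrable (fun w => u w * ((kern z w)^*)%R).
  by apply: L2_cintegrable => //; apply: F2_L2; exact: F2_kern.
pose p z := inner u (kern z).
have pE z : p z = cintegral (fun w => u w * ((kern z w)^*)%R) by [].
have iu : cintegrable u.
  have := iuk 0; congr cintegrable; apply/funext => w.
  by rewrite kern0 rmorph1 mulr1.
pose U := \int[mu]_w normc (u w).
have U0 : 0 <= U by apply: Rintegral_ge0 => w _; exact: normc_ge0.
have UE : (\int[mu]_w (normc (u w))%:E = U%:E)%E.
  by rewrite /U /Rintegral fineK// (integrable_fin_num _ (cintegrable_normc iu)).
have ukle z w : normc (u w * ((kern z w)^*)%R) <= normc (u w) * expR (N * normc z).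
  have [wN|wN] := leP (normc w) N; last by rewrite uN// mul0r !Normc.normc0 mul0r.
  rewrite Normc.normcM normc_conj ler_wpM2l ?normc_ge0// normc_kern ler_expR.
  by rewrite (le_trans (Re_le_normcM _ _))// mulrC ler_wpM2r// normc_ge0.
have ple z : normc (p z) <= U * expR (N * normc z).
  rewrite pE (le_trans (cintegral_le (iuk z)))// -lee_fin.
  rewrite EFinM -UE muleC -integralZl_ge0 ?expR_ge0//; last 2 first.
  - exact: measurable_fun_normc.
  - by move=> w; exact: normc_ge0.
  rewrite /Rintegral fineK; last first.
    exact: (integrable_fin_num measurableT (cintegrable_normc (iuk z))).
  apply: ge0_le_integral => //.
  - by move=> w _; rewrite lee_fin normc_ge0.
  - by apply/measurable_EFinP; apply: measurable_fun_normc; case: (iuk z).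
  - by apply/measurable_EFinP; apply: measurable_funM => //; exact: measurable_fun_normc.
  - by move=> w _; rewrite lee_fin [leRHS]mulrC.
have ep : entire p.
  move=> z.
  have iukw : cintegrable (fun w => u w * ((kern z w)^*)%R * (w^*)%R).
    have [mk koo] := cintegrableZ N%:C (iuk z).
    apply: (cintegrable_le _ (measurable_fun_normc mk) koo).
      apply: measurable_funcM; first by case: (iuk z).
      by apply: measurable_funcJ.
    move=> w; rewrite Normc.normcM [leRHS]Normc.normcM normc_conj mulrC normc_real//.
    have [wN|wN] := leP (normc w) N; first by rewrite ler_wpM2r// normc_ge0.
    by rewrite uN// mul0r Normc.normc0 !mulr0.
  pose V := \int[mu]_w normc (u w * ((kern z w)^*)%R).
  have V0 : 0 <= V by apply: Rintegral_ge0 => w _; exact: normc_ge0.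
  have VE : (\int[mu]_w (normc (u w * ((kern z w)^*)%R))%:E = V%:E)%E.
    by rewrite /V /Rintegral fineK// (integrable_fin_num _ (cintegrable_normc (iuk z))).
  have d0 : 0 < (2 * (N + 1))^-1 by rewrite invr_gt0 mulr_gt0// ltr_wpDl.
  apply: (@derivable_quadratic _ _ _ (cintegral (fun w => u w * ((kern z w)^*)%R * (w^*)%R))
     (4 * N ^+ 2 * V) (2 * (N + 1))^-1) => //.
    by rewrite !mulr_ge0// sqr_ge0.
  move=> t td.
  pose Q w := u w * ((kern z w)^*)%R * (cexp (t * (w^*)%R) - 1 - t * (w^*)%R).
  have Qle w : normc (Q w) <= 4 * N ^+ 2 * normc t ^+ 2 * normc (u w * ((kern z w)^*)%R).
    have [wN|wN] := leP (normc w) N; last first.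
      by rewrite /Q uN// !mul0r !Normc.normc0 mulr0.
    rewrite /Q Normc.normcM mulrC ler_wpM2r ?normc_ge0//.
    have tw : normc (t * (w^*)%R) <= N * normc t.
      by rewrite Normc.normcM normc_conj mulrC ler_wpM2r// normc_ge0.
    rewrite (le_trans (cexp_remainder _))//.
      rewrite (le_trans tw)// (le_trans (ler_wpM2l N0 td))// ler_pdivrMr//.
        by lra.
      by rewrite mulr_gt0// ltr_wpDl.
    rewrite -mulrA -exprMn ler_wpM2l// ler_pXn2r// nnegrE ?normc_ge0//.
    by rewrite mulr_ge0// normc_ge0.
  have mQ : measurable_fun setT Q.
    apply: measurable_funcM; first by case: (iuk z).
    have mtw : measurable_fun setT (fun w : R[i] => t * (w^*)%R).
      by apply: measurable_funcM; [exact: measurable_cst|exact: measurable_funcJ].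
    apply: measurable_funcD; last exact: measurable_funcN.
    apply: measurable_funcD; first exact: measurable_fun_cexp.
    exact: measurable_cst.
  have K0 : 0 <= 4 * N ^+ 2 * normc t ^+ 2 by rewrite (mulr_ge0 (mulr_ge0 _ (sqr_ge0 _)) (sqr_ge0 _)).
  have mKV := measurable_fun_normc (iuk z).1.
  have KV : (\int[mu]_w (4 * N ^+ 2 * normc t ^+ 2 * normc (u w * ((kern z w)^*)%R))%:E =
      (4 * N ^+ 2 * normc t ^+ 2 * V)%:E)%E.
    rewrite (integralZl_ge0 _ K0 mKV (fun w => normc_ge0 _)) VE.
    by rewrite -EFinM.
  have iQ : cintegrable Q.
    apply: (@cintegrable_le _ (fun w => 4 * N ^+ 2 * normc t ^+ 2 * normc (u w * ((kern z w)^*)%R))) => //.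
      by apply: measurable_funM.
    by rewrite KV ltry.
  have -> : p (z + t) - p z - cintegral (fun w => u w * ((kern z w)^*)%R * (w^*)%R) * t = cintegral Q.
    rewrite !pE.
    rewrite (@eq_cintegral _ (fun w => Q w + u w * ((kern z w)^*)%R +
      t * (u w * ((kern z w)^*)%R * (w^*)%R))); last first.
      move=> w; rewrite /Q conj_kern kernD -conj_kern /kern (mulrC (w^*)%R t).
      ring.
    rewrite cintegralD; [|exact: cintegrableD|exact: cintegrableZ].
    rewrite cintegralD// cintegralZ//; ring.
  rewrite (le_trans (cintegral_le iQ))// -lee_fin /Rintegral fineK; last first.
    exact: (integrable_fin_num measurableT (cintegrable_normc iQ)).
  have -> : 4 * N ^+ 2 * V * normc t ^+ 2 = 4 * N ^+ 2 * normc t ^+ 2 * V by rewrite mulrAC.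
  rewrite -KV; apply: ge0_le_integral => //.
  - by move=> w _; rewrite lee_fin normc_ge0.
  - by apply/measurable_EFinP; exact: measurable_fun_normc.
  - by apply/measurable_EFinP; apply: measurable_funM.
  - by move=> w _; rewrite lee_fin.
have mp := entire_measurable ep.
have LE := L2_exp_normc N0; have [mE Eoo] := LE.
have Lp : L2 p.
  split => //; apply: (@le_lt_trans _ _ (sqL2norm (fun z => U%:C * (expR (N * normc z))%:C))).
    apply: ge0_le_integral => //.
    - by move=> w _; rewrite lee_fin sqr_ge0.
    - by apply/measurable_EFinP; exact: measurable_sqr_normc.
    - apply/measurable_EFinP; apply: measurable_sqr_normc; exact: measurable_funcM.
    move=> z _; rewrite lee_fin Normc.normcM !normc_real ?expR_ge0//.
    by rewrite ler_pXn2r ?nnegrE ?normc_ge0// mulr_ge0 ?expR_ge0.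
  by rewrite sqL2normZ//; apply: lte_mul_pinfty => //; rewrite lee_fin sqr_ge0.

exists p; split; first by split => //; case: Lp.
move=> h F2h; have Lh := F2_L2 F2h; have [mh hoo] := Lh.
have iuh := L2_cintegrable Lu Lh; have iph := L2_cintegrable Lp Lh.
suff E : inner p h = inner u h.
  have -> : inner (fun z => u z - p z) h =
      cintegral (fun z => u z * ((h z)^*)%R + -1 * (p z * ((h z)^*)%R)).
    by apply: eq_cintegral => z; ring.
  rewrite cintegralD//; last exact: cintegrableZ.
  by rewrite cintegralZ// mulN1r -[cintegral _]/(inner u h) -E subrr.
pose F (q : R[i] * R[i]) := u q.2 * ((kern q.1 q.2)^*)%R * ((h q.1)^*)%R.
have mF : measurable_fun setT F.
  apply: measurable_funcM; last first.
    by apply: measurable_funcJ; exact: measurableT_comp.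
  apply: measurable_funcM; first exact: measurableT_comp.
  apply: measurable_funcJ; apply: measurable_fun_cexp.
  by apply: measurable_funcM => //; exact: measurable_funcJ.
have F1 z : cintegrable (fun w => F (z, w)).
  have := cintegrableZ ((h z)^*)%R (iuk z); congr cintegrable.
  by apply/funext => w; rewrite /F /= mulrC.
have F1E z : cintegral (fun w => F (z, w)) = p z * ((h z)^*)%R.
  rewrite pE mulrC -cintegralZ//; apply: eq_cintegral => w.
  by rewrite /F /= mulrC.
have ihk w : cintegrable (fun z => h z * ((kern w z)^*)%R).
  by apply: L2_cintegrable => //; apply: F2_L2; exact: F2_kern.
have conjE z w : F (z, w) = u w * ((h z * ((kern w z)^*)%R)^*)%R.
  by rewrite /F /= rmorphM /= conjCK conj_kern -mulrA (mulrC (kern w z)).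
have ihk' w : cintegrable (fun z => ((h z * ((kern w z)^*)%R)^*)%R).
  have [m1 o1] := ihk w; split; first exact: measurable_funcJ.
  by under eq_integral do rewrite normc_conj.
have F2' w : cintegrable (fun z => F (z, w)).
  have := cintegrableZ (u w) (ihk' w); congr cintegrable.
  by apply/funext => z; rewrite conjE.
have F2E w : cintegral (fun z => F (z, w)) = u w * ((h w)^*)%R.
  rewrite (eq_cintegral (fun z => conjE z w)) cintegralZ// cintegral_conj//.
  by rewrite -[cintegral _]/(inner h (kern w)) reproducing.
have Foo : (\int[mu]_z \int[mu]_w (normc (F (z, w)))%:E < +oo)%E.
  have CS := L2_cauchy_schwarz LE Lh.
  apply: (@le_lt_trans _ _ (U%:E * \int[mu]_z (normc (expR (N * normc z))%:C * normc (h z))%:E)%E); last first.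
    by apply: lte_mul_pinfty => //; rewrite (le_lt_trans CS)// ltry.
  rewrite -integralZl_ge0//; last 2 first.
  - by apply: measurable_funM; exact: measurable_fun_normc.
  - by move=> z; rewrite mulr_ge0 ?normc_ge0.
  apply: ge0_le_integral => //.
  - by move=> z _; apply: integral_ge0 => w _; rewrite lee_fin normc_ge0.
  - apply: (@measurable_fun_fubini_tonelli_F _ _ _ _ _ mu (EFin \o (fun q => normc (F q)))).
      by apply/measurable_EFinP; exact: measurable_fun_normc.
    by move=> q; rewrite lee_fin normc_ge0.
  - apply/measurable_EFinP; apply: measurable_funM => //.
    by apply: measurable_funM; exact: measurable_fun_normc.
  move=> z _.
  apply: (@le_trans _ _ ((expR (N * normc z) * normc (h z))%:E * \int[mu]_w (normc (u w))%:E)%E).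
    rewrite -integralZl_ge0; last 3 first.
    - by rewrite mulr_ge0 ?expR_ge0// normc_ge0.
    - exact: measurable_fun_normc.
    - by move=> w; exact: normc_ge0.
    apply: ge0_le_integral => //.
    - by move=> w _; rewrite lee_fin normc_ge0.
    - by apply/measurable_EFinP; apply: measurable_fun_normc; case: (F1 z).
    - by apply/measurable_EFinP; apply: measurable_funM => //; exact: measurable_fun_normc.
    move=> w _; rewrite lee_fin /F /= Normc.normcM normc_conj.
    apply: (le_trans (ler_wpM2r (normc_ge0 (h z)) (ukle z w))).
    by rewrite le_eqVlt; apply/predU1P; left; ring.
  by rewrite UE -EFinM lee_fin normc_real ?expR_ge0// [leRHS]mulrC.
rewrite -[LHS]/(cintegral (fun z => p z * ((h z)^*)%R)).
rewrite -[RHS]/(cintegral (fun z => u z * ((h z)^*)%R)).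
rewrite -(eq_cintegral F1E) -(eq_cintegral F2E).
exact: cFubini.
Qed.

(** * The Toeplitz operator on its natural domain *)

Lemma sqL2norm_mul g h :
  (\int[mu]_z (normc (g z) ^+ 2 * normc (h z) ^+ 2)%:E = sqL2norm (fun z => (g z * h z)%R))%E.
Proof. by apply: eq_integral => z _; rewrite Normc.normcM exprMn. Qed.

Lemma Re_inner_self f : L2 f -> complex.Re (inner f f) = L2norm f ^+ 2.
Proof.
move=> [mf foo]; apply: EFin_inj; rewrite -sqr_L2norm//= /Rintegral.
rewrite (eq_integral (fun z => (normc (f z) ^+ 2)%:E)); last first.
  by move=> z _; rewrite mulC_conj.
rewrite -/(sqL2norm f) fineK// ge0_fin_numE//; exact: sqL2norm_ge0.
Qed.

(** If p is the projection of g f, then ||p||^2 = <g f, p> = <f, conj(g) p>, which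
    is at most ||f|| times the norm of p in the space of the Carleson measure. *)
Lemma Carleson_op_bounded g (mg : measurable_fun setT g) :
  Fock_Carleson (density mu (measurable_sqr_normc mg) (sqr_normc_ge0 g)) ->
  op_bounded g.
Proof.
move=> [C [C0 hC]]; exists (Num.sqrt C); split; first by rewrite sqrtr_gt0.
move=> f [Lf Lgf]; rewrite /toeplitz_op /proj_F2.
set P := [set p | _].
(* Without a projection of g f, the default value of [proj_F2] is 0. *)
have [[p Pp]|nP] := pselect (exists p, P p); last first.
  rewrite xgetPN; last by move=> p Pp; apply: nP; exists p.
  rewrite {1}/L2norm /sqL2norm; under eq_integral do rewrite Normc.normc0 expr0n.
  by rewrite integral0 /= sqrtr0 mulr_ge0 ?sqrtr_ge0// L2norm_ge0.
have {p Pp} := xgetPex (fun=> 0) (ex_intro _ p Pp).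
set p := xget _ _ => -[F2p /(_ p F2p) orth].
have Lp := F2_L2 F2p; have [mp poo] := Lp; have [mf foo] := Lf.
have gp : (sqL2norm (fun z => (((g z)^*)%R * p z)%R) <= (C * L2norm p ^+ 2)%:E)%E.
  rewrite -sqL2norm_mul; under eq_integral do rewrite normc_conj.
  by rewrite -(Carleson_integralE (measurable_sqr_normc mg) (sqr_normc_ge0 g))//; exact: hC.
have Lgp : L2 (fun z => ((g z)^*)%R * p z).
  split; last by rewrite (le_lt_trans gp)// ltry.
  by apply: measurable_funcM => //; exact: measurable_funcJ.
have E : inner (fun z => g z * f z) p = inner p p.
  apply/eqP; rewrite -subr_eq0 -{}orth; apply/eqP.
  have i1 := L2_cintegrable Lgf Lp; have i2 := L2_cintegrable Lp Lp.
  have -> : inner (fun z => g z * f z - p z) p =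
      cintegral (fun z => g z * f z * ((p z)^*)%R + -1 * (p z * ((p z)^*)%R)).
    by apply: eq_cintegral => z; ring.
  rewrite cintegralD//; last exact: cintegrableZ.
  by rewrite cintegralZ// mulN1r.
have E2 : inner (fun z => g z * f z) p = inner f (fun z => ((g z)^*)%R * p z).
  by apply: eq_cintegral => z; rewrite rmorphM /= conjCK; ring.
have le1 : L2norm p ^+ 2 <= L2norm f * (Num.sqrt C * L2norm p).
  rewrite -Re_inner_self// -E E2.
  rewrite (le_trans (le_trans (ler_norm _) (normr_Re_le _)))//.
  rewrite (le_trans (inner_le Lf Lgp))// ler_wpM2l ?L2norm_ge0//.
  rewrite -(@ler_pXn2r _ 2) ?nnegrE ?mulr_ge0 ?sqrtr_ge0 ?L2norm_ge0//.
  rewrite exprMn (sqr_sqrtr (ltW C0)) -lee_fin -sqr_L2norm//.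
  by case: Lgp.
have [->|p0] := eqVneq (L2norm p) 0.
  by rewrite mulr_ge0 ?sqrtr_ge0// L2norm_ge0.
have pp : 0 < L2norm p by rewrite lt_neqAle eq_sym p0 L2norm_ge0.
by rewrite -(ler_pM2r pp) -expr2 (le_trans le1)// mulrA [L2norm f * _]mulrC.
Qed.

(** For h in F^2, test the operator on f = conj(g) h 1_A, where A is the set on which
    |g| and |z| are at most n. If p is the projection of g f, then
    ||f||^2 = <g f, h> = <p, h> <= C ||f|| ||h||, so that the integral of
    |g|^2 |h|^2 over A, which is ||f||^2, is at most C^2 ||h||^2; let n tend to
    infinity. *)
Lemma op_bounded_Carleson g (mg : measurable_fun setT g) :
  op_bounded g ->
  Fock_Carleson (density mu (measurable_sqr_normc mg) (sqr_normc_ge0 g)).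
Proof.
move=> [C [C0 hC]]; exists (C ^+ 2); split; first by rewrite exprn_gt0.
move=> h F2h; have Lh := F2_L2 F2h; have [mh hoo] := Lh.
rewrite Carleson_integralE//.
have mw : measurable_fun setT (fun z => normc (g z) ^+ 2 * normc (h z) ^+ 2).
  by apply: measurable_funM; exact: measurable_sqr_normc.
pose A (n : nat) := [set z | normc (g z) <= n%:R] `&` [set z | normc z <= n%:R].
have mA n : measurable (A n).
  apply: measurableI; last exact: measurable_cdisc.
  rewrite -[X in measurable X]setTI (_ : [set z | _] = g @^-1` [set z | normc z <= n%:R])//.
  by apply: mg => //; exact: measurable_cdisc.
apply: (integral_le_exhaustion (A := A)) => //.
- by move=> z; rewrite (mulr_ge0 (sqr_ge0 _))// sqr_ge0.
- move=> m n mn z /= [h1 h2].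
  by split => /=; [apply: le_trans h1 _|apply: le_trans h2 _]; rewrite ler_nat.
- move=> z; pose M := Num.max (normc (g z)) (normc z).
  have M0 : 0 <= M by rewrite le_max normc_ge0.
  by exists (Num.bound M); split => /=; rewrite (le_trans _ (ltW (archi_boundP M0)))// /M le_max lexx ?orbT.
move=> n.
pose f z := (\1_(A n) z)%:C * (((g z)^*)%R * h z).
have mf : measurable_fun setT f.
  apply: measurable_funcM; first by apply: measurable_fun_real_complex.
  by apply: measurable_funcM => //; exact: measurable_funcJ.
have fE z : normc (f z) ^+ 2 = \1_(A n) z * (normc (g z) ^+ 2 * normc (h z) ^+ 2).
  rewrite /f !Normc.normcM normc_conj !exprMn normc_real//.
  by rewrite indicE; case: (_ \in _); rewrite ?expr1n// expr0n.
have XE : (\int[mu]_(z in A n) (normc (g z) ^+ 2 * normc (h z) ^+ 2)%:E = sqL2norm f)%E.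
  rewrite integral_mkcond; apply: eq_integral => z _; rewrite patchE fE indicE.
  by case: ifPn => _; rewrite ?mul1r// mul0r.
have n0 : 0 <= n%:R ^+ 2 :> R by exact: sqr_ge0.
have fle z : normc (f z) ^+ 2 <= n%:R ^+ 2 * normc (h z) ^+ 2.
  rewrite fE indicE; case: (boolP (z \in A n)) => [|_]; last first.
    by rewrite mul0r (mulr_ge0 n0)// sqr_ge0.
  rewrite inE mul1r => -[/= gn _]; rewrite ler_wpM2r ?sqr_ge0//.
  by rewrite ler_pXn2r ?nnegrE ?normc_ge0.
have ule z : normc (g z * f z) ^+ 2 <= n%:R ^+ 2 * normc (f z) ^+ 2.
  rewrite Normc.normcM exprMn; case: (boolP (z \in A n)) => [|zA]; last first.
    by rewrite fE indicE (negbTE zA) !mul0r !mulr0.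
  rewrite inE => -[/= gn _]; rewrite ler_wpM2r ?sqr_ge0//.
  by rewrite ler_pXn2r ?nnegrE ?normc_ge0.
have L2le (k1 k2 : R[i] -> R[i]) : measurable_fun setT k1 -> L2 k2 ->
    (forall z, normc (k1 z) ^+ 2 <= n%:R ^+ 2 * normc (k2 z) ^+ 2) -> L2 k1.
  move=> m1 [m2 o2] k12; split => //.
  apply: (@le_lt_trans _ _ ((n%:R ^+ 2)%:E * sqL2norm k2)%E); last first.
    by apply: lte_mul_pinfty.
  rewrite /sqL2norm -(integralZl_ge0 _ n0 (measurable_sqr_normc m2) (fun z => sqr_ge0 _)).
  apply: ge0_le_integral => //.
  - by move=> z _; rewrite lee_fin sqr_ge0.
  - by apply/measurable_EFinP; exact: measurable_sqr_normc.
  - by apply/measurable_EFinP; apply: measurable_funM => //; exact: measurable_sqr_normc.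
  - by move=> z _; rewrite lee_fin.
have Lf : L2 f by exact: L2le Lh fle.
have Lu : L2 (fun z => g z * f z).
  by apply: L2le Lf ule; exact: measurable_funcM.
have usupp w : n%:R < normc w -> g w * f w = 0.
  move=> nw; suff -> : f w = 0 by rewrite mulr0.
  rewrite /f indicE memNset ?mul0r// => -[_ /=]; apply/negP; by rewrite -ltNge.
have [p0 Pp0] := projection_exists Lu (ler0n _ n) usupp.
have := xgetPex (fun=> 0) (ex_intro (fun p => is_F2_projection (fun z => g z * f z) p) p0 Pp0).
have := hC f (conj Lf Lu); rewrite /toeplitz_op -/(proj_F2 _).
set p := proj_F2 _ => ple [F2p /(_ h F2h) orth].
have Lp := F2_L2 F2p.
have E : inner f f = inner p h.
  have -> : inner f f = inner (fun z => g z * f z) h.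
    apply: eq_cintegral => z; rewrite /f !rmorphM /= conjCK.
    pose c : R := \1_(A n) z; rewrite -/c.
    have -> : ((c%:C)^*)%R = c%:C by exact: conjc_real.
    have cc : c%:C * c%:C = c%:C :> R[i].
      by rewrite /c indicE; case: (_ \in _); rewrite -rmorphM /= ?mulr1// mulr0.
    transitivity (c%:C * c%:C * (((g z)^*)%R * h z * (g z * ((h z)^*)%R))); first by ring.
    by rewrite cc; ring.
  apply/eqP; rewrite -subr_eq0 -{}orth; apply/eqP.
  have i1 := L2_cintegrable Lu Lh; have i2 := L2_cintegrable Lp Lh.
  have -> : inner (fun z => g z * f z - p z) h =
      cintegral (fun z => g z * f z * ((h z)^*)%R + -1 * (p z * ((h z)^*)%R)).
    by apply: eq_cintegral => z; ring.
  rewrite cintegralD//; last exact: cintegrableZ.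
  by rewrite cintegralZ// mulN1r.
have le1 : L2norm f ^+ 2 <= C * L2norm f * L2norm h.
  rewrite -(Re_inner_self Lf) E.
  rewrite (le_trans (le_trans (ler_norm _) (normr_Re_le _)))//.
  by rewrite (le_trans (inner_le Lp Lh))// ler_wpM2r ?L2norm_ge0.
have le2 : L2norm f <= C * L2norm h.
  have [->|f0] := eqVneq (L2norm f) 0.
    by rewrite mulr_ge0 ?L2norm_ge0// ltW.
  have ff : 0 < L2norm f by rewrite lt_neqAle eq_sym f0 L2norm_ge0.
  by rewrite -(ler_pM2r ff) -expr2 (le_trans le1)// mulrAC.
rewrite XE sqr_L2norm; last by case: Lf.
by rewrite lee_fin -exprMn ler_pXn2r ?nnegrE ?mulr_ge0 ?L2norm_ge0// ltW.
Qed.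

End projection.

(** * The smoothed annuli symbol *)

Section annuli_symbol.
Variable R : realType.
Local Notation dA := (@area R).
Implicit Types (z w a : R[i]) (n : nat).

(** The area of the unit disc. All the areas below are computed in this unit by
    scaling; its value pi is not needed. *)
Definition disc1 : R := fine (dA [set z | (normc z <= 1)%R]).

Lemma disc1E : (dA [set z | (normc z <= 1)%R] = disc1%:E)%E.
Proof.
rewrite fineK// ge0_fin_numE//.
by rewrite (le_lt_trans (area_cdisc_le ler01))// ltry.
Qed.

Lemma disc1_gt0 : 0 < disc1.
Proof. by rewrite -lte_fin -disc1E area_cdisc_gt0. Qed.

Lemma area_cdisc (r : R) : 0 < r ->
  (dA [set z | (normc z <= r)%R] = (r ^+ 2 * disc1)%:E)%E.
Proof.
move=> r0; rewrite -(area_scale r0 (@measurable_cdisc R r)).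
transitivity ((r ^+ 2)%:E * dA [set z | (normc z <= 1)%R])%E; last by rewrite disc1E.
congr (_ * dA _)%E; apply/seteqP; split => z /=.
  by rewrite Normc.normcM normc_real ?(ltW r0)// ger_pMr.
by rewrite Normc.normcM normc_real ?(ltW r0)// ger_pMr.
Qed.

Lemma area_ring (r s : R) : 0 < r -> r <= s ->
  (dA ([set z | (normc z <= s)%R] `\` [set z | (normc z <= r)%R]) =
   ((s ^+ 2 - r ^+ 2) * disc1)%:E)%E.
Proof.
move=> r0 rs; have s0 := lt_le_trans r0 rs.
rewrite measureD; last 3 first.
- exact: measurable_cdisc.
- exact: measurable_cdisc.
- exact: (le_lt_trans (area_cdisc_le (ltW s0)) (ltry _)).
rewrite (_ : _ `&` _ = [set z | normc z <= r]); last first.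
  by apply/seteqP; split => [z []//|z /= zr]; split => //=; exact: le_trans zr rs.
transitivity (dA [set z | (normc z <= s)%R] - dA [set z | (normc z <= r)%R])%E => //.
by rewrite !area_cdisc// -EFinB mulrBl.
Qed.

(** q = n^(1/4), in terms of which the radius, the width and the height of the n-th
    annulus are q^2, q^(-18) and q^10 ln n. *)
Definition root4 n : R := n%:R `^ (4^-1).

Lemma root4X n k : root4 n ^+ k = n%:R `^ (k%:R / 4).
Proof. by rewrite -powR_mulrn ?powR_ge0// /root4 -powRrM mulrC. Qed.

Lemma root4_4 n : root4 n ^+ 4 = n%:R.
Proof. by rewrite root4X divff// powRr1. Qed.

Lemma root4_ge1 n : (1 <= n)%N -> 1 <= root4 n.
Proof.
move=> n1; rewrite -(@ler_pXn2r _ 4) ?nnegrE ?powR_ge0//.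
by rewrite root4_4 expr1n ler1n.
Qed.

Lemma ann_radiusE n : ann_radius R n = root4 n ^+ 2.
Proof.
rewrite /ann_radius -root4_4 (_ : 4 = 2 * 2)%N// exprM sqrtr_sqr ger0_norm//.
exact: sqr_ge0.
Qed.

Lemma ann_widthE n : ann_width R n = (root4 n ^+ 18)^-1.
Proof. by rewrite /ann_width powRN root4X; congr (_ `^ _)^-1; field. Qed.

Lemma ann_heightE n : ann_height R n = root4 n ^+ 10 * ln n%:R.
Proof. by rewrite /ann_height root4X; congr (_ `^ _ * _); field. Qed.

Lemma ann_height_ge0 n : (1 <= n)%N -> 0 <= ann_height R n.
Proof. by move=> n1; rewrite mulr_ge0 ?powR_ge0// ln_ge0// ler1n. Qed.

Lemma ln_root4_le n : (1 <= n)%N -> ln n%:R <= 4 * root4 n.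
Proof.
move=> n1; have q1 := root4_ge1 n1; have q0 := lt_le_trans ltr01 q1.
rewrite -{1}root4_4 lnXn// -[_ *+ 4]mulr_natl ler_pM2l//.
exact/ltW/ln_sublinear.
Qed.

Lemma ann_width_le n : (2 <= n)%N -> ann_width R n <= 16^-1.
Proof.
move=> n2; have q1 := root4_ge1 (ltnW n2); have q0 := lt_le_trans ltr01 q1.
rewrite ann_widthE lef_pV2 ?posrE ?exprn_gt0//.
have -> : 16 = 2 ^+ 4 :> R by rewrite -natrX.
rewrite (_ : 18 = 4 * 4 + 2)%N// exprD exprM root4_4.
rewrite -[leLHS]mulr1 ler_pM ?exprn_ge0// ?exprn_ege1//.
by rewrite ler_pXn2r ?nnegrE// ler_nat.
Qed.

Lemma ann_width_gt0 n : (1 <= n)%N -> 0 < ann_width R n.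
Proof.
move=> n1; have q1 := root4_ge1 n1; have q0 := lt_le_trans ltr01 q1.
by rewrite ann_widthE invr_gt0 exprn_gt0.
Qed.

Lemma ann_radius_ge n : (2 <= n)%N -> 5 / 4 <= ann_radius R n.
Proof.
move=> n2; rewrite /ann_radius -(@ler_pXn2r _ 2) ?nnegrE ?sqrtr_ge0//.
rewrite sqr_sqrtr// expr_div_n (@le_trans _ _ 2)//; last by rewrite ler_nat.
by rewrite ler_pdivrMr -?natrX -?natrM ?ler_nat ?ltr0n.
Qed.

Lemma measurable_annulus n : measurable (@annulus R n).
Proof.
rewrite -[X in measurable X]setTI (_ : annulus n = (@normc R) @^-1`
  `[ann_radius R n - ann_width R n, ann_radius R n + ann_width R n]%classic).
  by apply: measurable_normc => //; exact: measurable_itv.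
by apply/seteqP; split => z; rewrite /annulus /= in_itv /= ler_distl.
Qed.

Lemma radius_width n : (1 <= n)%N -> ann_radius R n * ann_width R n = (root4 n ^+ 16)^-1.
Proof.
move=> n1; have q1 := root4_ge1 n1; have q0 := lt_le_trans ltr01 q1.
rewrite ann_radiusE ann_widthE (_ : 18 = 2 + 16)%N// exprD invfM mulrA divff ?mul1r//.
by rewrite expf_neq0// gt_eqF.
Qed.

Lemma area_annulus_ge n : (2 <= n)%N ->
  ((4 * disc1 / root4 n ^+ 16)%:E <= dA (@annulus R n))%E.
Proof.
move=> n2; have w0 := ann_width_gt0 (ltnW n2); have w1 := ann_width_le n2.
have r1 := ann_radius_ge n2; have rw := radius_width (ltnW n2).
set a := ann_radius R n in rw r1; set r := ann_width R n in w0 w1 rw.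
have ar0 : 0 < a - r by lra.
have ar : a - r <= a + r by lra.
apply: (@le_trans _ _ (dA ([set z | (normc z <= a + r)%R] `\` [set z | (normc z <= a - r)%R]))).
  rewrite (area_ring ar0 ar) lee_fin -rw le_eqVlt; apply/predU1P; left; ring.
apply: le_measure; rewrite ?inE.
- by apply: measurableD; exact: measurable_cdisc.
- exact: measurable_annulus.
- move=> z /= [h1 /negP h2]; rewrite /annulus /= -/a -/r ler_distl h1 andbT.
  by rewrite -ltNge in h2; exact: ltW.
Qed.

(** The upper bound uses a half-open ring with the smaller radius a - 2 r, which
    contains the closed annulus. *)
Lemma area_annulus_le n : (2 <= n)%N ->
  (dA (@annulus R n) <= (6 * disc1 / root4 n ^+ 16)%:E)%E.
Proof.
move=> n2; have w0 := ann_width_gt0 (ltnW n2); have w1 := ann_width_le n2.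
have r1 := ann_radius_ge n2; have rw := radius_width (ltnW n2).
set a := ann_radius R n in rw r1; set r := ann_width R n in w0 w1 rw.
have ar0 : 0 < a - 2 * r by lra.
have ar : a - 2 * r <= a + r by lra.
apply: (@le_trans _ _ (dA ([set z | (normc z <= a + r)%R] `\` [set z | (normc z <= a - 2 * r)%R]))).
  apply: le_measure; rewrite ?inE.
  - exact: measurable_annulus.
  - by apply: measurableD; exact: measurable_cdisc.
  - move=> z /=; rewrite /annulus /= -/a -/r ler_distl => /andP[h1 h2].
    by split => //=; apply/negP; rewrite -ltNge; lra.
rewrite (area_ring ar0 ar) lee_fin -rw -mulrA [leRHS]mulrCA [disc1 * _]mulrC mulrA.
by rewrite ler_pM2r ?disc1_gt0//; nra.
Qed.

(** The masses d_n |A_n| are summable: with p = n^(1/4) and q = (n + 1)^(1/4) they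
    are O(q^-5), because ln (n + 1) <= 4 q, while q^4 - p^4 = 1 makes 1 / p - 1 / q
    of the same order. *)
Lemma ann_mass_le n : (1 <= n)%N ->
  ann_height R n.+1 * (6 * disc1 / root4 n.+1 ^+ 16) <=
  96 * disc1 * ((root4 n)^-1 - (root4 n.+1)^-1).
Proof.
move=> n1; have p1 := root4_ge1 n1; have q1 := root4_ge1 (leqW n1).
have pq : root4 n.+1 ^+ 4 = root4 n ^+ 4 + 1 by rewrite !root4_4 natr1.
have ln_le := ln_root4_le (leqW n1).
rewrite ann_heightE; have c0 := disc1_gt0.
move: (root4 n) (root4 n.+1) (ln _) disc1 p1 q1 pq ln_le c0 => p q l c p1 q1 pq lq c0.
have p0 := lt_le_trans ltr01 p1; have q0 := lt_le_trans ltr01 q1.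
have ple : p <= q.
  by rewrite -(@ler_pXn2r _ 4) ?nnegrE ?(ltW p0) ?(ltW q0)// pq lerDl.
have step : 1 <= (q - p) * (4 * q ^+ 3).
  have e1 : (q - p) * ((q + p) * (q ^+ 2 + p ^+ 2)) = 1.
    by transitivity (q ^+ 4 - p ^+ 4); [ring|rewrite pq; ring].
  rewrite -[leLHS]e1 ler_wpM2l ?subr_ge0// (_ : 4 * q ^+ 3 = (2 * q) * (2 * q ^+ 2)); last by ring.
  rewrite ler_pM ?addr_ge0 ?sqr_ge0 ?(ltW p0) ?(ltW q0)//; first lra.
  have : p ^+ 2 <= q ^+ 2 by rewrite ler_pXn2r ?nnegrE ?(ltW p0) ?(ltW q0).
  lra.
have -> : q ^+ 10 * l * (6 * c / q ^+ 16) = 6 * c * (l / q ^+ 6).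
  by field; rewrite gt_eqF.
have -> : 96 * c * (p^-1 - q^-1) = 6 * c * (16 * ((q - p) / (p * q))).
  by field; rewrite !gt_eqF.
rewrite ler_pM2l ?mulr_gt0//.
apply: (@le_trans _ _ (4 * q / q ^+ 6)).
  by rewrite ler_wpM2r// invr_ge0 exprn_ge0// ltW.
rewrite ler_pdivrMr ?exprn_gt0//.
have -> : 16 * ((q - p) / (p * q)) * q ^+ 6 = 4 * ((q - p) * (4 * q ^+ 3)) * (q ^+ 2 / p).
  by field; rewrite !gt_eqF.
have qp : q <= q ^+ 2 / p by rewrite ler_pdivlMr// expr2 ler_pM2l.
have := ltW q0; nra.
Qed.

(** Integrating the bound on the Gaussian averages of G over the centres a with
    |a| <= r: each z with |z| <= r - 1 sees the whole disc of radius 1 around it, on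
    which the Gaussian is at least 1 / e, so that the mass of G in the disc of
    radius r - 1 is O(M r^2). *)
Lemma localized_mass (G : R[i] -> R) (M r : R) : measurable_fun setT G ->
  (forall z, 0 <= G z) -> 0 < M ->
  (forall a, (\int[dA]_z (expR (- normc (z - a) ^+ 2) * G z)%:E <= M%:E)%E) ->
  0 <= r ->
  ((expR (- 1) * disc1)%:E * \int[dA]_(z in [set z | (normc z <= r - 1)%R]) (G z)%:E <=
   (M * (4 * r ^+ 2))%:E)%E.
Proof.
move=> mG G0 M0 hM r0.
pose D s := [set z : R[i] | normc z <= s].
have mD s : measurable (D s) by exact: measurable_cdisc.
have mi s : measurable_fun setT (\1_(D s) : R[i] -> R) by [].
have mgs a : measurable_fun setT (fun z => expR (- normc (z - a) ^+ 2) * G z).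
  by apply: measurable_funM => //; exact: measurable_gauss_shift.
have gs0 a z : 0 <= expR (- normc (z - a) ^+ 2) * G z by rewrite mulr_ge0 ?expR_ge0.
have i0 s z : 0 <= \1_(D s) z :> R by rewrite indicE.
pose k (p : R[i] * R[i]) := \1_(D r) p.1 * (expR (- normc (p.2 - p.1) ^+ 2) * G p.2).
have k0 p : 0 <= k p by exact: mulr_ge0.
have mk : measurable_fun setT k.
  apply: measurable_funM; first exact: (measurableT_comp (mi r)).
  apply: measurable_funM; last exact: measurableT_comp.
  apply: measurableT_comp => //; apply: measurableT_comp => //; apply: measurable_funX.
  apply: measurable_fun_normc; apply: measurable_funcD => //.
  exact: measurable_funcN.
apply: (@le_trans _ _ (\int[dA]_a \int[dA]_z (k (a, z))%:E)%E); last first.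
  apply: (@le_trans _ _ (\int[dA]_a (M * \1_(D r) a)%:E)%E).
    apply: ge0_le_integral => //.
    - by move=> a _; apply: integral_ge0 => z _; rewrite lee_fin.
    - apply: (@measurable_fun_fubini_tonelli_F _ _ _ _ _ dA (EFin \o k)) => //.
      exact/measurable_EFinP.
    - by apply/measurable_EFinP; exact: measurable_funM.
    move=> a _; rewrite /k /= (integralZl_ge0 _ (i0 r a) (mgs a) (gs0 a)).
    rewrite [M * _]mulrC [leRHS]EFinM.
    by apply: lee_wpmul2l; rewrite ?lee_fin.
  rewrite (integralZl_ge0 _ (ltW M0) (mi r) (i0 r)) integral_indic// setIT.
  rewrite EFinM lee_wpmul2l ?lee_fin ?(ltW M0)//.
  exact: area_cdisc_le.
rewrite (fubini_tonelli (EFin \o k)); last 2 first.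
- exact/measurable_EFinP.
- by move=> p; rewrite lee_fin.
have c0 : 0 <= expR (- 1) * disc1 by rewrite mulr_ge0 ?expR_ge0// ltW ?disc1_gt0.
rewrite integral_mkcond.
have -> : (fun z => (G z)%:E) \_ [set z | normc z <= r - 1] =
    (fun z => (\1_(D (r - 1)) z * G z)%:E).
  apply/funext => z; rewrite patchE indicE /D.
  by case: (_ \in _); rewrite ?mul1r ?mul0r.
have mDG : measurable_fun setT (fun z => \1_(D (r - 1)) z * G z) by exact: measurable_funM.
rewrite -(integralZl_ge0 _ c0 mDG); last by move=> z; exact: mulr_ge0.
apply: ge0_le_integral => //.
- by move=> z _; rewrite lee_fin mulr_ge0// mulr_ge0.
- by apply/measurable_EFinP; exact: measurable_funM.
- apply: (@measurable_fun_fubini_tonelli_G _ _ _ _ _ dA (EFin \o k)) => //.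
  exact/measurable_EFinP.
move=> z _; rewrite indicE; have [|_] := boolP (z \in D (r - 1)); last first.
  rewrite mul0r mulr0; apply: integral_ge0 => a _; rewrite lee_fin; exact: k0.
rewrite inE /D /= => zr; rewrite mul1r.
pose B := [set a : R[i] | normc (a - z) <= 1].
have [mtr tr] := area_translate (- z).
have mB : measurable B.
  by have := mtr measurableT _ (@measurable_cdisc R 1); rewrite setTI.
have BE : (dA B = disc1%:E)%E by rewrite -disc1E -(tr _ (@measurable_cdisc R 1)).
have e0 : 0 <= expR (- 1) * G z by rewrite mulr_ge0 ?expR_ge0.
apply: (@le_trans _ _ (\int[dA]_a ((expR (- 1) * G z) * \1_B a)%:E)%E).
  rewrite (integralZl_ge0 _ e0) ?integral_indic ?setIT//.
  rewrite le_eqVlt; apply/predU1P; left.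
  transitivity ((expR (-1) * G z)%:E * dA B)%E => //.
  by rewrite BE -EFinM mulrAC.
apply: ge0_le_integral => //.
- by move=> a _; rewrite lee_fin mulr_ge0// indicE.
- by apply/measurable_EFinP; exact: measurable_funM.
- apply/measurable_EFinP; exact: (measurableT_comp mk (pair2_measurable z)).
move=> a _; rewrite lee_fin /k /= !indicE.
have [|_] := boolP (a \in B); last first.
  by rewrite mulr0 mulr_ge0 ?gs0// ler0n.
rewrite inE /B /= => az.
have -> : a \in D r.
  rewrite inE /D /= (_ : a = (a - z) + z); last by ring.
  by rewrite (le_trans (le_normcD _ _))//; lra.
rewrite mulr1 mul1r ler_wpM2r// ler_expR lerN2 normc_distC.
by rewrite expr_le1// normc_ge0.
Qed.

Section bumps.
Variables (c1 : R) (psi : nat -> R[i] -> R).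
Hypotheses (c1_gt0 : 0 < c1) (bumps : annular_bumps c1 psi).

Lemma bump_ge0 n z : (2 <= n)%N -> 0 <= psi n z.
Proof. by move=> n2; have [_ _ _ /(_ z)/andP[]] := bumps n2. Qed.

Lemma bump_le1 n z : (2 <= n)%N -> psi n z <= 1.
Proof. by move=> n2; have [_ _ _ /(_ z)/andP[]] := bumps n2. Qed.

Lemma bump_supp n z : (2 <= n)%N -> psi n z != 0 -> annulus n z.
Proof. by move=> n2 z0; have [_ _ sub _ _] := bumps n2; apply: sub; exact: subset_closure. Qed.

Lemma measurable_bump n : (2 <= n)%N -> measurable_fun setT (psi n).
Proof.
move=> n2; have [[Ck0 _] _ _ _ _] := bumps n2.
have c : continuous (psi n \o @of_xy R) := Ck0 0%N.
apply: (measurability _ (RGenOpens.measurableE R)).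
move=> _ [_ [a [b ->] <-]]; rewrite setTI; apply: sub_sigma_algebra => /=.
rewrite openE => z /= zab.
have : nbhs (complex.Re z, complex.Im z) ((psi n \o @of_xy R) @^-1` `]a, b[%classic).
  apply: c; apply: open_nbhs_nbhs; split; first exact: interval_open.
  by rewrite /= /of_xy /=; case: (z) zab.
move=> /nbhs_ballP[e /= e0 eV]; rewrite /interior /= -nbhs_ballE.
exists e%:C => /=; first by rewrite ltcR.
move=> w; rewrite -ball_normE /= normc_lt => zw.
have := eV (complex.Re w, complex.Im w); rewrite /= /of_xy /=.
have -> : complex.Re w +i* complex.Im w = w by case: (w).
apply; split; rewrite /= -ball_normE /=; apply: le_lt_trans zw.
  by rewrite -raddfB; exact: normr_Re_le.
by rewrite -raddfB; exact: normr_Im_le.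
Qed.

Lemma integral_bump_le n : (2 <= n)%N ->
  (\int[dA]_z (psi n z)%:E <= dA (@annulus R n))%E.
Proof.
move=> n2; rewrite -[leRHS]mul1e -integral_cst; last exact: measurable_annulus.
rewrite [leRHS]integral_mkcond; apply: ge0_le_integral => //.
- by move=> z _; rewrite lee_fin bump_ge0.
- by apply/measurable_EFinP; exact: measurable_bump.
- by apply/(measurable_restrictT _ (measurable_annulus n)); exact: measurable_cst.
move=> z _; rewrite patchE; case: ifPn => [_|/negP zA]; first by rewrite lee_fin bump_le1.
have [->//|/(bump_supp n2) h] := eqVneq (psi n z) 0.
by case: zA; rewrite inE.
Qed.

(** A lower bound for the integral of psi^2 on the annulus A, from that of psi:
    psi^2 >= 2 c1 psi - c1^2 1_A pointwise. *)
Lemma integral_bump_sqr_ge n : (2 <= n)%N ->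
  ((c1 ^+ 2 * (4 * disc1 / root4 n ^+ 16))%:E <= \int[dA]_z (psi n z ^+ 2)%:E)%E.
Proof.
move=> n2; have mpsi := measurable_bump n2; have mA := measurable_annulus n.
have [_ _ _ _ lb] := bumps n2.
have Afin : (dA (@annulus R n) < +oo)%E.
  by rewrite (le_lt_trans (area_annulus_le n2))// ltry.
have A0 : (0 <= dA (@annulus R n))%E by exact: measure_ge0.
have AE : (dA (@annulus R n) = (fine (dA (@annulus R n)))%:E)%E.
  by rewrite fineK// ge0_fin_numE.
set v := fine _ in AE.
have vge : 4 * disc1 / root4 n ^+ 16 <= v.
  by have := area_annulus_ge n2; rewrite AE lee_fin.
have c20 : 0 <= 2 * c1 by rewrite mulr_ge0// ltW.
have c120 : 0 <= c1 ^+ 2 by exact: sqr_ge0.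
have mi : measurable_fun setT (\1_(@annulus R n) : R[i] -> R) by [].
have key : ((2 * c1)%:E * \int[dA]_z (psi n z)%:E <=
    \int[dA]_z (psi n z ^+ 2)%:E + (c1 ^+ 2 * v)%:E)%E.
  rewrite -(integralZl_ge0 _ c20 mpsi (fun z => bump_ge0 z n2)).
  have -> : (c1 ^+ 2 * v)%:E = (\int[dA]_z (c1 ^+ 2 * \1_(@annulus R n) z)%:E)%E.
    rewrite (integralZl_ge0 _ c120 mi); last by move=> z; rewrite indicE.
    by rewrite integral_indic// setIT [X in (_ * X)%E]AE.
  have m2 : measurable_fun setT (fun z => (psi n z ^+ 2)%:E).
    by apply/measurable_EFinP; exact: measurable_funX.
  have m3 : measurable_fun setT (fun z => (c1 ^+ 2 * \1_(@annulus R n) z)%:E).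
    by apply/measurable_EFinP; exact: measurable_funM.
  rewrite -ge0_integralD//; last 2 first.
  - by move=> z _; rewrite lee_fin sqr_ge0.
  - by move=> z _; rewrite lee_fin mulr_ge0// indicE.
  apply: ge0_le_integral => //.
  - by move=> z _; rewrite lee_fin mulr_ge0// bump_ge0.
  - by apply/measurable_EFinP; exact: measurable_funM.
  - exact: emeasurable_funD.
  move=> z _; rewrite -EFinD lee_fin indicE.
  have [->|h] := eqVneq (psi n z) 0.
    by rewrite mulr0 addr_ge0 ?sqr_ge0// mulr_ge0.
  by rewrite mem_set ?mulr1; [have := sqr_ge0 (psi n z - c1); nra|exact: bump_supp].
have key2 : ((2 * c1 * (c1 * v))%:E <= (2 * c1)%:E * \int[dA]_z (psi n z)%:E)%E.
  by rewrite EFinM lee_wpmul2l ?lee_fin// EFinM -AE.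
have := le_trans key2 key.
have I0 : (0 <= \int[dA]_z (psi n z ^+ 2)%:E)%E.
  by apply: integral_ge0 => z _; rewrite lee_fin sqr_ge0.
case: (\int[dA]_z (psi n z ^+ 2)%:E)%E I0 => [r _|_ _|//]; last exact: leey.
rewrite -EFinD !lee_fin => h.
have : c1 ^+ 2 * (4 * disc1 / root4 n ^+ 16) <= c1 ^+ 2 * v by rewrite ler_wpM2l.
by move=> /le_trans; apply; lra.
Qed.

Let g := annuli_symbol psi.
(* The partial sums are eventually constant at each point, since the annuli go to
   infinity. *)
Let S N z := \sum_(2 <= n < N) ann_height R n * psi n z.

Lemma bump_term_ge0 n z : (2 <= n)%N -> 0 <= ann_height R n * psi n z.
Proof. by move=> n2; rewrite mulr_ge0 ?bump_ge0// ann_height_ge0// ltnW. Qed.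

Lemma partial_sum_ge0 N z : 0 <= S N z.
Proof.
rewrite /S big_seq_cond; apply: sumr_ge0 => n.
by rewrite mem_index_iota andbT => /andP[n2 _]; exact: bump_term_ge0.
Qed.

Lemma partial_sumS N z : S N z <= S N.+1 z.
Proof.
have [N2|N2] := leqP 2 N.
  by rewrite /S big_nat_recr//= lerDl bump_term_ge0.
by rewrite {1}/S big_geq ?partial_sum_ge0// ltnW.
Qed.

Lemma partial_sum_nd z : {homo S ^~ z : m n / (m <= n)%N >-> m <= n}.
Proof. by apply/nondecreasing_seqP => n; exact: partial_sumS. Qed.

Lemma bump_eventually0 z : exists N, forall n, (N <= n)%N -> (2 <= n)%N -> psi n z = 0.
Proof.
have b0 : 0 <= (normc z + 1) ^+ 2 by exact: sqr_ge0.
exists (Num.bound ((normc z + 1) ^+ 2)) => n Nn n2.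
apply/eqP; apply/negPn/negP => /(bump_supp n2).
rewrite /annulus /= ler_distl => /andP[h1 h2].
have w1 := ann_width_le n2.
have : ann_radius R n < normc z + 1 by lra.
rewrite -(@ltr_pXn2r _ 2) ?nnegrE ?sqrtr_ge0 ?addr_ge0 ?normc_ge0//.
rewrite sqr_sqrtr// ltNge => /negP; apply.
by rewrite (le_trans (ltW (archi_boundP b0)))// ler_nat.
Qed.

Lemma symbol_eventually z : exists N, forall M, (N <= M)%N -> S M z = g z.
Proof.
have [N0 hN] := bump_eventually0 z.
pose N := maxn N0 2.
have SN M : (N <= M)%N -> S M z = S N z.
  move=> NM; rewrite -(subnKC NM); elim: (M - N)%N => [|k ih]; first by rewrite addn0.
  rewrite addnS /S big_nat_recr/=; last first.
    by rewrite (leq_trans (leq_maxr N0 2))// leq_addr.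
  rewrite -/(S (N + k) z) ih hN ?mulr0 ?addr0//.
    by rewrite (leq_trans (leq_maxl N0 2))// leq_addr.
  by rewrite (leq_trans (leq_maxr N0 2))// leq_addr.
exists N => M NM; rewrite (SN M NM); apply/esym/cvg_lim => //.
by apply: cvg_near_cst; exists N => // k /= /SN.
Qed.

Lemma symbol_cvg z : S ^~ z @ \oo --> g z.
Proof.
have [N hN] := symbol_eventually z.
by apply: cvg_near_cst; exists N => // k /= /hN.
Qed.

Lemma measurable_partial_sum N : measurable_fun setT (S N).
Proof.
rewrite (_ : S N = fun z => \sum_(2 <= n < N)
    ann_height R n * (if (2 <= n)%N then psi n z else 0)).
  apply: measurable_sum => n; apply: measurable_funM => //.
  by have [n2|n2] := boolP (2 <= n)%N; [exact: measurable_bump|exact: measurable_cst].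
apply/funext => z; rewrite /S big_seq [RHS]big_seq; apply: eq_bigr => n.
by rewrite mem_index_iota => /andP[-> _].
Qed.

Lemma measurable_symbol : measurable_fun setT g.
Proof.
apply: (measurable_fun_cvg measurable_partial_sum) => z _; exact: symbol_cvg.
Qed.

Lemma symbol_ge0 z : 0 <= g z.
Proof. by have [N hN] := symbol_eventually z; rewrite -(hN N)// partial_sum_ge0. Qed.

Lemma term_le_symbol n z : (2 <= n)%N -> ann_height R n * psi n z <= g z.
Proof.
move=> n2; have [N hN] := symbol_eventually z.
rewrite -(hN (maxn N n.+1) (leq_maxl _ _)).
apply: (@le_trans _ _ (S n.+1 z)); last by rewrite partial_sum_nd// leq_maxr.
by rewrite /S big_nat_recr//= lerDr; exact: partial_sum_ge0.
Qed.

Lemma integral_partial_sum N : (2 <= N)%N ->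
  (\int[dA]_z (S N z)%:E <= (96 * disc1 * (1 - (root4 N.-1)^-1))%:E)%E.
Proof.
elim: N => // N ih; rewrite ltnS leq_eqVlt => /predU1P[<-|N2].
  rewrite /S; under eq_integral do rewrite big_geq//.
  by rewrite integral0 /root4 powR1 invr1 subrr mulr0.
have mN := measurable_partial_sum N; have mb := measurable_bump N2.
have h0 := ann_height_ge0 (ltnW N2).
have -> : (\int[dA]_z (S N.+1 z)%:E =
    \int[dA]_z (S N z)%:E + \int[dA]_z (ann_height R N * psi N z)%:E)%E.
  rewrite -ge0_integralD//; first last.
  - by apply/measurable_EFinP; exact: measurable_funM.
  - by move=> z _; rewrite lee_fin bump_term_ge0.
  - exact/measurable_EFinP.
  - by move=> z _; rewrite lee_fin partial_sum_ge0.
  by apply: eq_integral => z _; rewrite /S big_nat_recr.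
rewrite (integralZl_ge0 _ h0 mb (fun z => bump_ge0 z N2)).
have NN : N.-1.+1 = N by rewrite prednK// ltnW.
have N1 : (1 <= N.-1)%N by rewrite -ltnS NN.
have step := ann_mass_le N1; rewrite NN in step.
apply: (@le_trans _ _ ((96 * disc1 * (1 - (root4 N.-1)^-1))%:E +
    (ann_height R N * (6 * disc1 / root4 N ^+ 16))%:E)%E).
  apply: leeD; first exact: ih.
  rewrite [leRHS]EFinM; apply: lee_wpmul2l; rewrite ?lee_fin//.
  by rewrite (le_trans (integral_bump_le N2))// area_annulus_le.
rewrite -EFinD lee_fin; move: step => /= step.
move: (root4 N)^-1 (root4 N.-1)^-1 step => u v; lra.
Qed.

(** The symbol is integrable over the plane. *)
Lemma integral_symbol : (\int[dA]_z (g z)%:E <= (96 * disc1)%:E)%E.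
Proof.
have -> : (\int[dA]_z (g z)%:E = \int[dA]_z limn (fun N => (S N z)%:E))%E.
  apply: eq_integral => z _; apply/esym/cvg_lim => //.
  by apply: cvg_EFin; [exact: nearW|exact: symbol_cvg].
rewrite monotone_convergence//; first last.
- by move=> z _ m n mn; rewrite lee_fin partial_sum_nd.
- by move=> n z _; rewrite lee_fin partial_sum_ge0.
- by move=> n; apply/measurable_EFinP; exact: measurable_partial_sum.
have nd : {homo (fun N => \int[dA]_z (S N z)%:E)%E : m n / (m <= n)%N >-> (m <= n)%E}.
  move=> m n mn; apply: ge0_le_integral => //.
  - by move=> z _; rewrite lee_fin partial_sum_ge0.
  - by apply/measurable_EFinP; exact: measurable_partial_sum.
  - by apply/measurable_EFinP; exact: measurable_partial_sum.
  - by move=> z _; rewrite lee_fin partial_sum_nd.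
apply: lime_le; first exact: ereal_nondecreasing_is_cvgn.
exists 2%N => // N /= N2; rewrite (le_trans (integral_partial_sum N2))// lee_fin.
have r0 : 0 <= (root4 N.-1)^-1 by rewrite invr_ge0 powR_ge0.
have := disc1_gt0; nra.
Qed.

Lemma heat_symbol_bounded (t : R) : 0 < t ->
  exists M : R, forall x, (`|heat t g x| <= M%:E)%E.
Proof.
move=> t0; exists ((4 * pi * t)^-1 * (96 * disc1)) => x.
have c0 : 0 <= (4 * pi * t)^-1 by rewrite invr_ge0 !mulr_ge0 ?pi_ge0// ltW.
have int0 : (0 <= \int[dA]_y (g y * expR (- (normc (x - y) ^+ 2 / (4 * t))))%:E)%E.
  by apply: integral_ge0 => z _; rewrite lee_fin mulr_ge0 ?symbol_ge0 ?expR_ge0.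
rewrite /heat gee0_abs; last by rewrite mule_ge0.
rewrite EFinM lee_wpmul2l ?lee_fin//; apply: le_trans integral_symbol.
apply: ge0_le_integral => //.
- by move=> z _; rewrite lee_fin mulr_ge0 ?symbol_ge0 ?expR_ge0.
- apply/measurable_EFinP; apply: measurable_funM; first exact: measurable_symbol.
  apply: measurableT_comp => //; apply: measurableT_comp => //.
  apply: measurable_funM => //; apply: measurable_funX.
  apply: measurable_fun_normc; apply: measurable_funcD => //.
  by apply: measurable_funcN; exact: measurable_id.
- by apply/measurable_EFinP; exact: measurable_symbol.
move=> z _; rewrite lee_fin ler_piMr ?symbol_ge0// -expR0 ler_expR oppr_le0.
by rewrite divr_ge0 ?sqr_ge0// mulr_ge0// ltW.
Qed.

Lemma gauss_sup_symbol : (gauss_sup g < +oo)%E.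
Proof.
apply/(gauss_sup_ltP measurable_symbol symbol_ge0).
exists (96 * disc1); split; first by rewrite mulr_gt0 ?disc1_gt0.
move=> a; apply: le_trans integral_symbol; apply: ge0_le_integral => //.
- by move=> z _; rewrite lee_fin mulr_ge0 ?symbol_ge0 ?expR_ge0.
- by apply/measurable_EFinP; apply: measurable_funM;
    [exact: measurable_gauss_shift|exact: measurable_symbol].
- by apply/measurable_EFinP; exact: measurable_symbol.
move=> z _; rewrite lee_fin ler_piMl ?symbol_ge0// -expR0 ler_expR oppr_le0.
exact: sqr_ge0.
Qed.

(** A bound M on the Gaussian averages of g^2 would bound (ln n)^2: the mass of g^2
    in the disc of radius 2 sqrt(n) - 1, which contains the n-th annulus, is O(M n),
    whereas the n-th term of g alone contributes at least a multiple of d_n^2 |A_n|,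
    that is of n (ln n)^2. *)
Lemma sqr_mass_bound (M : R) : 0 < M ->
  (forall a, (\int[dA]_z (expR (- normc (z - a) ^+ 2) * normc (g z)%:C ^+ 2)%:E <= M%:E)%E) ->
  forall n, (2 <= n)%N ->
  expR (- 1) * disc1 * (c1 ^+ 2 * (4 * disc1)) * ln n%:R ^+ 2 <= M * 16.
Proof.
move=> M0 hM n n2.
have nE z : normc (g z)%:C ^+ 2 = g z ^+ 2 by rewrite normc_real// symbol_ge0.
have mG : measurable_fun setT (fun z => normc (g z)%:C ^+ 2).
  by under eq_fun do rewrite nE; apply: measurable_funX; exact: measurable_symbol.
have r0 : 0 <= 2 * ann_radius R n by rewrite mulr_ge0// sqrtr_ge0.
have := localized_mass mG (fun z => sqr_ge0 _) M0 hM r0.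
have c0 : 0 <= expR (- 1) * disc1 by rewrite mulr_ge0 ?expR_ge0// ltW ?disc1_gt0.
have mb := measurable_bump n2; have h0 := ann_height_ge0 (ltnW n2).
have mD : measurable [set z : R[i] | normc z <= 2 * ann_radius R n - 1].
  exact: measurable_cdisc.
have lb : ((ann_height R n ^+ 2 * (c1 ^+ 2 * (4 * disc1 / root4 n ^+ 16)))%:E <=
    \int[dA]_(z in [set z | (normc z <= 2 * ann_radius R n - 1)%R]) (normc (g z)%:C ^+ 2)%:E)%E.
  apply: (@le_trans _ _ (\int[dA]_z (ann_height R n ^+ 2 * psi n z ^+ 2)%:E)%E).
    rewrite (integralZl_ge0 _ (sqr_ge0 (ann_height R n)) (measurable_funX 2 mb) (fun z => sqr_ge0 (psi n z))).
    by rewrite [leLHS]EFinM; apply: lee_wpmul2l; rewrite ?lee_fin ?sqr_ge0// integral_bump_sqr_ge.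
  rewrite [leRHS]integral_mkcond; apply: ge0_le_integral => //.
  - by move=> z _; rewrite lee_fin -exprMn sqr_ge0.
  - by apply/measurable_EFinP; apply: measurable_funM => //; exact: measurable_funX.
  - by apply/(measurable_restrictT _ mD); apply: measurable_funTS; exact/measurable_EFinP.
  move=> z _; rewrite patchE nE; have [z0|/(bump_supp n2) zA] := eqVneq (psi n z) 0.
    by rewrite z0 expr0n mulr0; case: ifPn => // _; rewrite lee_fin sqr_ge0.
  rewrite ifT; last first.
    rewrite inE /=; move: zA; rewrite /annulus /= ler_distl => /andP[_ h].
    by have := ann_radius_ge n2; have := ann_width_le n2; lra.
  rewrite lee_fin -exprMn lerXn2r ?nnegrE ?bump_term_ge0 ?symbol_ge0//.
  exact: term_le_symbol.
move/(le_trans (lee_wpmul2l _ lb)); rewrite lee_fin => /(_ c0).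
rewrite -EFinM lee_fin ann_heightE ann_radiusE.
have q0 : root4 n != 0 by rewrite gt_eqF// (lt_le_trans ltr01)// root4_ge1// ltnW.
have q4 : 0 < root4 n ^+ 4 by rewrite exprn_gt0// (lt_le_trans ltr01)// root4_ge1// ltnW.
have -> : expR (-1) * disc1 * ((root4 n ^+ 10 * ln n%:R) ^+ 2 * (c1 ^+ 2 * (4 * disc1 / root4 n ^+ 16))) =
  (expR (-1) * disc1 * (c1 ^+ 2 * (4 * disc1)) * ln n%:R ^+ 2) * root4 n ^+ 4 by field.
have -> : M * (4 * (2 * root4 n ^+ 2) ^+ 2) = (M * 16) * root4 n ^+ 4 by ring.
by rewrite ler_pM2r.
Qed.

Lemma gauss_sup_sqr_symbol : ~ (gauss_sup (fun z => normc (g z)%:C ^+ 2)%R < +oo)%E.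
Proof.
have mG : measurable_fun setT (fun z => normc (g z)%:C ^+ 2).
  under eq_fun do rewrite normc_real ?symbol_ge0//.
  by apply: measurable_funX; exact: measurable_symbol.
move/(gauss_sup_ltP mG (fun z => sqr_ge0 _)) => [M [M0 /(sqr_mass_bound M0) hM]].
set K := expR (- 1) * disc1 * (c1 ^+ 2 * (4 * disc1)) in hM.
have K0 : 0 < K by rewrite !mulr_gt0 ?expR_gt0 ?disc1_gt0.
pose L := M * 16 / K + 1.
have L0 : 0 <= M * 16 / K by apply: divr_ge0 (ltW K0); rewrite mulr_ge0// ltW.
have e0 : 0 <= expR L by exact: expR_ge0.
pose n := (Num.bound (expR L)).+2.
have Ln : L <= ln n%:R.
  rewrite -[leLHS]expRK ler_ln ?posrE ?expR_gt0 ?ltr0n//.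
  by rewrite (le_trans (ltW (archi_boundP e0)))// ler_nat ltnW.
have := hM n isT; rewrite mulrC -ler_pdivlMr// => h.
have : ln n%:R ^+ 2 <= L - 1 by rewrite /L addrK.
have : 1 <= L by rewrite /L; lra.
move: Ln; move: (ln _) => l; nra.
Qed.

End bumps.
End annuli_symbol.

Theorem theorem1p4 (R : realType) :
  [/\
    (forall (g : R[i] -> R)
        (mg : measurable_fun setT g) (g0 : forall z, 0 <= g z),
      [/\ form_bounded (fun z => (g z)%:C) <->
            Fock_Carleson (density (@mu R) mg g0),
          Fock_Carleson (density (@mu R) mg g0) <-> (gauss_sup g < +oo)%E &
          (gauss_sup g < +oo)%E <->
            (Lnorm (@area R) +oo%E (heat (4^-1)%R g) < +oo)%E]),
    (forall (g : R[i] -> R[i]) (mg : measurable_fun setT g),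
      (op_bounded g <->
         Fock_Carleson
           (density (@mu R) (measurable_sqr_normc mg) (sqr_normc_ge0 g))) /\
      (Fock_Carleson
         (density (@mu R) (measurable_sqr_normc mg) (sqr_normc_ge0 g)) <->
         (gauss_sup (fun z => normc (g z) ^+ 2)%R < +oo)%E)) &
    (forall (c1 : R) (psi : nat -> R[i] -> R),
      0 < c1 -> annular_bumps c1 psi ->
      let g := annuli_symbol psi in
      [/\ (forall t : R, 0 < t ->
             exists M : R, forall x, (`|heat t g x| <= M%:E)%E),
          (gauss_sup g < +oo)%E &
          ~ (gauss_sup (fun z => normc (g z)%:C ^+ 2)%R < +oo)%E])].
Proof.
split.
- move=> g mg g0; split; last exact: gauss_sup_Lnorm.
    by split; [exact: form_bounded_Carleson|exact: Carleson_form_bounded].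
  by split; [exact: Carleson_gauss_sup|exact: gauss_sup_Carleson].
- move=> g mg; split.
    by split; [exact: op_bounded_Carleson|exact: Carleson_op_bounded].
  by split; [exact: Carleson_gauss_sup|exact: gauss_sup_Carleson].
- move=> c1 psi c10 bumps g; split.
  + by move=> t t0; exact: heat_symbol_bounded bumps _ t0.
  + exact: gauss_sup_symbol bumps.
  + exact: gauss_sup_sqr_symbol c10 bumps.
Qed.
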